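(* Let $G$ be an extremal uniformly $3$-connected graph on $n=3k+\ell\ge 4$ vertices, where $k\in\mathbb{N}$ and $\ell\in\{-1,0,1\}$. Then $\operatorname{cr}(G)\le 1$, and if $n=4$ or $\ell\in\{-1,0\}$, then $G$ is planar.
   Context: All graphs are finite and simple. A graph on at least $k+1$ vertices is uniformly $k$-connected if each pair of its vertices is connected by $k$ and not more than $k$ independent paths. For a graph $G$, $\nu(G)$ is the number of vertices of $G$ whose degree equals the minimum degree of $G$. Every uniformly $3$-connected graph $G$ on $n$ vertices satisfies $\nu(G)\ge\lceil(2n+2)/3\rceil$; $G$ is called extremal if equality holds. $\operatorname{cr}(G)$ denotes the crossing number of $G$. *)

(* Defs.v *)
From mathcomp Require Import all_boot.
From Stdlib Require Import Reals.

Set Implicit Arguments.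
Unset Strict Implicit.
Unset Printing Implicit Defensive.

Section Graphs.
Variable T : finType.

Definition simple_graph (e : rel T) : Prop := symmetric e /\ irreflexive e.

Definition deg (e : rel T) (v : T) : nat := #|[set w | e v w]|.

Definition nu (e : rel T) : nat :=
  #|[set v | [forall w, deg e v <= deg e w]]|.

Definition uv_path (e : rel T) (u v : T) (p : seq T) : bool :=
  [&& path e u p, last u p == v & uniq (u :: p)].

Definition interior (v : T) (p : seq T) : seq T := [seq x <- p | x != v].

Definition indep_paths (e : rel T) (u v : T) (m : nat) : Prop :=
  exists ps : seq (seq T),
    [/\ size ps = m, uniq ps, all (uv_path e u v) ps &
        forall p q, p \in ps -> q \in ps -> p != q ->
          [disjoint interior v p & interior v q]].

Definition uniformly_connected (e : rel T) (k : nat) : Prop :=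
  k.+1 <= #|T| /\
  forall u v, u != v -> indep_paths e u v k /\ ~ indep_paths e u v k.+1.

End Graphs.

Section Drawings.
Local Open Scope R_scope.
Variable T : finType.

Definition cont_curve (g : R -> R * R) : Prop :=
  forall t, continuity_pt (fun s => fst (g s)) t /\
            continuity_pt (fun s => snd (g s)) t.

Definition is_drawing (e : rel T) (pos : T -> R * R)
    (arc : T -> T -> R -> R * R) : Prop :=
  injective pos /\
  forall x y, e x y ->
    cont_curve (arc x y) /\ arc x y 0 = pos x /\ arc x y 1 = pos y /\
    (forall s t, 0 <= s <= 1 -> 0 <= t <= 1 -> arc x y s = arc x y t -> s = t) /\
    (forall t z, 0 < t < 1 -> arc x y t <> pos z) /\
    (forall t, arc y x t = arc x y (1 - t)).

Definition crossing (e : rel T) (arc : T -> T -> R -> R * R)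
    (p : R * R) (x y u v : T) : Prop :=
  [/\ e x y, e u v, [set x; y] <> [set u; v],
      (exists s, 0 < s < 1 /\ arc x y s = p) &
      (exists t, 0 < t < 1 /\ arc u v t = p)].

(* the drawing has at most one crossing (a crossing = a point together with
   an unordered pair of distinct edges whose interiors meet there) *)
Definition at_most_one_crossing (e : rel T) (arc : T -> T -> R -> R * R) : Prop :=
  forall p x y u v p' x' y' u' v',
    crossing e arc p x y u v -> crossing e arc p' x' y' u' v' ->
    p = p' /\
    (([set x; y] = [set x'; y'] /\ [set u; v] = [set u'; v']) \/
     ([set x; y] = [set u'; v'] /\ [set u; v] = [set x'; y'])).

Definition no_crossing (e : rel T) (arc : T -> T -> R -> R * R) : Prop :=
  forall p x y u v, ~ crossing e arc p x y u v.

Definition cr_le1 (e : rel T) : Prop :=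
  exists pos arc, is_drawing e pos arc /\ at_most_one_crossing e arc.

Definition planar (e : rel T) : Prop :=
  exists pos arc, is_drawing e pos arc /\ no_crossing e arc.

End Drawings.

(* Main.v *)
Require Import Defs.
From Stdlib Require Import ZArith Reals Lra Classical ClassicalEpsilon.
From mathcomp Require Import all_boot zify.

(* Let b be the number of vertices of degree at least 4; the others are cubic.
   By Menger's theorem any two vertices are separated by three elements, each a
   vertex or an edge, and uncrossing such mixed separations shows that three
   edges suffice.  Contracting one side of a 3-edge cut to a cubic vertex keeps
   this property as well as 3-connectedness, so induction gives n >= 3b + 2, and
   G is extremal iff n - 3b - 2 is 0, 1 or 2.  If b >= 2, some 3-edge cut has a
   side with exactly one big vertex and only 4 or 5 vertices; this side is a
   wheel minus a rim vertex, i.e. a fan, so G arises from a smaller graph by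
   replacing a cubic vertex with a fan.  In a straight-line drawing the fan fits
   into a small disc around the replaced vertex without new crossings.  The
   graphs with b <= 1 are K_4, the wheels on 5, 6 and 7 vertices, and three
   graphs on 7 vertices in which deleting the big vertex leaves a theta graph;
   one of these three needs a crossing, and then n - 3b - 2 = 2. *)

Set Implicit Arguments.
Unset Strict Implicit.
Unset Printing Implicit Defensive.

(** * Menger's theorem *)

(** After Menger's theorem everything refers to cuts instead of paths: a path system is awkward to
    push through a contraction, while a cut of the quotient equals the cut between the preimages.
    This is why the induction runs on [uniform3], which keeps only the cut form of both halves of
    uniform 3-connectedness. The number n - 3b - 2 governs planarity. The leaf contracted in the
    final induction has 4 or 5 vertices, so n drops by 3 or 4 while b drops by 1, and n - 3b - 2
    never grows on the way to a base graph. The values l = -1, 0, 1 correspond to n - 3b - 2 = 0, 1,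
    2, so the nonplanar base graph, with n = 7 and b = 1, can be reached only for l = 1. Arguments
    about general curves are avoided: drawings stay straight throughout, and only the
    vertex-disjoint pairs of edges that meet are tracked. Expanding a vertex to a fan maps such
    pairs of the new drawing to such pairs of the old one, so one statement transports both
    planarity and the bound of one crossing. *)

Lemma subset_of_card (T : finType) (A : {set T}) (k : nat) :
  k <= #|A| -> exists2 W : {set T}, W \subset A & #|W| = k.
Proof.
move=> kA; exists [set x in take k (enum A)].
  by apply/subsetP => x; rewrite inE => /mem_take; rewrite mem_enum.
have/card_uniqP e : uniq (take k (enum A)) by rewrite take_uniq ?enum_uniq.
by rewrite cardsE e size_takel // -cardE.
Qed.

Section Menger.
Variable T : finType.
Implicit Types (e : rel T) (P Q A B W : {set T}).

(** Directed: no arc leaves A from a vertex outside B. The induction for Menger's theorem deletes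
    single arcs and also uses the reversed graph. *)
Definition separation e P Q A B : Prop :=
  [/\ P \subset A, Q \subset B, A :|: B = setT &
      forall x y, x \in A -> x \notin B -> e x y -> y \in A].

Definition walk e P w (s : seq T) : bool :=
  if s is x :: p then [&& x \in P, path e x p, last x p == w & uniq s]
  else false.

(** The disjoint walks are indexed by their last vertices, so two linkages ending in the same
    separator can be glued vertex by vertex. *)
Definition linked e P W : Prop :=
  exists f : T -> seq T, (forall w, w \in W -> walk e P w (f w)) /\
    forall w w', w \in W -> w' \in W -> w != w' -> [disjoint f w & f w'].

Lemma walk_mem e P w s : walk e P w s -> w \in s.
Proof. by case: s => // x p /and4P[_ _ /eqP <- _]; rewrite mem_last. Qed.

Lemma sub_linked e e' P W : subrel e e' -> linked e P W -> linked e' P W.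
Proof.
move=> sub [f [fw fd]]; exists f; split => // w /fw.
by case: (f w) => // x p /and4P[h1 h2 h3 h4]; apply/and4P; split => //; apply: sub_path h2.
Qed.

(** Glued walks are indexed by where they pass the separator; their last vertices are distinct by
    disjointness and can serve as indices instead. *)
Lemma linked_reindex e P Q (I : {set T}) (f : T -> seq T) :
  (forall i, i \in I -> exists2 w, w \in Q & walk e P w (f i)) ->
  (forall i j, i \in I -> j \in I -> i != j -> [disjoint f i & f j]) ->
  exists W, [/\ W \subset Q, #|W| = #|I| & linked e P W].
Proof.
move=> fw fd.
pose l i := last i (f i).
have lw i : i \in I -> l i \in Q /\ walk e P (l i) (f i).
  case/fw => w wQ; rewrite /l; case: (f i) => // x p.
  by case/and4P=> hx hp /eqP lw un; rewrite /= lw hx hp eqxx.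
have linj : {in I &, injective l}.
  move=> i j iI jI eq; apply/eqP; apply: contraT => ne.
  have /pred0P/(_ (l i)) := fd i j iI jI ne; rewrite /= (walk_mem (lw i iI).2).
  by rewrite eq (walk_mem (lw j jI).2).
pose g w := if [pick i in I | l i == w] is Some i then f i else [::].
have gl i : i \in I -> g (l i) = f i.
  move=> iI; rewrite /g; case: pickP => [j /andP[jI /eqP eq]|/(_ i)]; last by rewrite iI eqxx.
  by rewrite (linj _ _ jI iI eq).
exists (l @: I); split.
- by apply/subsetP => w /imsetP[i iI ->]; case: (lw i iI).
- by rewrite card_in_imset.
exists g; split => [w /imsetP[i iI ->]|w w' /imsetP[i iI ->] /imsetP[j jI ->] ne].
  by rewrite gl //; case: (lw i iI).
by rewrite !gl //; apply: fd => //; apply: contra ne => /eqP ->.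
Qed.

(** A step out of A has to start in [A :&: B], but the walk meets that set only at its end. *)
Lemma walk_stays e P Q A B w s : separation e P Q A B ->
  walk e P w s -> (forall z, z \in s -> z \in A :&: B -> z = w) ->
  {subset s <= A}.
Proof.
case=> PA _ _ AB; case: s => // x p /and4P[xP pth /eqP lst un] avoid.
have {xP PA} xA := subsetP PA _ xP.
elim: p x xA pth lst un avoid => [|y p IH] x xA /=; first by move=> _ _ _ _ z; rewrite inE => /eqP ->.
case/andP => exy pth lst /andP[xn un] avoid.
have yA : y \in A.
  apply: (AB x y) => //; apply/negP => xB.
  have xw : x = w by apply: avoid; rewrite ?inE ?eqxx ?xA.
  by move: xn; rewrite xw -lst -[y :: p]/(y :: p) mem_last.
move=> z; rewrite inE => /predU1P[-> //|zp].
apply: (IH y) zp => // t tp; apply: avoid; by rewrite inE tp orbT.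
Qed.

Lemma walk_rev e P w s : walk e P w s ->
  exists q p, [/\ q \in P, rev s = w :: p, path (fun x y => e y x) w p,
    last w p = q & uniq (w :: p)].
Proof.
case: s => // x p /and4P[xP pth /eqP lst un].
exists x, (rev (belast x p)).
have rs : rev (x :: p) = w :: rev (belast x p) by rewrite lastI lst rev_rcons.
split => //; last by rewrite -rs rev_uniq.
- by rewrite -lst rev_path.
by case: (p) lst => [/= <- //|y p' _ /=]; rewrite rev_cons last_rcons.
Qed.

(** Induction on the number of arcs. If deleting the arc from x to y creates a separation (A, B) of
    order below k, this arc is the only one from A outside B to B outside A, and S = [A :&: B]
    together with x, or with y, has exactly k elements. A linkage from P to S with x is joined to
    one from Q to S with y in the reversed graph. *)
Theorem menger e P Q (k : nat) :
  (forall A B, separation e P Q A B -> k <= #|A :&: B|) ->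
  exists W, [/\ W \subset Q, #|W| = k & linked e P W].
Proof.
move: {2}_.+1 (ltnSn #|[set p : T * T | e p.1 p.2]|) => n.
elim: n e P Q => // n IH e P Q en sepk.
have [[x y] /= exy|noe] := pickP (fun p : T * T => e p.1 p.2); last first.
  (* Without arcs, P and [~: P :|: Q] form a separation meeting in [P :&: Q], and trivial walks at
     these vertices suffice. *)
  have [|W WPQ Wk] := @subset_of_card _ (P :&: Q) k.
    have -> : P :&: Q = P :&: (~: P :|: Q) by rewrite setIUr setICr set0U.
    apply: sepk; split => //; first by rewrite subsetUr.
      by rewrite setUA setUCr setTU.
    by move=> x y _ _ exy; have := noe (x, y); rewrite /= exy.
  exists W; split => //; first exact: subset_trans WPQ (subsetIr _ _).
  exists (fun w => [:: w]); split => [w wW|w w' _ _ ne].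
    by rewrite /= eqxx !andbT; have := subsetP WPQ _ wW; rewrite inE => /andP[].
  by rewrite disjoint_has /= orbF inE.
pose e' := [rel a b | e a b && ((a, b) != (x, y))].
have e'e : subrel e' e by move=> a b /andP[].
have e'n : #|[set p : T * T | e' p.1 p.2]| < n.
  apply: (@leq_trans #|[set p : T * T | e p.1 p.2]|) => //.
  apply: proper_card; apply/properP; split.
    by apply/subsetP => p; rewrite !inE => /andP[].
  by exists (x, y); rewrite !inE /= ?eqxx ?andbF.
have [sepk'|] := classic (forall A B, separation e' P Q A B -> k <= #|A :&: B|).
  have [W [WQ Wk lW]] := IH e' P Q e'n sepk'.
  by exists W; split => //; apply: sub_linked lW.
case/not_all_ex_not => A /not_all_ex_not[B nAB].
have {nAB}[sAB ABk] : separation e' P Q A B /\ #|A :&: B| < k.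
  by have [h nh] := imply_to_and _ _ nAB; rewrite ltnNge; split => //; apply/negP.
have [PA QB ABT AB] := sAB.
have [/and3P[xA xB yA]|nxy] := boolP [&& x \in A, x \notin B & y \notin A]; last first.
  suff /sepk : separation e P Q A B by rewrite leqNgt ABk.
  split => // a b aA aB eab; have [[ax b_y]|ne] := eqVneq (a, b) (x, y).
    by move: nxy; rewrite -ax -b_y aA aB /= negbK.
  by apply: (AB a b) => //=; rewrite eab.
have yB : y \in B by have := in_setT y; rewrite -ABT inE (negPf yA).
pose S := A :&: B.
have cx : #|x |: S| = #|S|.+1 by rewrite cardsU1 inE (negPf xB) andbF.
have cy : #|y |: S| = #|S|.+1 by rewrite cardsU1 inE (negPf yA).
(* A separation (C, D) of P from S with x in the smaller graph yields the separation with sides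
   [A :&: C] and [B :|: D] in the full graph: x lies in D, so the deleted arc does no harm. *)
have [|W1 [W1S W1k [f1 [f1w f1d]]]] := IH e' P (x |: S) e'n.
  move=> C D [PC SD CDT CD].
  have xD : x \in D by apply: (subsetP SD); rewrite !inE eqxx.
  have {}SD z : z \in S -> z \in D by move=> zS; apply: (subsetP SD); rewrite inE zS orbT.
  apply: (@leq_trans #|(A :&: C) :&: (B :|: D)|).
    apply: sepk; split.
    - by rewrite subsetI PA.
    - exact: subset_trans QB (subsetUl _ _).
    - apply/setP => z; rewrite !inE.
      have := in_setT z; rewrite -{1}ABT inE; have := in_setT z; rewrite -{1}CDT inE.
      by do 4 case: (z \in _).
    move=> a b; rewrite !inE negb_or => /andP[aA aC] /andP[aB aD] eab.
    have e'ab : e' a b.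
      by rewrite /= eab; apply/negP => /eqP[ax _]; rewrite ax xD in aD.
    by rewrite (AB a b) // (CD a b).
  apply: subset_leq_card; apply/subsetP => z; rewrite !inE.
  case/andP => /andP[zA zC]; rewrite zC /= => /orP[zB|//].
  by apply: SD; rewrite inE zA.
have [||W2 [W2S W2k [f2 [f2w f2d]]]] := IH (fun a b => e' b a) Q (y |: S).
- apply: leq_ltn_trans e'n.
  pose sw (p : T * T) := (p.2, p.1).
  have swi : injective sw by move=> [a b] [c d] [-> ->].
  rewrite -(card_imset _ swi); apply: subset_leq_card.
  apply/subsetP => p /imsetP[[a b]]; rewrite !inE /= => h ->.
  by [].
- move=> C D [QC SD CDT CD].
  have yD : y \in D by apply: (subsetP SD); rewrite !inE eqxx.
  have {}SD z : z \in S -> z \in D by move=> zS; apply: (subsetP SD); rewrite inE zS orbT.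
  apply: (@leq_trans #|(A :|: D) :&: (B :&: C)|).
    apply: sepk; split.
    - exact: subset_trans PA (subsetUl _ _).
    - by rewrite subsetI QB.
    - apply/setP => z; rewrite !inE.
      have := in_setT z; rewrite -{1}ABT inE; have := in_setT z; rewrite -{1}CDT inE.
      by do 4 case: (z \in _).
    move=> a b; rewrite !inE negb_and => aAD aBC eab.
    have [//|/norP[bA bD]] := boolP ((b \in A) || (b \in D)).
    have bB : b \in B by have := in_setT b; rewrite -ABT inE (negPf bA).
    have bC : b \in C by have := in_setT b; rewrite -CDT inE (negPf bD) orbF.
    have e'ab : e' a b by rewrite /= eab; apply/negP => /eqP[_ b_y]; rewrite b_y yD in bD.
    have aC := CD b a bC bD e'ab.
    move: aBC; rewrite aC orbF => aB.
    have aA : a \in A by have := in_setT a; rewrite -ABT inE (negPf aB) orbF.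
    by rewrite (AB a b aA aB e'ab) in bA.
  apply: subset_leq_card; apply/subsetP => z; rewrite !inE.
  case/andP => /orP[zA|->]; case/andP => zB -> //.
  by rewrite SD ?inE ?zA.
have Sk : #|S|.+1 = k.
  by apply/eqP; rewrite eqn_leq ABk -W1k -cx; apply: subset_leq_card.
have {W1S}W1E : W1 = x |: S by apply/eqP; rewrite eqEcard W1S W1k cx Sk leqnn.
have {W2S}W2E : W2 = y |: S by apply/eqP; rewrite eqEcard W2S W2k cy Sk leqnn.
subst W1 W2.
have f1S w z : w \in x |: S -> z \in f1 w -> z \in x |: S -> z = w.
  move=> wS zf zS; apply/eqP; apply: contraT => ne.
  have /pred0P/(_ z) := f1d z w zS wS ne.
  by rewrite /= zf (walk_mem (f1w z zS)).
have f2S w z : w \in y |: S -> z \in f2 w -> z \in y |: S -> z = w.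
  move=> wS zf zS; apply/eqP; apply: contraT => ne.
  have /pred0P/(_ z) := f2d z w zS wS ne.
  by rewrite /= zf (walk_mem (f2w z zS)).
have f1A w : w \in x |: S -> {subset f1 w <= A}.
  move=> wS; apply: (walk_stays sAB (f1w w wS)) => z zf zS.
  by apply: (f1S w) => //; rewrite inE zS orbT.
have sBA : separation (fun a b => e' b a) Q P B A.
  split => //; first by rewrite setUC.
  move=> a b aB aA eba; apply: contraT => bB.
  have bA : b \in A by have := in_setT b; rewrite -ABT inE (negPf bB) orbF.
  by rewrite (AB b a bA bB eba) in aA.
have f2B w : w \in y |: S -> {subset f2 w <= B}.
  move=> wS; apply: (walk_stays sBA (f2w w wS)) => z zf zS.
  by apply: (f2S w) => //; rewrite in_setU /S setIC zS orbT.
(* [t] pairs the ends of the two linkages: x continues at y through the deleted arc, a vertex of S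
   continues at itself and is dropped from the second half. *)
pose t w := if w == x then y else w.
have tS w : w \in x |: S -> t w \in y |: S.
  by rewrite /t !in_setU !in_set1; case: (w == x) => /= [|->]; rewrite ?eqxx ?orbT.
pose g w := f1 w ++ (if w == x then rev (f2 y) else behead (rev (f2 w))).
have gmem w z : z \in g w -> (z \in f1 w) || (z \in f2 (t w)).
  rewrite /g /t mem_cat; case: (z \in f1 w) => //=; case: (w == x); first by rewrite mem_rev.
  by move/mem_behead; rewrite mem_rev.
have fmeet w w' z : w \in x |: S -> w' \in x |: S -> z \in f1 w -> z \in f2 (t w') ->
  [/\ z = w, z = w' & z \in S].
  move=> wS w'S z1 z2.
  have zS : z \in S by rewrite inE (f1A w) // (f2B (t w')) // tS.
  have -> := f1S w z wS z1; last by rewrite inE zS orbT.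
  have zt : z = t w' by apply: f2S z2 _; rewrite ?tS // inE zS orbT.
  have zw : z = w by apply: f1S z1 _; rewrite // inE zS orbT.
  split; rewrite -?zw // zt /t; case: eqP => // w'x.
  by move: zS; rewrite zt /t w'x eqxx inE (negPf yA).
have [||W' [W'Q W'k lW']] := @linked_reindex e P Q (x |: S) g; last first.
- by exists W'; split => //; rewrite W'k cx.
- move=> i j iS jS /eqP ij; apply/pred0P => z /=; apply/negbTE/negP => /andP[zi zj].
  apply: ij.
  case/orP: (gmem _ _ zi) => z1; case/orP: (gmem _ _ zj) => z2.
  + apply/eqP; apply: contraT => ne.
    by have /pred0P/(_ z) := f1d i j iS jS ne; rewrite /= z1 z2.
  + by case: (fmeet i j z) => // -> ->.
  + by case: (fmeet j i z) => // -> ->.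
  + have [eqt|ne] := eqVneq (t i) (t j); last first.
      by have /pred0P/(_ z) := f2d _ _ (tS i iS) (tS j jS) ne; rewrite /= z1 z2.
    move: eqt iS jS; rewrite /t !inE.
    have [->|_] := eqVneq i x; have [->|_] := eqVneq j x => //.
      by move=> <-; rewrite (negPf yA) !orbF.
    by move=> ->; rewrite (negPf yA) !orbF.
move=> w wS.
have wx : (w == x) = (w \notin S).
  by move: wS; rewrite !inE; case: eqP => [->|_ /= -> //]; rewrite (negPf xB) andbF.
have [q [p [qQ rE pth lst un]]] := walk_rev (f2w _ (tS w wS)).
exists q => //.
have sw := f1w w wS; move: sw; rewrite /g.
case E: (f1 w) => [|a s] // /and4P[aP aps /eqP las uas].
have pd : {subset p <= f2 (t w)}.
  by move=> z zp; rewrite -mem_rev rE inE zp orbT.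
have nmeet : w \in S -> ~~ has (mem (a :: s)) p.
  move=> wS'; apply/hasPn => z zp; apply/negP => /= z1.
  have [zw _ _] : [/\ z = w, z = w & z \in S] by apply: fmeet => //; [rewrite E | apply: pd].
  by move: un; rewrite /t wx wS' /= -zw zp.
move: rE pth lst un pd; rewrite /t; case: ifP => wx'; rewrite ?wx' => rE pth lst un pd; rewrite rE.
  have wnS : w \notin S by rewrite -wx wx'.
  apply/and4P; split => //.
  - rewrite cat_path (sub_path e'e aps) las /= (eqP wx') exy /=.
    by apply: sub_path pth => b c /andP[].
  - by rewrite last_cat /= lst.
  rewrite cat_uniq uas un andbT -rE has_rev.
  apply/hasPn => z z2; apply/negP => /= z1.
  have [zw _ zS] : [/\ z = w, z = w & z \in S].
    by apply: fmeet => //; [rewrite E | rewrite /t wx'].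
  by rewrite -zw zS in wnS.
have wS' : w \in S by move: wx; rewrite wx' => /esym/negbFE.
apply/and4P; split => //.
- by rewrite cat_path (sub_path e'e aps) las /=; apply: sub_path pth => b c /andP[].
- by rewrite last_cat las lst.
by rewrite cat_uniq uas nmeet //=; case/andP: un.
Qed.

End Menger.

(** * Mixed separations *)

Section Cuts.
Variables (T : finType) (e : rel T).
Implicit Types (A B X Y : {set T}).

Definition cut A B : nat :=
  \sum_(p : T * T) ([&& p.1 \in A, p.2 \in B & e p.1 p.2] : nat).

(* The order of the mixed separation [(A, B)]: separating vertices plus separating edges. *)
Definition ordr A B : nat := #|~: (A :|: B)| + cut A B.

(** Counting separating edges along with vertices makes the condition compatible with contraction.
    It is vacuous on a single vertex, hence the hypotheses [1 < #|T|] further on. *)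
Definition three_connected : Prop :=
  forall A B, A != set0 -> B != set0 -> [disjoint A & B] -> 3 <= ordr A B.

Definition edge_separable : Prop :=
  forall u v, u != v -> exists Y, [/\ u \in Y, v \notin Y & cut Y (~: Y) <= 3].

Lemma card_sum (I : finType) (A : {set I}) : #|A| = \sum_(z : I) (z \in A : nat).
Proof. by rewrite -sum1_card big_mkcond. Qed.

Lemma cut_card A B :
  cut A B = #|[set p : T * T | [&& p.1 \in A, p.2 \in B & e p.1 p.2]]|.
Proof. by rewrite card_sum; apply: eq_bigr => p _; rewrite inE. Qed.

Lemma cutS A B A' B' : A \subset A' -> B \subset B' -> cut A B <= cut A' B'.
Proof.
move=> /subsetP sA /subsetP sB; apply: leq_sum => -[x y] _ /=.
case xA: (x \in A) => //; case yB: (y \in B) => //.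
by rewrite (sA _ xA) (sB _ yB).
Qed.

Lemma cutUl A A' B : [disjoint A & A'] -> cut (A :|: A') B = cut A B + cut A' B.
Proof.
move=> /pred0P dis; rewrite /cut -big_split; apply: eq_bigr => -[x y] _ /=.
by have /= := dis x; rewrite inE; case: (x \in A); case: (x \in A') => //=; rewrite ?addn0.
Qed.

Lemma cut_row A B : cut A B = \sum_(x in A) #|[set y in B | e x y]|.
Proof.
rewrite /cut -(pair_bigA _ (fun x y => ([&& x \in A, y \in B & e x y] : nat))) /= [RHS]big_mkcond.
apply: eq_bigr => x _; case: (x \in A) => /=; last by rewrite big1.
by rewrite card_sum; apply: eq_bigr => y _; rewrite inE.
Qed.

Lemma cut1l x B : cut [set x] B = #|[set y in B | e x y]|.
Proof. by rewrite cut_row big_set1. Qed.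

Lemma deg_cut x : deg e x = cut [set x] setT.
Proof. by rewrite cut1l /deg; apply: eq_card => y; rewrite !inE. Qed.

(** Both inequalities hold vertex by vertex and pair by pair. The extra term counts edges that
    contribute to [cut A' B'] but to neither corner; this surplus later bounds the neighbours of a
    separator vertex. *)
Lemma ordr_submod A B A' B' : [disjoint A & B] -> [disjoint A' & B'] ->
  ordr (A :&: A') (B :|: B') + ordr (A :|: A') (B :&: B') + cut (A' :&: B) (B' :\: B)
    <= ordr A B + ordr A' B'.
Proof.
move=> /pred0P dis /pred0P dis'.
suff : #|~: (A :&: A' :|: (B :|: B'))| + #|~: (A :|: A' :|: (B :&: B'))|
    <= #|~: (A :|: B)| + #|~: (A' :|: B')| /\
  cut (A :&: A') (B :|: B') + cut (A :|: A') (B :&: B') + cut (A' :&: B) (B' :\: B)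
    <= cut A B + cut A' B' by rewrite /ordr; lia.
split.
  rewrite !card_sum -!big_split; apply: leq_sum => z _ /=; rewrite !inE.
  have /= := dis z; have /= := dis' z.
  by case: (z \in A); case: (z \in B); case: (z \in A'); case: (z \in B').
rewrite /cut -!big_split; apply: leq_sum => -[x y] _ /=; rewrite !inE.
case: (e x y); rewrite ?andbF //= !andbT.
have /= := dis x; have /= := dis' y.
by case: (x \in A); case: (x \in B); case: (x \in A'); case: (y \in B); case: (y \in B').
Qed.

Hypothesis sym : symmetric e.

Lemma cutC A B : cut A B = cut B A.
Proof.
rewrite /cut -(pair_bigA _ (fun x y => ([&& x \in A, y \in B & e x y] : nat))) exchange_big /=.
rewrite (pair_bigA _ (fun x y => ([&& y \in A, x \in B & e y x] : nat))) /=.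
by apply: eq_bigr => -[x y] _ /=; rewrite sym andbCA.
Qed.

Lemma cut_uncrossI X Y :
  cut (X :&: Y) (~: (X :&: Y)) + cut (X :|: Y) (~: (X :|: Y))
    <= cut X (~: X) + cut Y (~: Y).
Proof.
rewrite /cut -!big_split; apply: leq_sum => -[x y] _ /=; rewrite !inE.
case: (e x y); rewrite ?andbF //= !andbT.
by case: (x \in X); case: (y \in X); case: (x \in Y); case: (y \in Y).
Qed.

Lemma cut_uncrossD X Y :
  cut (X :\: Y) (~: (X :\: Y)) + cut (Y :\: X) (~: (Y :\: X))
    <= cut X (~: X) + cut Y (~: Y).
Proof.
have E : X :|: ~: Y = ~: (Y :\: X).
  by apply/setP => z; rewrite !inE; case: (z \in X); case: (z \in Y).
by have := cut_uncrossI X (~: Y); rewrite -setDE E !setCK (cutC (~: Y)) (cutC (~: (Y :\: X))).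
Qed.

(* Minimality of [A], then maximality of [B], makes every separator vertex
   have at most one neighbour in [B]; trading each for that edge turns the
   mixed separation into an edge cut. *)
Lemma separable_edge : three_connected ->
  (forall u v, u != v -> exists A B,
    [/\ u \in A, v \in B, [disjoint A & B] & ordr A B <= 3]) ->
  edge_separable.
Proof.
move=> K3 U u v uv.
pose P (p : {set T} * {set T}) :=
  [&& u \in p.1, v \in p.2, [disjoint p.1 & p.2] & ordr p.1 p.2 <= 3].
have [A0 [B0 [uA0 vB0 d0 o0]]] := U u v uv.
have P0 : P (A0, B0) by apply/and4P.
(* The factor [#|T|.+1] makes the weight lexicographic: A is smallest, and then B is largest. *)
case: (arg_minnP (fun p : {set T} * {set T} => #|p.1| * #|T|.+1 + #|~: p.2|) P0) => -[A B].
case/and4P => /= uA vB dAB oAB mn.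
have mnAB A2 B2 : P (A2, B2) -> A2 \subset A -> A2 = A /\ #|~: B| <= #|~: B2|.
  move=> /mn /= le sA.
  have sAc := subset_leq_card sA.
  have eA : A2 = A.
    apply/eqP; rewrite eqEcard sA /= leqNgt; apply/negP => lt.
    have : #|A2|.+1 * #|T|.+1 <= #|A| * #|T|.+1 by rewrite leq_mul2r lt orbT.
    have : #|~: B2| <= #|T| := max_card _; rewrite mulSn => h1 h2.
    have := leq_trans h2 (leq_trans (leq_addr _ _) (leq_trans le (leq_add (leqnn _) h1))).
    by rewrite addSn addnC ltnn.
  by split => //; move: le; rewrite eA leq_add2l.
have one s : s \notin A -> s \notin B -> cut [set s] B <= 1.
  move=> sA sB.
  have us : u != s by apply: contraNneq sA => <-.
  have [A' [B' [uA' sB' dAB' oAB']]] := U u s us.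
  have sm := ordr_submod dAB dAB'.
  have dI : [disjoint A :&: A' & B :|: B'].
    apply/pred0P => z /=; rewrite !inE.
    have /= := pred0P dAB z; have /= := pred0P dAB' z.
    by case: (z \in A); case: (z \in B); case: (z \in A'); case: (z \in B').
  (* A corner of order at most 3 would either shrink A or, with A unchanged, enlarge B by s. *)
  have big : 3 < ordr (A :&: A') (B :|: B').
    rewrite ltnNge; apply/negP => small.
    have [] := mnAB (A :&: A') (B :|: B'); rewrite ?subsetIl //.
      by apply/and4P; split => //=; rewrite !inE ?uA ?uA' ?vB.
    move=> _ le.
    have : ~: (B :|: B') \proper ~: B.
      apply/properP; split; first by rewrite setCS subsetUl.
      by exists s; rewrite !inE ?sB ?sB' ?orbT.
    by move/proper_card; rewrite ltnNge le.
  (* Submodularity leaves order at most 2 for the opposite corner, which 3-connectedness permits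
     only if a side is empty. *)
  have BB0 : B :&: B' = set0.
    apply/eqP; apply: contraT => nBB.
    have : 3 <= ordr (A :|: A') (B :&: B').
      apply: K3 => //; first by apply/set0Pn; exists u; rewrite inE uA.
      apply/pred0P => z /=; rewrite !inE.
      have /= := pred0P dAB z; have /= := pred0P dAB' z.
      by case: (z \in A); case: (z \in B); case: (z \in A'); case: (z \in B').
    by move: sm oAB oAB' big; clear; lia.
  (* With [B :&: B'] empty, the vertices of [B :\: A'] and s itself are separator vertices of this
     corner. *)
  have oU : ordr (A :|: A') (B :&: B') >= #|B :\: A'| + 1.
    rewrite /ordr BB0 setU0 -(cards1 s) -cardsUI.
    apply: (@leq_trans #|~: (A :|: A')|); last by rewrite leq_addr.
    have -> : (B :\: A') :&: [set s] = set0.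
      by apply/setP => z; rewrite !inE; case: eqP => [->|]; rewrite ?(negPf sB) ?andbF.
    rewrite cards0 addn0; apply: subset_leq_card; apply/subsetP => z; rewrite !inE negb_or.
    have /= := pred0P dAB z.
    move=> dz /orP[/andP[zA' zB]|/eqP ->].
      by move: dz; rewrite zB andbT zA' => ->.
    by rewrite sA /=; have /= := pred0P dAB' s; rewrite sB' andbT => ->.
  (* Edges from s into [A' :&: B] belong to the surplus of submodularity; those into [B :\: A'] are
     paid for by the separator vertices just counted. *)
  have c1 : cut [set s] (A' :&: B) <= cut (A' :&: B) (B' :\: B).
    by rewrite cutC; apply: cutS => //; rewrite sub1set inE sB sB'.
  have c2 : cut [set s] (B :\: A') <= #|B :\: A'|.
    by rewrite cut1l; apply: subset_leq_card; apply/subsetP => z; rewrite inE => /andP[].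
  have c3 : cut [set s] B = cut [set s] (A' :&: B) + cut [set s] (B :\: A').
    rewrite !(cutC [set s]) -cutUl; first by rewrite [A' :&: B]setIC setID.
    by apply/pred0P => z /=; rewrite !inE; case: (z \in A'); rewrite ?andbF.
  by move: sm oAB oAB' big oU c1 c2 c3; clear; lia.
exists (~: B); split; rewrite ?inE ?negbK //.
  by have /= := pred0P dAB u; rewrite uA /= => ->.
rewrite setCK.
have -> : ~: B = A :|: ~: (A :|: B).
  apply/setP => z; rewrite !inE; have /= := pred0P dAB z.
  by case: (z \in A); case: (z \in B).
rewrite cutUl; last first.
  by apply/pred0P => z /=; rewrite !inE; case: (z \in A).
apply: leq_trans oAB; rewrite /ordr addnC leq_add2r cut_row -sum1_card.
apply: leq_sum => s; rewrite !inE negb_or => /andP[sA sB].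
by rewrite -cut1l; apply: one.
Qed.

End Cuts.

(** * Independent paths and mixed separations *)

Section Paths.
Variables (T : finType) (e : rel T).
Implicit Types (A B : {set T}).

Lemma path_crosses A B u (p : seq T) : path e u p -> u \in A ->
  last u p \in B -> [disjoint A & B] -> all [in A :|: B] p ->
  exists x y, [/\ (x, y) \in zip (u :: p) p, x \in A, y \in B & e x y].
Proof.
move=> pth uA lB dis; elim: p u pth uA lB => [|a p IH] u /=.
  by move=> _ uA uB _; have /= := pred0P dis u; rewrite uA uB.
case/andP => eua pth uA lB /andP[aAB alp].
have [aB|aB] := boolP (a \in B).
  by exists u, a; rewrite inE eqxx.
have aA : a \in A by move: aAB; rewrite inE (negPf aB) orbF.
have [x [y [xy xA yB exy]]] := IH a pth aA lB alp.
by exists x, y; split => //; rewrite inE xy orbT.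
Qed.

Lemma mem_zip2 (s t : seq T) x y : (x, y) \in zip s t -> x \in s /\ y \in t.
Proof.
elim: s t => [|a s IH] [|b t] //=; rewrite inE => /predU1P[[-> ->]|/IH[xs yt]].
  by rewrite !inE !eqxx.
by rewrite !inE xs yt !orbT.
Qed.

(** Every path uses a separator vertex or an edge from A to B, and [phi] selects one. Distinct paths
    share only u and v, so a shared element could only be the edge uv, and then both paths are
    [[:: v]]. *)
Lemma indep_ordr A B u v m : indep_paths e u v m -> u \in A -> v \in B ->
  [disjoint A & B] -> m <= ordr e A B.
Proof.
case=> ps [<- ups /allP psP dis] uA vB dAB.
have nv z : z \in A -> z != v.
  by move=> zA; apply/negP => /eqP zv; have /= := pred0P dAB z; rewrite zA zv vB.
pose good (c : T + T * T) (p : seq T) := match c with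
  | inl z => (z \in p) && (z \notin A :|: B)
  | inr (x, y) => [&& (x, y) \in zip (u :: p) p, x \in A, y \in B & e x y] end.
have ex p : exists c, p \in ps -> good c p.
  have [pps|] := boolP (p \in ps); last by exists (inl u).
  have /and3P[pth lst un] := psP p pps.
  have [alp|] := boolP (all [in A :|: B] p).
    have [|x [y [xy xA yB exy]]] := path_crosses pth uA _ dAB alp; first by rewrite (eqP lst).
    by exists (inr (x, y)) => _; apply/and4P.
  by case/allPn => z zp zAB; exists (inl z) => _; rewrite /= zp.
have {ex}[phi phiP] : exists phi, forall p, p \in ps -> good (phi p) p.
  exists (fun p => proj1_sig (constructive_indefinite_description _ (ex p))) => p.
  exact: proj2_sig (constructive_indefinite_description _ (ex p)).
pose cs := map inl (enum (~: (A :|: B))) ++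
  map inr (enum [set p : T * T | [&& p.1 \in A, p.2 \in B & e p.1 p.2]]).
have -> : ordr e A B = size cs by rewrite size_cat !size_map -!cardE /ordr cut_card.
rewrite -(size_map phi); apply: uniq_leq_size; last first.
  move=> c /mapP[p pps ->]; have := phiP p pps; case: (phi p) => [z|[x y]] /=.
    by case/andP => _ zn; rewrite mem_cat map_f // mem_enum inE.
  by case/and4P => _ xA yB exy; rewrite mem_cat map_f ?orbT // mem_enum inE xA yB.
rewrite map_inj_in_uniq // => p q pps qps epq; apply/eqP; apply: contraT => npq.
have nint z : z != v -> z \in p -> z \in q -> False.
  move=> zv zp zq; have /= := pred0P (dis p q pps qps npq) z.
  by rewrite !mem_filter zv zp zq.
have := phiP p pps; have := phiP q qps; rewrite epq; case: (phi q) => [z|[x y]] /=.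
  case/andP => zq zn /andP[zp _]; case: (@nint z) => //.
  by apply: contraNneq zn => ->; rewrite inE vB orbT.
case/and4P => xyq xA yB exy /and4P[xyp _ _ _].
have [xup yp] := mem_zip2 xyp; have [xuq yq] := mem_zip2 xyq.
have xu : x = u.
  move: xup xuq; rewrite !inE; case: eqP => //= _ xp xq.
  by case: (@nint x) => //; apply: nv.
have yv : y = v by apply/eqP; apply: contraT => yv; case: (@nint y).
have single r : r \in ps -> (x, y) \in zip (u :: r) r -> r = [:: v].
  move=> rps; have /and3P[_] := psP r rps; rewrite xu yv.
  case: r {rps} => [|a r] //= lst; rewrite !inE negb_or -andbA => /and3P[ua ur /andP[ar un]].
  case/predU1P => [[va]|/mem_zip2[]]; last by rewrite inE (negPf ua) (negPf ur).
  move: ar lst; rewrite -va; case: r {ur un} => //= b r.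
  by rewrite inE negb_or => /andP[vb vr] /eqP lv; move: (mem_last b r); rewrite lv inE (negPf vb) (negPf vr).
by move: npq; rewrite (single p) // (single q) // eqxx.
Qed.

Lemma uniformly_connected_three : uniformly_connected e 3 -> three_connected e.
Proof.
case=> _ uc A B /set0Pn[u uA] /set0Pn[v vB] dis.
have uv : u != v.
  by apply/negP => /eqP uv; have /= := pred0P dis u; rewrite uA uv vB.
by have [ip _] := uc u v uv; apply: (indep_ordr ip).
Qed.

Hypotheses (sym : symmetric e) (irr : irreflexive e).

(** Menger's theorem is applied between the neighbourhoods of u and v with both vertices deleted. An
    edge uv is a path by itself, hence [k.+1 - e u v]; if the linkage fails, uv is also the only
    edge that can run between the two sides built from the small separator. *)
Lemma indep_paths_or_cut (u v : T) k : u != v -> ~ indep_paths e u v k.+1 ->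
  exists A B, [/\ u \in A, v \in B, [disjoint A & B] & ordr e A B <= k].
Proof.
move=> uv nip.
pose out x := (x != u) && (x != v).
pose e0 := [rel x y | [&& e x y, out x & out y]].
pose P := [set x | e u x & out x].
pose Q := [set x | e v x & out x].
have [sep|] := classic (forall A B, separation e0 P Q A B -> k.+1 - e u v <= #|A :&: B|).
  case: nip; have [W [WQ Wk [f [fw fd]]]] := menger sep.
  have fW w : w \in W -> w = last u (f w) /\ all out (f w).
    move=> wW; have := fw w wW; case: (f w) => // x p /and4P[xP pth /eqP lst _].
    split => //=; move: xP; rewrite inE => /andP[_ xo]; rewrite xo /=.
    by elim: p x xo {lst} pth => //= a p IH x xo /andP[/and3P[_ _ ao] /IH ->]; rewrite ?ao.
  pose g w := rcons (f w) v.
  have gi w : Defs.interior v (g w) = f w \/ w \notin W.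
    have [wW|] := boolP (w \in W); last by right.
    left; rewrite /Defs.interior filter_rcons eqxx /=; apply/all_filterP.
    by apply: sub_all (fW w wW).2 => z /andP[].
  have ginj : {in W &, injective g}.
    move=> w w' wW wW'; rewrite /g => /rcons_inj[fe].
    by apply: etrans (fW w wW).1 _; rewrite fe -(fW w' wW').1.
  exists (map g (enum W) ++ nseq (e u v) [:: v]); split.
  - rewrite size_cat size_map size_nseq -cardE Wk.
    by case: (e u v); rewrite ?subn0 ?addn0 // subn1 addn1.
  - rewrite cat_uniq map_inj_in_uniq ?enum_uniq /=; last first.
      by move=> w w'; rewrite !mem_enum; apply: ginj.
    apply/andP; split; last by case: (e u v).
    apply/hasPn => s; rewrite mem_nseq => /andP[_ /eqP ->] /=.
    apply/mapP => -[w]; rewrite mem_enum => wW.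
    rewrite /g -[[:: v]]/(rcons [::] v) => /rcons_inj[f0].
    by have := fw w wW; rewrite -f0.
  - rewrite all_cat; apply/andP; split; last first.
      apply/allP => s; rewrite mem_nseq => /andP[euv /eqP ->].
      by rewrite /uv_path /= inE eqxx uv !andbT; case: (e u v) euv.
    apply/allP => s /mapP[w]; rewrite mem_enum => wW ->.
    have [lw alo] := fW w wW; have := fw w wW.
    rewrite /uv_path /g; case E: (f w) lw alo => [|x p] //= lw /andP[xo po].
    rewrite inE => /and4P[/andP[eux _] pth _ /andP[xp up]].
    move: (xo) => /andP[xu xv].
    have np z : z \in p -> out z by move/(allP po).
    rewrite eux rcons_path last_rcons eqxx rcons_uniq !mem_rcons !inE.
    have -> : path e x p by apply: sub_path pth => a b /and3P[].
    have : last x p \in Q by rewrite -lw; apply: (subsetP WQ).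
    rewrite inE sym => /andP[-> _] /=.
    have un : u \notin p by apply/negP => /np /andP[]; rewrite eqxx.
    have vn : v \notin p by apply/negP => /np /andP[_]; rewrite eqxx.
    rewrite ?(eq_sym u x) ?(eq_sym v x) ?(eq_sym v u).
    by rewrite mem_rcons inE (negPf uv) (negPf xu) (negPf xv) (negPf un) (negPf vn) xp up.
  move=> p q; rewrite !mem_cat => /orP[/mapP[w]|]; last first.
    rewrite mem_nseq => /andP[_ /eqP ->] _ _; apply/pred0P => z /=.
    by rewrite /Defs.interior /= eqxx.
  rewrite mem_enum => wW -> /orP[/mapP[w']|]; last first.
    rewrite mem_nseq => /andP[_ /eqP ->] _; apply/pred0P => z /=.
    by rewrite /Defs.interior /= eqxx andbF.
  rewrite mem_enum => wW' -> ne.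
  case: (gi w) => [->|]; last by rewrite wW.
  case: (gi w') => [->|]; last by rewrite wW'.
  by apply: fd => //; apply: contraNneq ne => ->.
case/not_all_ex_not => A /not_all_ex_not[B nAB].
have [[PA QB ABT AB] nk] := imply_to_and _ _ nAB.
have {nAB nk}ABk : #|A :&: B| < k.+1 - e u v by rewrite ltnNge; apply/negP.
pose A1 := u |: (A :\: B :\ v); pose B1 := v |: (B :\: A :\ u).
exists A1, B1; split; rewrite ?inE ?eqxx //.
  apply/pred0P => z /=; rewrite !inE.
  have [->|] := eqVneq z u; first by rewrite (negPf uv).
  have [->|] := eqVneq z v => //=.
  by case: (z \in A); case: (z \in B).
have sS : #|~: (A1 :|: B1)| <= #|A :&: B|.
  apply: subset_leq_card; apply/subsetP => z; rewrite !inE.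
  have := in_setT z; rewrite -ABT inE.
  by case: (z \in A); case: (z \in B); case: (z == u); case: (z == v).
suff : cut e A1 B1 <= e u v by rewrite /ordr; lia.
have euv1 : #|[set p in [:: (u, v)] | e p.1 p.2]| <= e u v.
  case euv: (e u v).
    apply: (@leq_trans #|[set (u, v)]|); last by rewrite cards1.
    by apply: subset_leq_card; apply/subsetP => p; rewrite !inE => /andP[].
  rewrite leqn0 cards_eq0; apply/eqP/setP => p; rewrite !inE.
  by case: eqP => // ->; rewrite /= euv.
apply: leq_trans euv1; rewrite cut_card; apply: subset_leq_card.
apply/subsetP => -[x y]; rewrite !inE /=.
case/and3P => xA yB exy; rewrite exy andbT xpair_eqE.
have inP z : e u z -> z != u -> z != v -> z \in A.
  by move=> euz zu zv; apply: (subsetP PA); rewrite inE euz /out zu zv.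
have inQ z : e v z -> z != u -> z != v -> z \in B.
  by move=> euz zu zv; apply: (subsetP QB); rewrite inE euz /out zu zv.
case/predU1P: xA => [xu|/and3P[xv xB xA]].
  case/predU1P: yB => [yv|/and3P[yu yA yB]]; first by rewrite xu yv !eqxx.
  have [yv|yv] := eqVneq y v; first by rewrite xu eqxx.
  by rewrite inP // -xu in yA.
case/predU1P: yB => [yv|/and3P[yu yA yB]].
  have [xu|xu] := eqVneq x u; first by rewrite yv eqxx.
  by rewrite inQ // sym -yv in xB.
have [xu|xu] := eqVneq x u.
  have [yv|yv] := eqVneq y v => //; by rewrite inP // -xu in yA.
have [yv|yv] := eqVneq y v; first by rewrite inQ // sym -yv in xB.
by rewrite (AB x y) // /e0 /= exy /out xu xv yu yv in yA.
Qed.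

Theorem uniformly_connected_separable : uniformly_connected e 3 -> edge_separable e.
Proof.
move=> uc; apply: separable_edge => //; first exact: uniformly_connected_three.
move=> u v uv; apply: indep_paths_or_cut => //.
by case: uc => _ /(_ u v uv)[].
Qed.

End Paths.

(** * Contracting one side of a 3-edge cut *)

Definition uniform3 (T : finType) (e : rel T) : Prop :=
  [/\ symmetric e, irreflexive e, three_connected e & edge_separable e].

Definition big (T : finType) (e : rel T) : {set T} := [set v | 3 < deg e v].

Definition boundary (T : finType) (e : rel T) (X : {set T}) : nat := cut e X (~: X).

Lemma setC_neq0 (T : finType) (X : {set T}) : X != setT -> ~: X != set0.
Proof. by apply: contraNneq => X0; rewrite -[X]setCK X0 setC0. Qed.

Lemma boundary1 (T : finType) (e : rel T) (x : T) : irreflexive e ->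
  boundary e [set x] = deg e x.
Proof.
move=> irr; rewrite /boundary cut1l; apply: eq_card => y; rewrite !inE.
by case: eqP => // ->; rewrite irr.
Qed.

(** * Three-edge cuts and leaves *)

Section Uniform3.
Variables (T : finType) (e : rel T).
Hypothesis ue : uniform3 e.
Implicit Types (X Y Z : {set T}).

Let sym : symmetric e. Proof. by case: ue. Qed.
Let irr : irreflexive e. Proof. by case: ue. Qed.
Let K3 : three_connected e. Proof. by case: ue. Qed.

Lemma boundary_ge3 X : X != set0 -> X != setT -> 3 <= boundary e X.
Proof.
move=> X0 XT; have -> : boundary e X = ordr e X (~: X).
  by rewrite /ordr setUCr setCT cards0.
by apply: K3 => //; [exact: setC_neq0 | rewrite disjoints_subset setCK].
Qed.

Lemma boundaryC X : boundary e (~: X) = boundary e X.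
Proof. by rewrite /boundary setCK cutC. Qed.

(** Moving x into the separator trades its edges across X for one vertex; the order must stay at
    least 3, so there is at most one such edge. Applied to both sides, this makes a 3-edge cut a
    matching. *)
Lemma boundary_matching X x : 1 < #|X| -> X != setT -> boundary e X <= 3 -> x \in X ->
  cut e [set x] (~: X) <= 1.
Proof.
move=> X1 XT bX xX.
have : 3 <= ordr e (X :\ x) (~: X).
  apply: K3; first by rewrite -card_gt0; move: X1; rewrite (cardsD1 x) xX.
    exact: setC_neq0.
  by apply/pred0P => z /=; rewrite !inE; case: (z \in X); rewrite ?andbF.
move: bX; rewrite /boundary -{1}(setD1K xX) cutUl; last first.
  by rewrite disjoints_subset sub1set !inE eqxx.
rewrite /ordr; suff -> : ~: (X :\ x :|: ~: X) = [set x] by rewrite cards1; lia.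
by apply/setP => z; rewrite !inE; case: eqP => [->|]; rewrite ?xX //; case: (z \in X).
Qed.

Lemma matching_uniq X x y y' : 1 < #|X| -> X != setT -> boundary e X <= 3 -> x \in X ->
  y \notin X -> y' \notin X -> e x y -> e x y' -> y = y'.
Proof.
move=> X1 XT bX xX yX y'X exy exy'; apply/eqP; apply: contraT => ne.
have := boundary_matching X1 XT bX xX; rewrite cut1l leqNgt => /negP[].
apply: (@leq_trans #|[set y; y']|); first by rewrite cards2 ne.
by apply: subset_leq_card; apply/subsetP => z; rewrite !inE => /orP[]/eqP ->; apply/andP.
Qed.

(** Between two single vertices runs at most one edge, so at least two further vertices must
    separate them. *)
Lemma card_ge4 : 1 < #|T| -> 4 <= #|T|.
Proof.
move=> T1; have /card_gt1P[x [y [_ _ xy]]] : 1 < #|[set: T]| by rewrite cardsT.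
have : 3 <= ordr e [set x] [set y].
  by apply: K3; rewrite -?card_gt0 ?cards1 // disjoints_subset sub1set !inE.
have : cut e [set x] [set y] <= 1.
  by rewrite cut1l -(cards1 y) subset_leq_card //; apply/subsetP => z; rewrite inE => /andP[].
have := cardsC [set x; y]; rewrite cards2 xy /ordr; lia.
Qed.

Lemma deg_ge3 x : 1 < #|T| -> 3 <= deg e x.
Proof.
move=> T1; rewrite -boundary1 //; apply: boundary_ge3; first by rewrite -card_gt0 cards1.
by apply: contraTneq T1 => xT; rewrite -cardsT -xT cards1.
Qed.

(** Suppose a minimal Y holds two vertices u, v of C, and let W with at most three boundary edges
    contain u but not v. Uncrossing gives the smaller set [Y :&: W], unless Y and W cover
    everything; then [W :\: Y] is the complement of Y, and [Y :\: W] is smaller instead. *)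
Lemma leaf_in (C : {set T}) Z : Z != setT -> boundary e Z <= 3 -> Z :&: C != set0 ->
  exists Y, [/\ Y \subset Z, boundary e Y <= 3 & #|Y :&: C| = 1].
Proof.
move=> ZT bZ ZC.
pose P Y := [&& Y \subset Z, boundary e Y <= 3 & Y :&: C != set0].
have PZ : P Z by apply/and3P.
case: (arg_minnP (fun Y : {set T} => #|Y|) PZ) => Y /and3P[YZ bY YC] mn.
exists Y; split => //; apply/eqP; apply: contraT => Y1.
have /card_gt1P[u [v [uYC vYC uv]]] : 1 < #|Y :&: C| by rewrite -card_gt0 in YC; lia.
move: uYC vYC; rewrite !inE => /andP[uY uC] /andP[vY vC].
have [_ _ _ /(_ u v uv)[W [uW vW bW]]] := ue.
have [YWT|YWT] := eqVneq (Y :|: W) setT.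
  have WY : W :\: Y = ~: Y.
    by apply/setP => z; have := in_setT z; rewrite -YWT !inE; case: (z \in Y) => //= ->.
  have := cut_uncrossD sym Y W; rewrite -!/(boundary e _) WY.
  have : 3 <= boundary e (~: Y).
    apply: boundary_ge3; last by apply/negP => /eqP/setP/(_ u); rewrite !inE uY.
    by apply: setC_neq0; apply: contra ZT => /eqP YT; rewrite -subTset -YT.
  move=> h1 h2; have : P (Y :\: W).
    apply/and3P; split; first exact: subset_trans (subsetDl _ _) YZ.
      by move: bW bY h1 h2; rewrite -/(boundary e W); clear; lia.
    by apply/set0Pn; exists v; rewrite !inE vW vY.
  move/mn; rewrite leqNgt => /negP[]; apply: proper_card; apply/properP.
  by split; [exact: subsetDl | exists u; rewrite ?inE ?uW].
have := cut_uncrossI e Y W; rewrite -!/(boundary e _).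
have : 3 <= boundary e (Y :|: W).
  by apply: boundary_ge3 => //; apply/set0Pn; exists u; rewrite inE uY.
move=> h1 h2; have : P (Y :&: W).
  apply/and3P; split; first exact: subset_trans (subsetIl _ _) YZ.
    by move: bW bY h1 h2; rewrite -/(boundary e W); clear; lia.
  by apply/set0Pn; exists u; rewrite !inE uW uY.
move/mn; rewrite leqNgt => /negP[]; apply: proper_card; apply/properP.
by split; [exact: subsetIl | exists v; rewrite ?inE ?(negPf vW) ?andbF].
Qed.

(** With C the whole vertex set, [leaf_in] yields a single vertex with at most three edges. *)
Lemma exists_cubic : 1 < #|T| -> exists x, deg e x = 3.
Proof.
move=> T1; have /card_gt1P[u [v [_ _ uv]]] : 1 < #|[set: T]| by rewrite cardsT.
have [_ _ _ /(_ u v uv)[W [uW vW bW]]] := ue.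
have [||Y [_ bY]] := @leaf_in setT W _ bW.
- by apply: contraNneq vW => ->; rewrite inE.
- by rewrite setIT; apply/set0Pn; exists u.
rewrite setIT => /eqP/cards1P[x Yx]; exists x.
by apply/eqP; rewrite eqn_leq deg_ge3 // andbT -boundary1 // -Yx.
Qed.

Lemma boundary_gt1 Y : 0 < #|Y :&: big e| -> boundary e Y <= 3 -> 1 < #|Y|.
Proof.
case/card_gt0P => h; rewrite !inE => /andP[hY bh] bY; rewrite ltnNge.
apply/negP => Y1; have Yh : Y = [set h].
  by apply/eqP; rewrite eq_sym eqEcard sub1set hY cards1.
by move: bY; rewrite Yh boundary1 // leqNgt bh.
Qed.

(** By the matching property the big vertex has at most one neighbour outside Y, hence at least
    three inside. *)
Lemma leaf_card Y : Y != setT -> boundary e Y <= 3 -> #|Y :&: big e| = 1 -> 4 <= #|Y|.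
Proof.
move=> YT bY Y1; have Yg1 := @boundary_gt1 Y; rewrite Y1 in Yg1.
have {}Yg1 := Yg1 isT bY.
have /card_gt0P[h] : 0 < #|Y :&: big e| by rewrite Y1.
rewrite !inE => /andP[hY bh].
have := boundary_matching Yg1 YT bY hY; rewrite cut1l.
have : deg e h <= #|Y :\ h| + #|[set y in ~: Y | e h y]|.
  apply: leq_trans (leq_card_setU _ _); apply: subset_leq_card.
  apply/subsetP => y; rewrite !inE => ehy; rewrite ehy andbT.
  by case: (y \in Y) => //=; rewrite ?andbT ?orbF ?orbT //; apply: contraTneq ehy => ->; rewrite irr.
by rewrite (cardsD1 h Y) hY; lia.
Qed.

End Uniform3.

(** * The quotient graph *)

Section Contraction.
Variables (T : finType) (e : rel T) (X : {set T}).

(* [None] is the vertex to which [X] is contracted. *)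
Definition quot : finType := option {x : T | x \notin X}.

Definition qproj (x : T) : quot := insub x.

Definition qrel : rel quot := fun a b =>
  (a != b) && [exists x, exists y, [&& qproj x == a, qproj y == b & e x y]].

Lemma qproj_in x : (qproj x == None) = (x \in X).
Proof. by rewrite /qproj; case: insubP => [u /negPf -> //|]; rewrite negbK => ->. Qed.

Lemma qproj_out x y : x \notin X -> qproj x = qproj y -> x = y.
Proof.
move=> xX; rewrite /qproj; case: insubP => [u _ ux|]; last by rewrite xX.
by case: insubP => // v _ vy [uv]; rewrite -ux -vy uv.
Qed.

Lemma qproj_some (a : quot) : a != None -> exists2 x, x \notin X & qproj x = a.
Proof. by case: a => // -[x xX] _; exists x => //; rewrite /qproj insubT. Qed.

Lemma qrel_proj x y : qproj x != qproj y -> e x y -> qrel (qproj x) (qproj y).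
Proof.
move=> ne exy; rewrite /qrel ne; apply/existsP; exists x; apply/existsP; exists y.
by rewrite !eqxx.
Qed.

Lemma card_quot : #|quot| = #|~: X|.+1.
Proof. by rewrite card_option card_sig -cardsE; congr S; apply: eq_card => x; rewrite !inE. Qed.

Lemma card_pre (C : {set quot}) : None \notin C -> #|qproj @^-1: C| = #|C|.
Proof.
move=> nC; have im : qproj @: (qproj @^-1: C) = C.
  apply/setP => a; apply/imsetP/idP => [[x]|aC]; first by rewrite inE => h ->.
  have [|x _ xa] := @qproj_some a; first by apply: contraNneq nC => <-.
  by exists x; rewrite ?inE xa.
rewrite -{2}im card_in_imset // => x y; rewrite !inE => xC _; apply: qproj_out.
by rewrite -qproj_in; apply: contraNneq nC => <-.
Qed.

Lemma qproj_imset (Z : {set T}) : X \subset Z \/ [disjoint X & Z] ->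
  qproj @^-1: (qproj @: Z) = Z.
Proof.
move=> sat; apply/setP => x; rewrite inE; apply/imsetP/idP => [[y yZ xy]|]; last by exists x.
have [xX|xX] := boolP (x \in X); last by rewrite (qproj_out xX xy).
case: sat => [sX|dX]; first exact: (subsetP sX).
have /= := pred0P dX y; rewrite yZ andbT -qproj_in -xy qproj_in.
by rewrite xX.
Qed.

Lemma pre_None : qproj @^-1: [set None] = X.
Proof. by apply/setP => x; rewrite !inE qproj_in. Qed.

Lemma pre_neq0 (C : {set quot}) : X != set0 -> C != set0 -> qproj @^-1: C != set0.
Proof.
case/set0Pn => z zX /set0Pn[a aC]; apply/set0Pn; have [aN|/qproj_some[x _ xa]] := eqVneq a None.
  by exists z; rewrite inE; move: zX; rewrite -qproj_in => /eqP ->; rewrite -aN.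
by exists x; rewrite inE xa.
Qed.

Hypothesis ue : uniform3 e.
Hypotheses (X1 : 1 < #|X|) (X2 : 1 < #|~: X|) (bX : boundary e X <= 3).

Let sym : symmetric e. Proof. by case: ue. Qed.
Let irr : irreflexive e. Proof. by case: ue. Qed.

Let X0 : X != set0. Proof. by rewrite -card_gt0 ltnW. Qed.
Let XT : X != setT.
Proof. by apply: contraTneq X2 => ->; rewrite setCT cards0. Qed.

Lemma qrel_sym : symmetric qrel.
Proof.
have h a b : qrel a b -> qrel b a.
  case/andP => ab /existsP[x /existsP[y /and3P[xa yb exy]]].
  by rewrite /qrel eq_sym ab; apply/existsP; exists y; apply/existsP; exists x; rewrite xa yb sym.
by move=> a b; apply/idP/idP; apply: h.
Qed.

Lemma qrel_irr : irreflexive qrel.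
Proof. by move=> a; rewrite /qrel eqxx. Qed.

Lemma matching_in x y y' : x \notin X -> y \in X -> y' \in X -> e x y -> e x y' -> y = y'.
Proof.
move=> xX yX y'X; apply: (matching_uniq ue X2); rewrite ?inE ?negbK //; last by rewrite boundaryC.
by apply: contraNneq X0 => h; rewrite -[X]setCK h setCT.
Qed.

(** No two edges merge under the contraction, because a vertex outside X has at most one neighbour
    in X. *)
Lemma cut_qrel (A B : {set quot}) : [disjoint A & B] ->
  cut qrel A B = cut e (qproj @^-1: A) (qproj @^-1: B).
Proof.
move=> dAB; rewrite !cut_card.
set E := [set p : T * T | _].
rewrite -(@card_in_imset _ _ (fun p : T * T => (qproj p.1, qproj p.2)) E).
  apply: eq_card => -[a b]; rewrite inE /=; apply/idP/imsetP.
    case/and3P => aA bB /andP[ab /existsP[x /existsP[y /and3P[/eqP xa /eqP yb exy]]]].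
    by exists (x, y); rewrite ?inE /= xa yb // aA bB.
  case=> -[x y]; rewrite !inE /= => /and3P[xA yB exy] [-> ->].
  rewrite xA yB qrel_proj //; apply: contraTneq xA => ->; apply/negP => h.
  by have /= := pred0P dAB (qproj y); rewrite h yB.
have NAB x y : qproj x \in A -> qproj y \in B -> x \in X -> y \in X -> False.
  rewrite -!qproj_in => xA yB /eqP xN /eqP yN.
  by have /= := pred0P dAB None; rewrite -{1}xN xA -yN yB.
move=> [x y] [x' y']; rewrite !inE /= => /and3P[xA yB exy] /and3P[xA' yB' exy'] [xx' yy'].
have [xX|xX] := boolP (x \in X).
  have yX : y \notin X by apply/negP => yX; apply: (NAB x y).
  move/(qproj_out yX): yy' => yy'; subst y'; congr pair; apply: (matching_in yX) => //.
  - by rewrite -qproj_in -xx' qproj_in.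
  - by rewrite sym.
  - by rewrite sym.
move/(qproj_out xX): xx' => xx'; subst x'.
have [yX|yX] := boolP (y \in X); last by rewrite (qproj_out yX yy').
congr pair; apply: (matching_in xX) => //.
by rewrite -qproj_in -yy' qproj_in.
Qed.

Lemma boundary_qrel (A : {set quot}) : boundary qrel A = boundary e (qproj @^-1: A).
Proof. by rewrite /boundary cut_qrel ?preimsetC // disjoints_subset setCK. Qed.

(** A separator vertex [None] would pull back to all vertices of X; hence the requirement
    [None \in A :|: B]. *)
Lemma ordr_qrel (A B : {set quot}) : [disjoint A & B] -> None \in A :|: B ->
  ordr qrel A B = ordr e (qproj @^-1: A) (qproj @^-1: B).
Proof.
move=> dAB NAB; rewrite /ordr cut_qrel //; congr (_ + _).
by rewrite -preimsetU -preimsetC card_pre // inE negbK.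
Qed.

Lemma deg_qrel x : x \notin X -> deg qrel (qproj x) = deg e x.
Proof.
move=> xX; rewrite -(boundary1 _ qrel_irr) -(boundary1 _ irr).
rewrite boundary_qrel; congr (boundary e _).
apply/setP => y; rewrite !inE; apply/eqP/eqP => [/esym/(qproj_out xX) -> //|-> //].
Qed.

Lemma deg_qrel_None : deg qrel None <= 3.
Proof. by rewrite -(boundary1 _ qrel_irr) boundary_qrel pre_None. Qed.

Lemma card_big_qrel : #|X :&: big e| + #|big qrel| = #|big e|.
Proof.
have NB : None \notin big qrel by rewrite inE -leqNgt deg_qrel_None.
rewrite -(card_pre NB) -(cardsID X (big e)) setIC; congr (_ + _).
apply: eq_card => x; rewrite !inE.
have [xX|xX] := boolP (x \in X); last by rewrite deg_qrel.
by have /eqP -> : qproj x == None; [rewrite qproj_in|apply/negbTE; rewrite -leqNgt deg_qrel_None].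
Qed.

Lemma leaf_pre (Y : {set quot}) : None \notin Y ->
  #|qproj @^-1: Y :&: big e| = #|Y :&: big qrel|.
Proof.
move=> NY; rewrite -card_pre; last by rewrite inE (negPf NY).
apply: eq_card => x; rewrite !inE.
have [xX|xX] := boolP (x \in X); last by rewrite deg_qrel.
by have /eqP -> : qproj x == None; [rewrite qproj_in|rewrite (negPf NY)].
Qed.

(** A separation with [None] as separator vertex is repaired first: [None] has degree at most 3, so
    it sends at most one edge to one of the sides and can join the other side at no extra cost. Edge
    cuts come from uncrossing a cut of the original graph with X, unless that cut avoids X or one of
    the two vertices is [None]. *)
Lemma uniform3_qrel : uniform3 qrel.
Proof.
have [_ _ K3 L] := ue.
split; [exact: qrel_sym | exact: qrel_irr | |].
  have main (A B : {set quot}) : A != set0 -> B != set0 -> [disjoint A & B] ->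
      None \in A :|: B -> 3 <= ordr qrel A B.
    move=> A0 B0 dAB NAB; rewrite ordr_qrel //; apply: K3; rewrite ?pre_neq0 //.
    by apply/pred0P => x /=; rewrite !inE; apply: (pred0P dAB).
  have add (A B : {set quot}) : A != set0 -> B != set0 -> [disjoint A & B] ->
      None \notin A :|: B -> cut qrel [set None] A <= 1 -> 3 <= ordr qrel A B.
    move=> A0 B0 dAB; rewrite inE negb_or => /andP[NA NB] c1.
    have dN : [disjoint [set None] & A] by rewrite disjoints_subset sub1set inE.
    have : 3 <= ordr qrel A (None |: B).
      apply: main => //; last by rewrite !inE orbT.
        by apply/set0Pn; exists None; rewrite !inE.
      apply/pred0P => z /=; rewrite !inE; have /= := pred0P dAB z.
      by case: eqP => [->|_] //=; rewrite (negPf NA).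
    rewrite /ordr [cut _ A (None |: B)](cutC qrel_sym) cutUl; last first.
      by rewrite disjoints_subset sub1set inE.
    rewrite [cut _ B A](cutC qrel_sym).
    have : #|~: (A :|: B)| = #|~: (A :|: (None |: B))|.+1.
      rewrite (cardsD1 None) !inE negb_or NA NB add1n; congr S.
      by apply: eq_card => z; rewrite !inE; case: (z == None); case: (z \in A).
    by move: c1; clear; lia.
  move=> A B A0 B0 dAB; have [NAB|NAB] := boolP (None \in A :|: B); first exact: main.
  have [c1|c1] := leqP (cut qrel [set None] A) 1; first exact: add.
  have dBA : [disjoint B & A] by rewrite disjoint_sym.
  have : cut qrel [set None] B <= 1.
    have : cut qrel [set None] (A :|: B) <= 3.
      apply: leq_trans deg_qrel_None; rewrite deg_cut.
      by apply: cutS => //; apply: subsetT.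
    rewrite (cutC qrel_sym) cutUl // !(cutC qrel_sym _ [set None]).
    by move: c1; clear; lia.
  move/(add B A B0 A0 dBA); rewrite setUC => /(_ NAB).
  by rewrite /ordr setUC (cutC qrel_sym).
move=> a b; have [->|aN] := eqVneq a None => [bN|].
  exists [set None]; split; [by rewrite inE | by rewrite inE eq_sym | ].
  by rewrite -/(boundary _ _) boundary_qrel pre_None.
have [-> _|bN] := eqVneq b None.
  exists (~: [set None]); split; [by rewrite !inE | by rewrite !inE | ].
  by rewrite -/(boundary _ _) boundary_qrel preimsetC pre_None boundaryC.
have [x xX <-] := qproj_some aN; have [y yX <-] := qproj_some bN.
move=> xy; have {}xy : x != y by apply: contraNneq xy => ->.
have [Y [xY yY bY]] := L x y xy.
suff [Z [xZ yZ bZ sat]] : exists Z : {set T}, [/\ x \in Z, y \notin Z, boundary e Z <= 3 &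
    X \subset Z \/ [disjoint X & Z]].
  have preZ := qproj_imset sat.
  exists (qproj @: Z); rewrite -/(boundary _ _) boundary_qrel preZ; split => //.
    by rewrite imset_f.
  by move: yZ; rewrite -{1}preZ inE.
have [dis|ndis] := boolP [disjoint X & Y]; first by exists Y; split => //; right.
exists (Y :|: X); rewrite !inE xY negb_or yY yX; split => //; last by left; apply: subsetUr.
have := cut_uncrossI e Y X; rewrite -!/(boundary e _).
have : 3 <= boundary e (Y :&: X).
  apply: (boundary_ge3 ue); first by rewrite setIC setI_eq0.
  by apply: contraNneq yY => /setP/(_ y); rewrite !inE (negPf yX) andbF.
by move: bY bX; rewrite -/(boundary e Y); clear; lia.
Qed.

End Contraction.

Lemma card_leaf_complement (T : finType) (e : rel T) (X : {set T}) :
  #|X :&: big e| = 1 -> 1 < #|big e| -> ~: X :&: big e != set0.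
Proof.
move=> X1 b1; rewrite -card_gt0; have := cardsID X (big e).
by rewrite setIC X1 setDE setIC => h; move: b1; rewrite -h.
Qed.

(** Contracting a leaf removes one big vertex and, since a leaf has at least 4 vertices, at least
    three vertices. For a single big vertex the bound is 5, which its four neighbours supply. *)
Theorem card_big_le (T : finType) (e : rel T) : uniform3 e -> 1 < #|T| ->
  3 * #|big e| + 2 <= #|T|.
Proof.
move: {2}#|T|.+1 (ltnSn #|T|) => n; elim: n T e => // n IH T e Tn ue T1.
have [_ irr _ _] := ue.
have [b0|b0] := posnP #|big e|; first by rewrite b0.
have [xi xi3] := exists_cubic ue T1.
have [b1|b1] := leqP #|big e| 1.
  have /card_gt0P[h] := b0; rewrite inE => bh.
  have : #|[set w | e h w]| <= #|[set~ h]|.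
    by apply: subset_leq_card; apply/subsetP => y; rewrite !inE; apply: contraTneq => ->; rewrite irr.
  by have := cardsC1 h; rewrite cardsC1; rewrite /deg in bh; move: bh b1; clear; lia.
have [|||Y [YZ bY Y1]] := @leaf_in _ e ue (big e) (~: [set xi]).
- by apply/eqP => /setP/(_ xi); rewrite !inE eqxx.
- by rewrite boundaryC // boundary1 // xi3.
- have /card_gt0P[h hb] := b0; apply/set0Pn; exists h; rewrite !inE; move: hb; rewrite inE => hb.
  by rewrite hb andbT; apply: contraTneq hb => ->; rewrite xi3.
have YT : Y != setT.
  by apply: contraTneq YZ => ->; apply/subsetPn; exists xi; rewrite !inE ?eqxx.
have Y4 := leaf_card ue YT bY Y1.
have Yc : 1 < #|~: Y|.
  apply: (boundary_gt1 ue); last by rewrite boundaryC.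
  by rewrite card_gt0 card_leaf_complement.
have Yg : 1 < #|Y| by apply: leq_trans Y4.
have uq := uniform3_qrel ue Yg Yc bY.
have := card_big_qrel ue Yg Yc bY; have := cardsC Y.
have := IH _ _ _ uq; rewrite card_quot Y1.
move: Y4 Yc Tn; clear => h1 h2 h3 h4 h5 h6.
by have := h4 _ _; lia.
Qed.

(** * Small leaves *)

Section Leaves.
Variables (T : finType) (e : rel T).
Hypothesis ue : uniform3 e.

Lemma leaf_proper (Y : {set T}) : #|Y :&: big e| = 1 -> 1 < #|big e| -> Y != setT.
Proof. by move=> Y1; apply: contraTneq => YT; rewrite -Y1 YT setTI ltnn. Qed.

Lemma leaf_complement_gt1 (Y : {set T}) : boundary e Y <= 3 -> #|Y :&: big e| = 1 ->
  1 < #|big e| -> 1 < #|~: Y|.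
Proof.
move=> bY Y1 b1; have [sym _ _ _] := ue.
apply: (boundary_gt1 ue); last by rewrite boundaryC.
by rewrite card_gt0 card_leaf_complement.
Qed.

(** With two or more big vertices, contracting a leaf of five vertices would violate [card_big_le];
    with one, there are at most 5 vertices and Y misses x. Keeping x outside allows the leaf to be
    pulled back when x arose by a contraction. *)
Lemma tight_leaf x : x \notin big e -> 0 < #|big e| -> #|T| <= 3 * #|big e| + 2 ->
  exists Y : {set T}, [/\ x \notin Y, boundary e Y <= 3, #|Y :&: big e| = 1 & #|Y| <= 4].
Proof.
move=> xb b0 Tb; have [sym irr _ _] := ue.
have [|||Y [YZ bY Y1]] := @leaf_in _ e ue (big e) (~: [set x]).
- by apply/eqP => /setP/(_ x); rewrite !inE eqxx.
- by rewrite boundaryC // boundary1 // leqNgt; rewrite inE in xb.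
- have /card_gt0P[h hb] := b0; apply/set0Pn; exists h; rewrite !inE.
  by move: (hb); rewrite inE => ->; rewrite andbT; apply: contraNneq xb => <-.
have xY : x \notin Y by apply: contraTN YZ => xY; apply/subsetPn; exists x; rewrite // !inE eqxx.
exists Y; split => //; have [b1|b1] := leqP #|big e| 1.
  have : #|Y| < #|T|.
    by rewrite -cardsT; apply: proper_card; apply/properP; split; [apply: subsetT | exists x].
  by move: b0 b1 Tb; clear; lia.
have YT := leaf_proper Y1 b1.
have Y4 := leaf_card ue YT bY Y1.
have Yc := leaf_complement_gt1 bY Y1 b1.
have Yg : 1 < #|Y| by apply: leq_trans Y4.
have := card_big_le (uniform3_qrel ue Yg Yc bY); rewrite card_quot.
have := card_big_qrel ue Yg Yc bY; have := cardsC Y; rewrite Y1.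
by move: Tb Yc b1; clear => h1 h2 h3 h4 h5 h6; have := h6 _; lia.
Qed.

End Leaves.

Section SmallLeaf.
Variables (T : finType) (e : rel T).
Hypothesis ue : uniform3 e.

(** If a smallest leaf had six or more vertices, contracting it would lose at least five vertices
    and one big one, so the quotient would be tight. Then [tight_leaf] gives a leaf of at most 4
    vertices avoiding [None], whose preimage is a smaller leaf of the original graph. *)
Theorem small_leaf : 1 < #|big e| -> #|T| <= 3 * #|big e| + 4 ->
  exists Y : {set T}, [/\ boundary e Y <= 3, #|Y :&: big e| = 1 & #|Y| <= 5].
Proof.
move=> b1 Tb; have [sym irr _ _] := ue.
have T1 : 1 < #|T| by apply: leq_trans b1 _; apply: max_card.
pose P (Y : {set T}) := (boundary e Y <= 3) && (#|Y :&: big e| == 1).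
have [Y0 PY0] : exists Y, P Y.
  have [x x3] := exists_cubic ue T1.
  have [|||Y [YZ bY /eqP Y1]] := @leaf_in _ e ue (big e) (~: [set x]).
  - by apply/eqP => /setP/(_ x); rewrite !inE eqxx.
  - by rewrite boundaryC // boundary1 // x3.
  - have /card_gt0P[h hb] := ltnW b1; apply/set0Pn; exists h; rewrite !inE.
    by move: (hb); rewrite inE => ->; rewrite andbT; apply: contraTneq hb => ->; rewrite inE x3.
  by exists Y; apply/andP.
case: (arg_minnP (fun Y : {set T} => #|Y|) PY0) => Y /andP[bY /eqP Y1] mn.
exists Y; split => //; rewrite leqNgt; apply/negP => Y6.
have Yc := leaf_complement_gt1 ue bY Y1 b1.
have Yg : 1 < #|Y| by apply: leq_trans Y6.
have cb := card_big_qrel ue Yg Yc bY.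
have [|||Y' [NY' bY' Y'1 Y'4]] := tight_leaf (uniform3_qrel ue Yg Yc bY) (x := None).
- by rewrite inE -leqNgt; apply: deg_qrel_None.
- by move: cb b1; rewrite Y1; clear; lia.
- have := cardsC Y; rewrite card_quot; move: cb Tb Y6 Yc; rewrite Y1; clear; lia.
have : P (@qproj _ Y @^-1: Y').
  by rewrite /P -boundary_qrel // bY' leaf_pre // Y'1.
move/mn; rewrite card_pre // => h; have := leq_trans Y6 (leq_trans h Y'4).
by [].
Qed.

End SmallLeaf.

(** * Graphs with one vertex of degree at least four *)

Fixpoint cands (n t : nat) : seq (seq bool) :=
  if n is n'.+1 then
    (if t is t'.+1 then map (cons true) (cands n' t') else [::]) ++ map (cons false) (cands n' t)
  else if t is 0 then [:: [::]] else [::].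

Lemma mem_cands r : r \in cands (size r) (count id r).
Proof.
elim: r => //= -[] r IH; rewrite mem_cat map_f ?orbT //.
Qed.

(* [chk n ds [::] C] tests [C] on all graphs on [n] vertices with degree
   sequence [ds]; the [i]-th row of a graph lists the adjacencies of [i] to
   [i + 1], .., [n - 1]. *)
Fixpoint chk (n : nat) (ds : seq nat) (acc : seq (seq bool)) (C : pred (seq (seq bool))) : bool :=
  match n, ds with
  | n'.+1, d :: ds' =>
      all (fun r => if all (fun p => nat_of_bool p.2 <= p.1) (zip ds' r) then
                      chk n' [seq p.1 - nat_of_bool p.2 | p <- zip ds' r] (r :: acc) C
                    else true)
        (cands (size ds') d)
  | _, _ => C (rev acc)
  end.

(** The row of i starts at vertex i + 1, hence the predecessor in the index. *)
Definition adj (R : seq (seq bool)) (i j : nat) : bool :=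
  if i < j then nth false (nth [::] R i) (j - i).-1
  else if j < i then nth false (nth [::] R j) (i - j).-1 else false.

Section Rows.
Variables (T : finType) (e : rel T).
Hypotheses (sym : symmetric e) (irr : irreflexive e).

Fixpoint rows (vs : seq T) : seq (seq bool) :=
  if vs is v :: vs' then map (e v) vs' :: rows vs' else [::].

(** The degree list always holds the degrees into the vertices not yet treated: the row of v is a
    candidate of the right weight, and subtracting its entries restores this for the remaining
    vertices. *)
Lemma chkP vs acc C : chk (size vs) [seq count (e v) vs | v <- vs] acc C ->
  C (rev acc ++ rows vs).
Proof.
elim: vs acc => [|v vs IH] acc /=; first by rewrite cats0.
rewrite irr add0n size_map => /allP/(_ (map (e v) vs)).
have -> : map (e v) vs \in cands (size vs) (count (e v) vs).
  by have := mem_cands (map (e v) vs); rewrite size_map count_map.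
move=> /(_ isT).
have gen (f : T -> nat) ws :
    [seq p.1 - nat_of_bool p.2 | p <- zip [seq e w v + f w | w <- ws] [seq e v w | w <- ws]]
      = [seq f w | w <- ws] /\
    all (fun p => nat_of_bool p.2 <= p.1)
      (zip [seq e w v + f w | w <- ws] [seq e v w | w <- ws]).
  by elim: ws => //= w ws [-> ->]; rewrite sym addKn leq_addr.
have [-> ->] := gen (fun w => count (e w) vs) vs.
by move/IH; rewrite rev_cons cat_rcons.
Qed.

Lemma adj_rows x0 vs i j : i < size vs -> j < size vs ->
  e (nth x0 vs i) (nth x0 vs j) = adj (rows vs) i j.
Proof.
have main : forall vs i j, i < j -> j < size vs ->
    e (nth x0 vs i) (nth x0 vs j) = nth false (nth [::] (rows vs) i) (j - i).-1.
  elim=> // v ws IH [|i'] [|j'] //= ij js; last by rewrite subSS IH.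
  by rewrite (nth_map x0).
move=> iv jv; rewrite /adj; case: (ltngtP i j) => ij; first exact: main.
  by rewrite sym; apply: main.
by rewrite ij irr.
Qed.

Lemma count_all vs x : uniq vs -> (forall y, y \in vs) -> count (e x) vs = deg e x.
Proof.
move=> us all; rewrite -size_filter -(card_uniqP (filter_uniq _ us)).
by apply: eq_card => y; rewrite inE mem_filter all andbT.
Qed.

Lemma cut_seq (s1 s2 : seq T) : uniq s1 -> uniq s2 ->
  cut e [set x in s1] [set x in s2] =
    sumn [seq sumn [seq nat_of_bool (e x y) | y <- s2] | x <- s1].
Proof.
move=> u1 u2; rewrite cut_row sumnE big_map.
rewrite (eq_bigl (fun x => x \in s1)); last by move=> x; rewrite inE.
rewrite -big_uniq //; apply: eq_bigr => x _.
rewrite sumnE big_map big_uniq //= -sum1_card.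
rewrite [RHS]big_mkcond [LHS]big_mkcond /=; apply: eq_bigr => y _.
by rewrite !inE; case: (y \in s2) => //=; case: (e x y).
Qed.

End Rows.

Definition crossing_edges (R : seq (seq bool)) (I J : seq nat) : nat :=
  sumn [seq sumn [seq nat_of_bool (adj R i j) | j <- J] | i <- I].

(** The ten splittings of 1, .., 6 into two triples, each given by the half containing 1. *)
Definition triples : seq (seq nat) :=
  [seq [:: 1; p.1; p.2] | p <- allpairs pair (iota 2 5) (iota 2 5) & p.1 < p.2].

(* Deleting vertex [0] and at most one edge separates two triples. *)
Definition disconnected7 (R : seq (seq bool)) : bool :=
  has (fun I => crossing_edges R I [seq j <- iota 1 6 | j \notin I] <= 1) triples.

Lemma triples_split I : I \in triples ->
  [&& uniq (I ++ [seq j <- iota 1 6 | j \notin I]),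
      perm_eq (I ++ [seq j <- iota 1 6 | j \notin I]) (iota 1 6), I != [::] &
      [seq j <- iota 1 6 | j \notin I] != [::]].
Proof. by move: I; apply/allP; vm_compute. Qed.

Lemma not_disconnected7 (T : finType) (e : rel T) (x0 : T) (vs : seq T) : uniform3 e ->
  uniq vs -> (forall x, x \in vs) -> size vs = 7 -> ~~ disconnected7 (rows e vs).
Proof.
move=> [sym irr K3 _] us all s7; apply/hasPn => I It; rewrite -ltnNge.
set J := [seq j <- _ | _].
have := triples_split It; rewrite -/J => /and4P[uIJ pIJ I0 J0].
have /and3P[uI dIJ uJ] : [&& uniq I, ~~ has (mem I) J & uniq J] by rewrite -cat_uniq.
pose f i := nth x0 vs i.
have lt7 i : i \in I ++ J -> 0 < i < 7 by rewrite (perm_mem pIJ) mem_iota.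
have finj : {in I ++ J &, injective f}.
  move=> i j /lt7 /andP[_ i7] /lt7 /andP[_ j7] /eqP.
  by rewrite nth_uniq ?s7 // => /eqP.
have inI i : i \in I -> i \in I ++ J by rewrite mem_cat => ->.
have inJ i : i \in J -> i \in I ++ J by rewrite mem_cat orbC => ->.
have ufI : uniq (map f I) by rewrite map_inj_in_uniq // => i j /inI iI /inI jI; apply: finj.
have ufJ : uniq (map f J) by rewrite map_inj_in_uniq // => i j /inJ iI /inJ jI; apply: finj.
have : 3 <= ordr e [set x in map f I] [set x in map f J].
  apply: K3.
  - case: (I) I0 => // i l _; apply/set0Pn; exists (f i); rewrite inE /=; apply: mem_head.
  - case: (J) J0 => // i l _; apply/set0Pn; exists (f i); rewrite inE /=; apply: mem_head.
  apply/pred0P => x /=; rewrite !inE; apply/negP => /andP[/mapP[i iI ->] /mapP[j jJ /finj ij]].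
  have {}ij : i = j by apply: ij; [apply: inI | apply: inJ].
  by move/hasPn/(_ j jJ): dIJ; rewrite /= -ij iI.
rewrite /ordr cut_seq //.
have -> : sumn [seq sumn [seq nat_of_bool (e x y) | y <- map f J] | x <- map f I]
    = crossing_edges (rows e vs) I J.
  rewrite /crossing_edges; congr sumn; rewrite -map_comp; apply/eq_in_map => i /inI/lt7/andP[_ i7] /=.
  congr sumn; rewrite -map_comp; apply/eq_in_map => j /inJ/lt7/andP[_ j7] /=.
  by rewrite (adj_rows sym irr) ?s7.
suff : #|~: ([set x in map f I] :|: [set x in map f J])| <= 1 by clear; lia.
rewrite -(cards1 (f 0)); apply: subset_leq_card; apply/subsetP => x; rewrite !inE negb_or -negb_or.
have : x \in vs by []; move/(nthP x0) => [i i7 <-].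
case: i i7 => [|i] i7; first by rewrite eqxx.
rewrite -mem_cat -map_cat => /negP[]; apply: (map_f f).
by move: i7; rewrite s7 (perm_mem pIJ) mem_iota.
Qed.

(* A template lists the admissible edges [(i, j)], [i < j], of a graph on [0, .., n - 1]. *)
Definition matches (n : nat) (R : seq (seq bool)) (tm : seq (nat * nat)) (s : seq nat) : bool :=
  all (fun a => all (fun b => if adj R (nth 0 s a) (nth 0 s b) then (a, b) \in tm else true)
    (iota a.+1 (n.-1 - a))) (iota 0 n).

Definition embeds (T : finType) (e : rel T) (vs : seq T) (tm : seq (nat * nat)) : Prop :=
  [/\ uniq vs, forall x, x \in vs &
      forall x y, e x y -> index x vs < index y vs -> (index x vs, index y vs) \in tm].

Lemma matches_embeds (T : finType) (e : rel T) (x0 : T) (vs : seq T) tm s :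
  symmetric e -> irreflexive e -> uniq vs -> (forall x, x \in vs) ->
  perm_eq s (iota 0 (size vs)) -> matches (size vs) (rows e vs) tm s ->
  embeds e [seq nth x0 vs i | i <- s] tm.
Proof.
move=> sym irr us all ps mt.
have pv : perm_eq [seq nth x0 vs i | i <- s] vs.
  by rewrite -[X in perm_eq _ X](mkseq_nth x0) /mkseq perm_map.
split; first by rewrite (perm_uniq pv).
  by move=> x; rewrite (perm_mem pv).
set ws := map _ s; have sw : size ws = size vs by rewrite size_map (perm_size ps) size_iota.
move=> x y exy lt; have iy : index y ws < size vs by rewrite -sw index_mem (perm_mem pv).
have ix : index x ws < size vs by apply: ltn_trans iy.
have ss : size s = size vs by rewrite (perm_size ps) size_iota.
have st i : i < size vs -> nth 0 s i < size vs.
  move=> it; have : nth 0 s i \in s by apply: mem_nth; rewrite ss.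
  by rewrite (perm_mem ps) mem_iota.
have nthw z : nth x0 vs (nth 0 s (index z ws)) = z.
  have iz : index z ws < size s by rewrite ss -sw index_mem (perm_mem pv).
  by rewrite -(nth_map 0 x0) // nth_index // (perm_mem pv).
have /allP/(_ (index x ws)) := mt; rewrite mem_iota add0n ix => /(_ isT).
move=> /allP/(_ (index y ws)); rewrite mem_iota lt /=.
have -> : index y ws < (index x ws).+1 + ((size vs).-1 - index x ws) by lia.
by move/(_ isT); rewrite -(adj_rows sym irr x0) ?st // !nthw exy.
Qed.

Definition wheel_template (n : nat) : seq (nat * nat) :=
  [seq (0, i) | i <- iota 1 n.-1] ++ [seq (i, i.+1) | i <- iota 1 (n - 2)] ++ [:: (1, n.-1)].

(** Positions 0 and 1 are fixed, so the search also prescribes which vertex becomes rim vertex 1; by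
    symmetry of the wheel any rim vertex can. *)
Definition is_wheel (n : nat) (ps : seq (seq nat)) (R : seq (seq bool)) : bool :=
  has (fun s => matches n R (wheel_template n) [:: 0, 1 & s]) ps
  || (n == 7) && disconnected7 R.

(** Parity of the degree sum rules out (6, 4) and (7, 5). In the other cases the hub sees all other
    vertices, which induce a 2-regular graph: a cycle, or two triangles when n = 7, and the latter
    is caught by [disconnected7]. *)
Lemma wheel_enum : all (fun nd => chk nd.1 (nd.2 :: nseq nd.1.-1 3) [::]
    (is_wheel nd.1 (permutations (iota 2 (nd.1 - 2)))))
  [:: (5, 4); (6, 4); (6, 5); (7, 5); (7, 6)].
Proof. by vm_compute. Qed.

(* Deleting the hub [0] leaves a theta graph with branch vertices [5] and [6],
   whose three branches have 0+1+3, 0+2+2 or 1+1+2 inner vertices. *)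
Definition theta_templates : seq (seq (nat * nat)) :=
  let hub := [:: (0, 1); (0, 2); (0, 3); (0, 4)] in
  [:: hub ++ [:: (5, 6); (1, 5); (2, 5); (1, 6); (3, 6); (2, 4); (3, 4)];
      hub ++ [:: (5, 6); (1, 5); (2, 5); (3, 6); (4, 6); (1, 3); (2, 4)];
      hub ++ [:: (1, 5); (2, 5); (3, 5); (1, 6); (2, 6); (4, 6); (3, 4)]].

Definition is_theta (ps : seq (seq nat)) (R : seq (seq bool)) : bool :=
  has (fun s => has (fun t => has (fun tm => matches 7 R tm (0 :: s ++ t)) theta_templates)
    [:: [:: 5; 6]; [:: 6; 5]]) ps || disconnected7 R.

(** The hub row is fixed in advance, with the neighbours of the hub first. Six vertices of degrees
    2, 2, 2, 2, 3, 3 form a theta graph or two triangles joined by an edge; the latter is caught by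
    [disconnected7]. *)
Lemma theta_enum :
  chk 6 [:: 2; 2; 2; 2; 3; 3] [:: [:: true; true; true; true; false; false]]
    (is_theta (permutations (iota 1 4))).
Proof. by vm_compute. Qed.

(** * Wheels and theta graphs around the big vertex *)

Section OneBig.
Variables (T : finType) (e : rel T) (h : T).
Hypothesis ue : uniform3 e.
Hypothesis bh : big e = [set h].

Let sym : symmetric e. Proof. by case: ue. Qed.
Let irr : irreflexive e. Proof. by case: ue. Qed.

Let deg_h : 4 <= deg e h.
Proof. by have := set11 h; rewrite -bh inE. Qed.

Let deg_lt x : deg e x < #|T|.
Proof.
rewrite -cardsT; apply: proper_card; apply/properP; split; first exact: subsetT.
by exists x; rewrite !inE // irr.
Qed.

Let deg_x x : x != h -> deg e x = 3.
Proof.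
move=> xh; apply/eqP; rewrite eqn_leq deg_ge3 ?andbT //; last first.
  by have := deg_lt h; move: deg_h; clear; lia.
by rewrite leqNgt; have := in_set1 x h; rewrite -bh inE (negPf xh) => ->.
Qed.

(** The vertex b is put on rim position 1. For a leaf it will be the vertex created by contraction,
    so that the rest of the rim is a path. Seven vertices with hub degree 4 are left to the theta
    graphs. *)
Theorem wheel_embedding (b : T) : b != h -> #|T| <= 7 -> (#|T| = 7 -> 4 < deg e h) ->
  exists s, embeds e [:: h, b & s] (wheel_template #|T|).
Proof.
move=> bneh T7 T7d.
pose vs := [:: h, b & enum (~: [set h; b])].
have us : uniq vs.
  by rewrite /= !inE !mem_enum !inE enum_uniq !negb_or eq_sym bneh !eqxx ?orbT.
have all x : x \in vs by rewrite /= !inE mem_enum !inE; case: (x == h); case: (x == b).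
have sv : size vs = #|T|.
  by rewrite -(card_uniqP us); apply: eq_card => x; rewrite all.
have := @chkP _ _ sym irr vs [::] (is_wheel #|T| (permutations (iota 2 (#|T| - 2)))).
have -> : [seq count (e v) vs | v <- vs] = deg e h :: nseq #|T|.-1 3.
  rewrite (eq_map (fun v => count_all e v us all)) /=; congr cons.
  have -> : #|T|.-1 = (size (enum (~: [set h; b]))).+1 by rewrite -sv.
  rewrite /= deg_x //; congr cons; rewrite -(size_map (deg e)).
  apply/all_pred1P/allP => d /mapP[v]; rewrite mem_enum !inE => vhb ->.
  by rewrite /= deg_x //; move: vhb; rewrite negb_or => /andP[].
rewrite sv => W; have {}W : is_wheel #|T| (permutations (iota 2 (#|T| - 2))) (rows e vs).
  apply: W.
  apply: (allP wheel_enum (#|T|, deg e h)); rewrite !inE !xpair_eqE.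
  move: T7d T7 deg_h (deg_lt h); move: #|T| (deg e h) => n d; clear => h1 h2 h3 h4.
  by have [n7|n7] := eqVneq n 7; [have := h1 n7; rewrite n7 in h4 *; clear -h4 h3|clear h1]; lia.
case/orP: W => [/hasP[s]|/andP[/eqP s7]]; last first.
  by move=> dR; have := not_disconnected7 h ue us all; rewrite sv s7 dR => /(_ erefl).
rewrite mem_permutations => ps mt.
have T2 : 2 <= #|T| by rewrite -sv.
have pss : perm_eq [:: 0, 1 & s] (iota 0 (size vs)).
  by rewrite sv -(subnKC T2) /= !perm_cons.
exists [seq nth h vs i | i <- s].
have := @matches_embeds _ e h vs (wheel_template #|T|) _ sym irr us all pss.
by rewrite sv; apply.
Qed.

Theorem theta_embedding : #|T| = 7 -> deg e h = 4 ->
  exists vs tm, tm \in theta_templates /\ embeds e vs tm.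
Proof.
move=> T7 d4.
pose ns := enum [set x | e h x]; pose os := enum (~: (h |: [set x | e h x])).
pose vs := h :: ns ++ os.
have us : uniq vs.
  rewrite /= mem_cat !mem_enum !inE irr eqxx /= cat_uniq !enum_uniq andbT /=.
  by apply/hasPn => x; rewrite !mem_enum !inE negb_or => /andP[].
have all x : x \in vs.
  by rewrite inE mem_cat !mem_enum !inE; case: (x == h); case: (e h x).
have sv : size vs = 7 by rewrite -T7 -(card_uniqP us); apply: eq_card => x; rewrite all.
have sns : size ns = 4 by rewrite -cardE.
have sos : size os = 2 by move: sv; rewrite /= size_cat sns => -[].
have cnt x : x != h -> count (e x) (ns ++ os) + e h x = 3.
  by move=> xh; rewrite -(deg_x xh) -(count_all e x us all) /= addnC sym.
have := @chkP _ _ sym irr (ns ++ os) [:: map (e h) (ns ++ os)]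
  (is_theta (permutations (iota 1 4))).
have -> : size (ns ++ os) = 6 by rewrite size_cat sns sos.
have -> : [seq count (e v) (ns ++ os) | v <- ns ++ os] = [:: 2; 2; 2; 2; 3; 3].
  rewrite map_cat; have -> : [seq count (e v) (ns ++ os) | v <- ns] = nseq 4 2.
    rewrite -sns -(size_map (fun v => count (e v) (ns ++ os)) ns).
    apply/all_pred1P/allP => d /mapP[v]; rewrite mem_enum inE => ehv ->.
    have vh : v != h by apply: contraTneq ehv => ->; rewrite irr.
    by have := cnt v vh; rewrite ehv addn1 => -[->].
  have -> // : [seq count (e v) (ns ++ os) | v <- os] = nseq 2 3.
  rewrite -{1}sos -(size_map (fun v => count (e v) (ns ++ os)) os).
  apply/all_pred1P/allP => d /mapP[v]; rewrite mem_enum !inE negb_or => /andP[vh ehv] ->.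
  by have := cnt v vh; rewrite (negPf ehv) addn0 => ->.
have hrow : map (e h) (ns ++ os) = [:: true; true; true; true; false; false].
  rewrite map_cat; have -> : map (e h) ns = nseq 4 true.
    rewrite -sns -(size_map (e h) ns).
    by apply/all_pred1P/allP => d /mapP[v]; rewrite mem_enum inE => ehv ->; rewrite ehv.
  have -> // : map (e h) os = nseq 2 false.
  rewrite -sos -(size_map (e h) os); apply/all_pred1P/allP => d /mapP[v].
  by rewrite mem_enum !inE negb_or => /andP[vh ehv] ->; rewrite (negPf ehv).
rewrite hrow => /(_ theta_enum) W; have {}W : is_theta (permutations (iota 1 4)) (rows e vs)
  by rewrite /vs /= hrow.
case/orP: W => [/hasP[s]|dR]; last first.
  by have := not_disconnected7 h ue us all sv; rewrite dR.
rewrite mem_permutations => ps /hasP[t tt] /hasP[tm tmt mt].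
have pss : perm_eq (0 :: s ++ t) (iota 0 (size vs)).
  rewrite sv -[iota 0 7]/(0 :: iota 1 4 ++ iota 5 2) perm_cons perm_cat //.
  by move: tt; rewrite !inE => /orP[]/eqP ->.
exists [seq nth h vs i | i <- 0 :: s ++ t], tm; split => //.
have := @matches_embeds _ e h vs tm _ sym irr us all pss.
by rewrite sv; apply.
Qed.

End OneBig.

(** * Straight-line fans *)

Local Open Scope R_scope.

Definition seg (a b w : R * R) : Prop := exists t, 0 <= t <= 1 /\
  w = (fst a + t * (fst b - fst a), snd a + t * (snd b - snd a)).

Definition ray (a d w : R * R) : Prop := exists t, 0 <= t /\
  w = (fst a + t * fst d, snd a + t * snd d).

Definition det (a b : R * R) : R := fst a * snd b - snd a * fst b.

Definition vsub (a b : R * R) : R * R := (fst a - fst b, snd a - snd b).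

Definition orient (a b c : R * R) : R := det (vsub b a) (vsub c a).

Lemma segC a b w : seg a b w -> seg b a w.
Proof.
case=> t [ht ->]; exists (1 - t); split; first lra.
by congr pair; ring.
Qed.

Lemma seg_l a b : seg a b a.
Proof. by exists 0; split; [lra | case: a => x y; congr pair => /=; ring]. Qed.

Lemma seg_r a b : seg a b b.
Proof. by apply: segC; apply: seg_l. Qed.

Lemma orient_seg o a b c t :
  orient o a (fst b + t * (fst c - fst b), snd b + t * (snd c - snd b)) =
  (1 - t) * orient o a b + t * orient o a c.
Proof. by rewrite /orient /det /vsub /=; ring. Qed.

Lemma orient_ray o a b d t :
  orient o a (fst b + t * fst d, snd b + t * snd d) = orient o a b + t * det (vsub a o) d.
Proof. by rewrite /orient /det /vsub /=; ring. Qed.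

Lemma orient_self o a : orient o a o = 0.
Proof. by rewrite /orient /det /vsub /=; ring. Qed.

Lemma orientaa o a : orient o a a = 0.
Proof. by rewrite /orient /det /vsub /=; ring. Qed.

Lemma orientC o a b : orient o a b = - orient o b a.
Proof. by rewrite /orient /det /vsub /=; ring. Qed.

Section Fan.
Variables (sg : R) (H : R * R) (S : nat -> R * R) (m : nat) (p q r : R * R).
Hypothesis m0 : (0 < m)%N.
(** From H the path points appear in strict angular order, in the direction given by [sg], any two
    less than a half turn apart. The leg conditions control the directions of the three rays
    relative to the lines from H through the path points. *)
Hypothesis star : forall i j, (i < j)%N -> (j <= m)%N -> 0 < sg * orient H (S i) (S j).
Hypothesis leg0P : forall i, (0 < i)%N -> (i <= m)%N -> sg * det (vsub (S i) H) p <= 0.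
Hypothesis leg1P : forall i, (i < m)%N -> 0 <= sg * det (vsub (S i) H) q.
Hypothesis legHP : sg * det (vsub (S 0) H) r < 0 \/ 0 < sg * det (vsub (S m) H) r.

Inductive fan_edge := Spoke of nat | Rim of nat | Leg0 | Leg1 | LegH.

Definition fan_valid k : bool := match k with
  Spoke i => (i <= m)%N | Rim i => (i < m)%N | _ => true end.

Definition is_leg k : bool := match k with Spoke _ => false | Rim _ => false | _ => true end.

Definition fan_pts k : R * R -> Prop := match k with
  | Spoke i => seg H (S i) | Rim i => seg (S i) (S i.+1)
  | Leg0 => ray (S 0) p | Leg1 => ray (S m) q | LegH => ray H r end.

(* [None] is the hub, [Some i] the [i]-th vertex of the path. *)
Definition fan_ends k : seq (option nat) := match k with
  | Spoke i => [:: None; Some i] | Rim i => [:: Some i; Some i.+1]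
  | Leg0 => [:: Some 0%N] | Leg1 => [:: Some m] | LegH => [:: None] end.

Definition fan_pos (c : option nat) : R * R := if c is Some i then S i else H.

(** The signed side of w with respect to the line through H and [S i]. Disjointness of fan edges is
    read off from the sign of [o i] for a suitable i. *)
Let o i w := sg * orient H (S i) w.

Lemma star_lt i j : (i < j)%N -> (j <= m)%N -> 0 < o i (S j).
Proof. exact: star. Qed.

Lemma star_gt i j : (j < i)%N -> (i <= m)%N -> o i (S j) < 0.
Proof.
move=> ji im; rewrite /o orientC; have := star ji im.
by rewrite Ropp_mult_distr_r_reverse; lra.
Qed.

Lemma star_eq i : o i (S i) = 0.
Proof. by rewrite /o orientaa; ring. Qed.

Lemma o_seg i a b t : o i (fst a + t * (fst b - fst a), snd a + t * (snd b - snd a)) =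
  (1 - t) * o i a + t * o i b.
Proof. by rewrite /o orient_seg; ring. Qed.

Lemma spoke_o i w : seg H (S i) w -> o i w = 0.
Proof. by case=> t [_ ->]; rewrite o_seg star_eq /o orient_self; ring. Qed.

Lemma rim_ge i j w : (i <= j)%N -> (j < m)%N -> seg (S j) (S j.+1) w -> 0 <= o i w.
Proof.
move=> ij jm [t [ht ->]]; rewrite o_seg.
have h1 : 0 < o i (S j.+1) by apply: star_lt.
have h2 : 0 <= o i (S j).
  move: ij; rewrite leq_eqVlt => /orP[/eqP ->|ij]; first by rewrite star_eq; lra.
  by apply: Rlt_le; apply: star_lt => //; apply: ltnW.
by nra.
Qed.

Lemma rim_gt i j w : (i < j)%N -> (j < m)%N -> seg (S j) (S j.+1) w -> 0 < o i w.
Proof.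
move=> ij jm [t [ht ->]]; rewrite o_seg.
have h1 : 0 < o i (S j.+1) by apply: star_lt => //; apply: ltnW.
have h2 : 0 < o i (S j) by apply: star_lt => //; apply: ltnW.
by nra.
Qed.

Lemma rim_le i j w : (j < i)%N -> (i <= m)%N -> seg (S j) (S j.+1) w -> o i w <= 0.
Proof.
move=> ji im [t [ht ->]]; rewrite o_seg.
have h1 : o i (S j) < 0 by apply: star_gt.
have h2 : o i (S j.+1) <= 0.
  move: ji; rewrite leq_eqVlt => /orP[/eqP ->|ij]; first by rewrite star_eq; lra.
  by apply: Rlt_le; apply: star_gt.
by nra.
Qed.

Lemma rim_lt i j w : (j.+1 < i)%N -> (i <= m)%N -> seg (S j) (S j.+1) w -> o i w < 0.
Proof.
move=> ji im [t [ht ->]]; rewrite o_seg.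
have h1 : o i (S j) < 0 by apply: star_gt => //; apply: ltnW.
have h2 : o i (S j.+1) < 0 by apply: star_gt.
by nra.
Qed.

Lemma rim_hub j : (j < m)%N -> ~ seg (S j) (S j.+1) H.
Proof.
move=> jm [t [ht E]]; have : o j H = 0 by rewrite /o orient_self; ring.
have h1 : 0 < o j (S j.+1) by apply: star_lt.
rewrite {1}E o_seg star_eq => E2.
have {ht E2} t0 : t = 0 by nra.
have Hj : H = S j by rewrite E t0; case: (S j) => a b /=; congr pair; ring.
by move: h1; rewrite /o Hj orientC orient_self; lra.
Qed.

Lemma leg0_lt i w : (0 < i)%N -> (i <= m)%N -> ray (S 0) p w -> o i w < 0.
Proof.
move=> i0 im [t [ht ->]]; rewrite /o orient_ray.
have := star_gt i0 im; rewrite /o; have := leg0P i0 im; nra.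
Qed.

Lemma leg1_gt i w : (i < m)%N -> ray (S m) q w -> 0 < o i w.
Proof.
move=> im [t [ht ->]]; rewrite /o orient_ray.
have := star_lt im (leqnn m); rewrite /o; have := leg1P im; nra.
Qed.

(** On the ray, [o i] is a multiple of the parameter. By [legHP] it is negative for i = 0 or
    positive for i = m, where the path has the opposite weak sign; only H remains as a common point,
    and no rim edge contains it. *)
Lemma legH_rim j w : (j < m)%N -> seg (S j) (S j.+1) w -> ray H r w -> False.
Proof.
move=> jm rw [t [ht E]].
have ow i : o i w = t * (sg * det (vsub (S i) H) r).
  by rewrite E /o orient_ray orient_self; ring.
suff t0 : t = 0.
  apply: (@rim_hub j jm); suff <- : w = H by [].
  by rewrite E t0; case: (H) => a b /=; congr pair; ring.
case: legHP => lh.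
  by have := rim_ge (leq0n j) jm rw; rewrite ow; nra.
by have := rim_le jm (leqnn m) rw; rewrite ow; nra.
Qed.

(** A spoke lies on the zero line of its own [o i], while rim edges and path legs not at its end
    stay strictly on one side; two rim edges are separated by the line through the end of the first.
    Pairs of legs are left out: they leave the fan and are controlled by the old drawing. *)
Lemma fan_disjoint k k' w : fan_valid k -> fan_valid k' -> ~~ (is_leg k && is_leg k') ->
  ~~ has (mem (fan_ends k)) (fan_ends k') -> fan_pts k w -> fan_pts k' w -> False.
Proof.
have spoke_rim i j : (i <= m)%N -> (j < m)%N -> i != j -> i != j.+1 ->
    seg H (S i) w -> seg (S j) (S j.+1) w -> False.
  move=> im jm ij ij1 /spoke_o ow rw.
  have [lt|gt] := ltnP i j; first by have := rim_gt lt jm rw; lra.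
  have gt1 : (j.+1 < i)%N by rewrite ltn_neqAle eq_sym ij1 ltn_neqAle eq_sym ij.
  by have := rim_lt gt1 im rw; lra.
have spoke_leg0 i : (i <= m)%N -> i != 0%N -> seg H (S i) w -> ray (S 0) p w -> False.
  by rewrite -lt0n => im i0 /spoke_o ow /(leg0_lt i0 im); lra.
have spoke_leg1 i : (i <= m)%N -> i != m -> seg H (S i) w -> ray (S m) q w -> False.
  by move=> im im1 /spoke_o ow /(@leg1_gt i); rewrite ltn_neqAle im im1 => /(_ isT); lra.
have rim_rim i j : (i < m)%N -> (j < m)%N -> (i.+1 < j)%N ->
    seg (S i) (S i.+1) w -> seg (S j) (S j.+1) w -> False.
  move=> im jm ij rw rw'.
  by have := rim_gt ij jm rw'; have := rim_le (ltnSn i) im rw; lra.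
have rim_leg0 i : (i < m)%N -> i != 0%N -> seg (S i) (S i.+1) w -> ray (S 0) p w -> False.
  rewrite -lt0n => im i0 rw /(leg0_lt i0 (ltnW im)); have := rim_ge (leqnn i) im rw; lra.
have rim_leg1 i : (i < m)%N -> i.+1 != m -> seg (S i) (S i.+1) w -> ray (S m) q w -> False.
  move=> im im1 rw; have im2 : (i.+1 < m)%N by rewrite ltn_neqAle im1.
  by move/(leg1_gt im2); have := rim_le (ltnSn i) im rw; lra.
case: k => [i|i|||]; case: k' => [j|j|||] //=; rewrite ?inE ?orbF //=; move=> v1 v2 _.
- rewrite !negb_or -!/(_ == _) => /andP[n1 n2]; apply: spoke_rim => //.
    by move: n1; rewrite eq_sym.
  by move: n2; rewrite eq_sym.
- by move=> n1; apply: spoke_leg0; rewrite // eq_sym.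
- by move=> n1; apply: spoke_leg1; rewrite // eq_sym.
- rewrite !negb_or => /andP[n1 n2] p1 p2; apply: (spoke_rim j i) => //.
- rewrite !negb_or => /andP[/andP[n1 n2] /andP[n3 n4]] p1 p2.
  move: n1 n2 n3 n4; rewrite !(inj_eq (@Some_inj _)) => n1 n2 n3 n4.
  have [lt|gt] := ltnP i j.
    by apply: (rim_rim i j) => //; rewrite ltn_neqAle eq_sym n2.
  by apply: (rim_rim j i) => //; rewrite ltn_neqAle n3 ltn_neqAle n1.
- by move=> n1 p1 p2; apply: (rim_leg0 i) => //; rewrite eq_sym.
- by rewrite negb_or => /andP[n1 n2] p1 p2; apply: (rim_leg1 i) => //; rewrite eq_sym.
- by move=> _; apply: legH_rim.
- by move=> n1 p1 p2; apply: (spoke_leg0 j).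
- by move=> n1 p1 p2; apply: (rim_leg0 j).
- by move=> n1 p1 p2; apply: (spoke_leg1 j).
- by rewrite negb_or => /andP[n1 n2] p1 p2; apply: (rim_leg1 j).
- by move=> _ p1 p2; apply: legH_rim p2 p1.
Qed.

(** A path vertex is the end of its spoke, so [fan_disjoint] applies to that spoke; the hub, [LegH]
    and the spokes are treated directly. *)
Lemma fan_vertex k c : fan_valid k -> (if c is Some i then (i <= m)%N else true) ->
  c \notin fan_ends k -> ~ fan_pts k (fan_pos c).
Proof.
move=> vk; case: c => [i|] vc nc pc; last first.
  case: k vk nc pc => [j|j|||] //= vj _; first exact: rim_hub.
    by move/(leg0_lt m0 (leqnn m)); rewrite /o orient_self; lra.
  by move/(leg1_gt m0); rewrite /o orient_self; lra.
have [lk|lk] := boolP (if k is LegH then true else false).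
  case: k lk vk nc pc => // _ _ _ pc.
  move: vc; rewrite leq_eqVlt => /orP[/eqP im|im]; last first.
    by apply: (legH_rim im _ pc); apply: seg_l.
  move: pc; rewrite im -(prednK m0) => pc.
  by apply: (@legH_rim m.-1 _ _ _ pc); [rewrite prednK | rewrite prednK //; apply: seg_r].
have [sk|sk] := boolP (if k is Spoke _ then true else false).
  case: k sk vk nc pc {lk} => // j _ /= jm; rewrite !inE => ij /spoke_o.
  have [lt|gt|eq] := ltngtP i j; last by rewrite eq eqxx in ij.
    by have := star_gt lt jm; lra.
  by have := star_lt gt vc; lra.
apply: (@fan_disjoint (Spoke i) k (S i)) => //; last exact: seg_r.
case: k vk nc pc lk sk => [j|j|||] //=; rewrite !inE ?orbF.
- rewrite !negb_or => _ /andP[n1 n2] _ _ _.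
  by rewrite /= -(eq_sym (Some i)) n1 -(eq_sym (Some i)) n2.
- by move=> _ n1 _ _ _; rewrite /= -(eq_sym (Some i)) n1.
- by move=> _ n1 _ _ _; rewrite /= -(eq_sym (Some i)) n1.
Qed.

End Fan.

Definition vadd (a b : R * R) : R * R := (fst a + fst b, snd a + snd b).
Definition vscale (c : R) (a : R * R) : R * R := (c * fst a, c * snd a).

Definition opposite (a b : R * R) : Prop := exists l, 0 < l /\ a = vscale (- l) b.
Definition codirected (a b : R * R) : Prop := exists l, 0 < l /\ a = vscale l b.

Lemma parallel_cases a b : a <> (0, 0) -> b <> (0, 0) -> det a b = 0 ->
  opposite a b \/ codirected a b.
Proof.
case: a => a1 a2; case: b => b1 b2 a0 b0; rewrite /det /= => d0.
have [l E] : exists l, (a1, a2) = vscale l (b1, b2).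
  rewrite /vscale /=; have [h|h] := classic (b1 = 0).
    have b2n : b2 <> 0 by move=> h2; apply: b0; rewrite h h2.
    exists (a2 / b2); congr pair; last by field.
    rewrite h; have : a1 * b2 = 0 by move: d0; rewrite h; lra.
    by case/Rmult_integral => // ->; ring.
  exists (a1 / b1); congr pair; first by field.
  have -> : a1 / b1 * b2 = (a1 * b2) / b1 by field.
  have -> : a1 * b2 = a2 * b1 by lra.
  by field.
have [l0|[l0|l0]] := Rtotal_order l 0.
- by left; exists (- l); split; [lra | rewrite Ropp_involutive].
- by case: a0; rewrite E l0 /vscale /=; congr pair; ring.
- by right; exists l.
Qed.

Lemma sign_pos x : x <> 0 -> exists sg, (sg = 1 \/ sg = -1) /\ 0 < sg * x.
Proof.
move=> x0; have [l0|[//|l0]] := Rtotal_order x 0.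
  by exists (-1); split; [right | lra].
by exists 1; split; [left | lra].
Qed.

(* With the hub at [eps * kap * r] and the path along the segment from
   [eps * eta * p] to [eps * eta * q], these conditions say that the hub sees the
   path in angular order and that the three legs towards [p], [q], [r] leave the
   fan without meeting it again. *)
Definition frame_spec (p q r : R * R) (sg kap eta : R) : Prop :=
  [/\ 0 <= kap <= 1, 0 < eta <= 1,
      0 < eta * (sg * det p q) + kap * (sg * det r p - sg * det r q),
      (forall t, 0 <= t <= 1 ->
         - (eta * t * (sg * det p q)) - kap * (sg * det r p) <= 0 /\
         0 <= eta * (1 - t) * (sg * det p q) - kap * (sg * det r q)) &
      sg * det p r < 0 \/ 0 < sg * det q r].

(** A small eta lets the terms with kap = 1 dominate those with [det p q]; the minimum of 1, a and
    -b divided by |c| + 1 is small enough. *)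
Lemma frame_splitting p q r sg : 0 < sg * det r p -> sg * det r q < 0 ->
  exists eta, frame_spec p q r sg 1 eta.
Proof.
set a := sg * det r p; set b := sg * det r q => a0 b0.
pose c := sg * det p q.
have [eta [e0 e1 ea eb]] : exists eta,
    [/\ 0 < eta, eta <= 1, eta * Rabs c <= a & eta * Rabs c <= - b].
  have cc := Rabs_pos c.
  pose mn := Rmin 1 (Rmin a (- b)).
  have mn0 : 0 < mn by apply: Rmin_pos; [lra | apply: Rmin_pos; lra].
  have mna : mn <= a by apply: Rle_trans (Rmin_r _ _) (Rmin_l _ _).
  have mnb : mn <= - b by apply: Rle_trans (Rmin_r _ _) (Rmin_r _ _).
  have mn1 : mn <= 1 by apply: Rmin_l.
  pose d := / (Rabs c + 1).
  have d0 : 0 < d by apply: Rinv_0_lt_compat; lra.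
  have dE : d * (Rabs c + 1) = 1 by rewrite /d; field; lra.
  have d1 : d <= 1 by nra.
  exists (mn * d); split; [nra | nra | |];
    have : mn * (d * (Rabs c + 1)) = mn by [rewrite dE; ring]; nra.
exists eta; split; first lra; first lra; rewrite -/a -/b -/c.
- have h := Rle_abs (- c); rewrite Rabs_Ropp in h.
  have h3 : eta * - c <= eta * Rabs c by apply: Rmult_le_compat_l; lra.
  clearbody a b c; lra.
- move=> t ht; have h1 := Rle_abs c; have h2 := Rle_abs (- c); rewrite Rabs_Ropp in h2.
  have cc := Rabs_pos c; clearbody a b c; move: (Rabs c) ea eb h1 h2 cc => k ea eb h1 h2 cc.
  have K0 : 0 <= eta * k by apply: Rmult_le_pos; lra.
  have h3 : t * (eta * k) <= eta * k by nra.
  have h4 : (1 - t) * (eta * k) <= eta * k by nra.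
  have h5 : eta * t * - c <= eta * t * k.
    by apply: Rmult_le_compat_l; [apply: Rmult_le_pos; lra | lra].
  have h6 : eta * (1 - t) * - c <= eta * (1 - t) * k.
    by apply: Rmult_le_compat_l; [apply: Rmult_le_pos; lra | lra].
  by split; lra.
left; have : det p r = - det r p by rewrite /det; ring.
by move=> ->; move: a0; rewrite /a; nra.
Qed.

(* Either the sector between [p] and [q] avoids [r] and is convex, and the hub
   stays at the centre, or [r] strictly separates [p] from [q] and the hub
   moves out along [r]. *)
Lemma frame_exists p q r : p <> (0, 0) -> q <> (0, 0) -> r <> (0, 0) ->
  ~ codirected p q -> ~ codirected p r -> ~ codirected q r ->
  exists sg kap eta, frame_spec p q r sg kap eta.
Proof.
move=> p0 q0 r0 pq pr qr; have [d0|d0] := classic (det p q = 0).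
  (* Parallel p and q must be opposite. Then r is not parallel to them, being codirected with
     neither, so its line has p and q strictly on different sides. *)
  have [[l [l0 pE]]|//] := parallel_cases p0 q0 d0.
  have drq : det r q <> 0.
    move=> drq; have dqr : det q r = 0 by move: drq; rewrite /det; lra.
    have [[u [u0 qE]]|//] := parallel_cases q0 r0 dqr.
    by apply: pr; exists (l * u); split; [nra | rewrite pE qE /vscale /=; congr pair; ring].
  have [|sg [_ sgP]] := @sign_pos (- det r q); first lra.
  have [||eta fr] := @frame_splitting p q r sg.
  - have -> : det r p = - l * det r q by rewrite pE /det /vscale /=; ring.
    nra.
  - nra.
  by exists sg, 1, eta.
have [sg [sg1 sgP]] := sign_pos d0.
have [c4|c4] := classic (sg * det p r < 0 \/ 0 < sg * det q r).
  exists sg, 0, 1; split => //; try lra.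
  by move=> t ht; split; nra.
have c41 : 0 <= sg * det p r by apply: Rnot_lt_le => h; apply: c4; left.
have c42 : sg * det q r <= 0 by apply: Rnot_lt_le => h; apply: c4; right.
have s2 : sg * sg = 1 by case: sg1 => ->; ring.
have dpr : det p r <> 0.
  move=> h; have [[l [l0 pE]]|//] := parallel_cases p0 r0 h.
  have : det p q = l * det q r by rewrite pE /det /vscale /=; ring.
  by move=> E; move: sgP; rewrite E; nra.
have dqr : det q r <> 0.
  move=> h; have [[l [l0 qE]]|//] := parallel_cases q0 r0 h.
  have : det p q = - l * det p r by rewrite qE /det /vscale /=; ring.
  by move=> E; move: sgP; rewrite E; nra.
have rp : det r p = - det p r by rewrite /det; ring.
have rq : det r q = - det q r by rewrite /det; ring.
(* Here r lies strictly inside the convex sector between p and q. Seen from a hub moved out along r,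
   the path runs the other way, hence the sign [- sg]. *)
have [||eta fr] := @frame_splitting p q r (- sg).
- by rewrite rp; case: sg1 => E; move: c41; rewrite E; lra.
- by rewrite rq; case: sg1 => E; move: c42; rewrite E; lra.
by exists (- sg), 1, eta.
Qed.

(** * Coordinates of the fan near the replaced vertex *)

Section FanPlacement.
Variables (v p q r : R * R) (sg kap eta eps : R) (m : nat).
Hypothesis m0 : (0 < m)%N.
Hypothesis fr : frame_spec p q r sg kap eta.
Hypothesis eps0 : 0 < eps.

Definition tau (i : nat) : R := INR i / INR m.

Definition hub_pt : R * R := vadd v (vscale (eps * kap) r).

Definition rim_pt (i : nat) : R * R :=
  vadd v (vscale (eps * eta) (vadd (vscale (1 - tau i) p) (vscale (tau i) q))).

Let Rm0 : 0 < INR m. Proof. by apply: lt_0_INR; apply/ltP. Qed.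

Lemma tau_lt i j : (i < j)%N -> tau i < tau j.
Proof.
move=> /ltP/lt_INR ij; rewrite /tau /Rdiv; apply: Rmult_lt_compat_r => //.
exact: Rinv_0_lt_compat.
Qed.

Lemma tau0 : tau 0 = 0.
Proof. by rewrite /tau /= /Rdiv Rmult_0_l. Qed.

Lemma taum : tau m = 1.
Proof. by rewrite /tau; field; lra. Qed.

Lemma tau_bound i : (i <= m)%N -> 0 <= tau i <= 1.
Proof.
move=> im; rewrite -tau0 -taum; split.
  by case: i im => [|i] _; [lra | apply: Rlt_le; apply: tau_lt].
move: im; rewrite leq_eqVlt => /orP[/eqP ->|im]; first lra.
by apply: Rlt_le; apply: tau_lt.
Qed.

Lemma placement_star i j : (i < j)%N -> (j <= m)%N ->
  0 < sg * orient hub_pt (rim_pt i) (rim_pt j).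
Proof.
move=> ij jm; case: fr => k1 e1 f1 _ _.
have -> : sg * orient hub_pt (rim_pt i) (rim_pt j) = (eps * eps * eta) * ((tau j - tau i) *
    (eta * (sg * det p q) + kap * (sg * det r p - sg * det r q))).
  by rewrite /orient /det /vsub /hub_pt /rim_pt /vadd /vscale /=; ring.
have := tau_lt ij => tt.
by apply: Rmult_lt_0_compat; apply: Rmult_lt_0_compat; nra.
Qed.

Lemma placement_leg0 i : (0 < i)%N -> (i <= m)%N ->
  sg * det (vsub (rim_pt i) hub_pt) p <= 0.
Proof.
move=> _ /tau_bound tb; case: fr => _ _ _ /(_ _ tb)[f2 _] _.
have -> : sg * det (vsub (rim_pt i) hub_pt) p =
    eps * (- (eta * tau i * (sg * det p q)) - kap * (sg * det r p)).
  by rewrite /det /vsub /hub_pt /rim_pt /vadd /vscale /=; ring.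
nra.
Qed.

Lemma placement_leg1 i : (i < m)%N -> 0 <= sg * det (vsub (rim_pt i) hub_pt) q.
Proof.
move=> /ltnW/tau_bound tb; case: fr => _ _ _ /(_ _ tb)[_ f2] _.
have -> : sg * det (vsub (rim_pt i) hub_pt) q =
    eps * (eta * (1 - tau i) * (sg * det p q) - kap * (sg * det r q)).
  by rewrite /det /vsub /hub_pt /rim_pt /vadd /vscale /=; ring.
nra.
Qed.

Lemma placement_legH : sg * det (vsub (rim_pt 0) hub_pt) r < 0 \/
  0 < sg * det (vsub (rim_pt m) hub_pt) r.
Proof.
case: fr => _ e1 _ _ f4.
have -> : sg * det (vsub (rim_pt 0) hub_pt) r = eps * eta * (sg * det p r).
  by rewrite /det /vsub /hub_pt /rim_pt /vadd /vscale /= tau0; ring.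
have -> : sg * det (vsub (rim_pt m) hub_pt) r = eps * eta * (sg * det q r).
  by rewrite /det /vsub /hub_pt /rim_pt /vadd /vscale /= taum; ring.
have ee : 0 < eps * eta by nra.
by case: f4 => f4; [left | right]; nra.
Qed.

Definition inbox (d : R) (w : R * R) : Prop :=
  Rabs (fst w - fst v) <= d /\ Rabs (snd w - snd v) <= d.

Lemma inbox_seg d a b w : inbox d a -> inbox d b -> seg a b w -> inbox d w.
Proof.
have conv x y z t : 0 <= t <= 1 -> Rabs (x - z) <= d -> Rabs (y - z) <= d ->
    Rabs (x + t * (y - x) - z) <= d.
  move=> ht hx hy; have -> : x + t * (y - x) - z = (1 - t) * (x - z) + t * (y - z) by ring.
  apply: Rle_trans (Rabs_triang _ _) _; rewrite !Rabs_mult.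
  rewrite (Rabs_pos_eq t); last lra; rewrite (Rabs_pos_eq (1 - t)); last lra.
  nra.
by move=> [a1 a2] [b1 b2] [t [ht ->]]; split; apply: conv.
Qed.

Lemma hub_inbox d : eps * (Rabs (fst r) + Rabs (snd r)) <= d -> inbox d hub_pt.
Proof.
case: fr => k1 _ _ _ _ hd; rewrite /inbox /hub_pt /vadd /vscale /=.
have h x : Rabs (eps * kap * x) <= eps * Rabs x.
  rewrite !Rabs_mult (Rabs_pos_eq eps); last lra; rewrite (Rabs_pos_eq kap); last lra.
  have := Rabs_pos x => hx; have : kap * Rabs x <= Rabs x by nra.
  by nra.
have h1 := h (fst r); have h2 := h (snd r).
have p1 := Rabs_pos (fst r); have p2 := Rabs_pos (snd r).
split.
  have -> : fst v + eps * kap * fst r - fst v = eps * kap * fst r by ring.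
  nra.
have -> : snd v + eps * kap * snd r - snd v = eps * kap * snd r by ring.
nra.
Qed.

Lemma rim_inbox d i : (i <= m)%N ->
  eps * (Rabs (fst p) + Rabs (snd p) + (Rabs (fst q) + Rabs (snd q))) <= d ->
  inbox d (rim_pt i).
Proof.
case: fr => _ e1 _ _ _ /tau_bound; rewrite /inbox /rim_pt /vadd /vscale /=.
move: (tau i) => t tb hd.
have h x y : Rabs (eps * eta * ((1 - t) * x + t * y)) <= eps * (Rabs x + Rabs y).
  have xx := Rabs_pos x; have yy := Rabs_pos y.
  have : Rabs ((1 - t) * x + t * y) <= Rabs x + Rabs y.
    apply: Rle_trans (Rabs_triang _ _) _; rewrite !Rabs_mult.
    rewrite (Rabs_pos_eq t); last lra; rewrite (Rabs_pos_eq (1 - t)); last lra.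
    nra.
  rewrite Rabs_mult; set u := Rabs (_ + _) => hu; have u0 : 0 <= u by apply: Rabs_pos.
  rewrite Rabs_mult (Rabs_pos_eq eps); last lra; rewrite (Rabs_pos_eq eta); last lra.
  have : eta * u <= u by nra.
  by nra.
have h1 := h (fst p) (fst q); have h2 := h (snd p) (snd q).
have p1 := Rabs_pos (fst p); have p2 := Rabs_pos (snd p).
have p3 := Rabs_pos (fst q); have p4 := Rabs_pos (snd q).
split.
  have -> : forall c, fst v + c - fst v = c by move=> c; ring.
  nra.
have -> : forall c, snd v + c - snd v = c by move=> c; ring.
nra.
Qed.

End FanPlacement.

Lemma seg_away v a b : ~ seg a b v ->
  exists d, 0 < d /\ forall w, seg a b w -> ~ inbox v d w.
Proof.
move=> nv.
pose f t := (fst a + t * (fst b - fst a) - fst v) * (fst a + t * (fst b - fst a) - fst v) +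
  (snd a + t * (snd b - snd a) - snd v) * (snd a + t * (snd b - snd a) - snd v).
have cf : forall c, 0 <= c <= 1 -> continuity_pt f c by move=> c _; rewrite /f; reg.
have [|t0 [mn ht0]] := continuity_ab_min f 0 1 _ cf; first lra.
have f0 : 0 < f t0.
  apply: Rnot_le_lt => le; apply: nv; exists t0; split => //.
  move: le; rewrite /f; set x := fst a + _ - _; set y := snd a + _ - _ => le.
  have x0 : x = 0 by nra.
  have y0 : y = 0 by nra.
  by rewrite [v]surjective_pairing; congr pair; move: x0 y0; rewrite /x /y; lra.
(* In a box of half-width d at most 1 the squared distance to v is at most 2d, so a quarter of its
   minimum on the segment suffices. *)
exists (Rmin 1 (f t0 / 4)); split; first by apply: Rmin_pos; lra.
move=> w [t [ht ->]] [] /=; have := mn t ht; rewrite {2}/f.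
set x := fst a + _ - _; set y := snd a + _ - _; set d := Rmin _ _ => le hx hy.
have d1 : d <= 1 by apply: Rmin_l.
have d2 : d <= f t0 / 4 by apply: Rmin_r.
have hx2 : x * x <= d.
  have := Rabs_pos x; have -> : x * x = Rabs x * Rabs x by rewrite -Rabs_mult Rabs_pos_eq //; nra.
  nra.
have hy2 : y * y <= d.
  have := Rabs_pos y; have -> : y * y = Rabs y * Rabs y by rewrite -Rabs_mult Rabs_pos_eq //; nra.
  nra.
lra.
Qed.

Lemma uniform_delta (I : finType) (P : I -> R -> Prop) :
  (forall i d d', 0 < d -> d <= d' -> P i d' -> P i d) ->
  (forall i, exists d, 0 < d /\ P i d) -> exists d, 0 < d /\ forall i, P i d.
Proof.
move=> mon ex.
suff [d [d0 dP]] : exists d, 0 < d /\ forall i, i \in enum I -> P i d.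
  by exists d; split => // i; apply: dP; rewrite mem_enum.
elim: (enum I) => [|i l [d [d0 dP]]]; first by exists 1; split; [lra|].
have [d' [d'0 d'P]] := ex i.
exists (Rmin d d'); split; first exact: Rmin_pos.
move=> j; rewrite inE => /predU1P[->|jl].
  by apply: mon d'P; [apply: Rmin_pos | apply: Rmin_r].
by apply: mon (dP j jl); [apply: Rmin_pos | apply: Rmin_l].
Qed.

(** Both segments leave v in the same direction, so the shorter one ends on the longer one. In a
    straight drawing this puts a vertex on an edge and is therefore excluded. *)
Lemma seg_common v a b w : seg v a w -> seg v b w -> w <> v -> seg v a b \/ seg v b a.
Proof.
case=> s [hs ->] [t [ht [E1 E2]]] nv.
have s0 : 0 < s.
  have [//|h] := Rle_lt_or_eq_dec 0 s (proj1 hs).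
  by case: nv; rewrite -h; case: (v) => x y /=; congr pair; ring.
have t0 : 0 < t.
  have [//|h] := Rle_lt_or_eq_dec 0 t (proj1 ht).
  case: nv; move: E1 E2; rewrite -h; case: (v) => x y /= E1 E2.
  by congr pair; lra.
have [le|lt] := Rle_lt_dec s t.
  left; exists (s / t); split.
    split; first by apply: Rlt_le; apply: Rdiv_lt_0_compat.
    by apply: (Rmult_le_reg_r t) => //; field_simplify; lra.
  case: (b) E1 E2 => x y /= E1 E2; congr pair.
    have -> : s / t * (fst a - fst v) = (s * (fst a - fst v)) / t by field; lra.
    have -> : s * (fst a - fst v) = t * (x - fst v) by lra.
    by field; lra.
  have -> : s / t * (snd a - snd v) = (s * (snd a - snd v)) / t by field; lra.
  have -> : s * (snd a - snd v) = t * (y - snd v) by lra.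
  by field; lra.
right; exists (t / s); split.
  split; first by apply: Rlt_le; apply: Rdiv_lt_0_compat.
  by apply: (Rmult_le_reg_r s) => //; field_simplify; lra.
case: (a) E1 E2 => x y /= E1 E2; congr pair.
  have -> : t / s * (fst b - fst v) = (t * (fst b - fst v)) / s by field; lra.
  have -> : t * (fst b - fst v) = s * (x - fst v) by lra.
  by field; lra.
have -> : t / s * (snd b - snd v) = (t * (snd b - snd v)) / s by field; lra.
have -> : t * (snd b - snd v) = s * (y - snd v) by lra.
by field; lra.
Qed.

(** The new leg is a terminal piece of the old edge, so it can be compared with the old drawing and,
    as part of a ray, with the fan. *)
Lemma leg_seg v d mu w : 0 <= mu < 1 -> seg (vadd v (vscale mu d)) (vadd v d) w ->
  [/\ seg v (vadd v d) w, ray (vadd v (vscale mu d)) d w &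
      0 < mu -> d <> (0, 0) -> w <> v].
Proof.
move=> hm [t [ht ->]]; rewrite /vadd /vscale /=; split.
- exists (mu + t * (1 - mu)); split; first nra.
  by congr pair; rewrite /=; ring.
- exists (t * (1 - mu)); split; first nra.
  by congr pair; rewrite /=; ring.
move=> m0 d0 E; apply: d0; case: v d E => x y [a b] /= [E1 E2].
have k0 : 0 < mu + t * (1 - mu) by nra.
congr pair.
  have : (mu + t * (1 - mu)) * a = 0 by lra.
  by case/Rmult_integral => //; lra.
have : (mu + t * (1 - mu)) * b = 0 by lra.
by case/Rmult_integral => //; lra.
Qed.

(** * Replacing a cubic vertex by a fan *)

Definition straight (T : finType) (e : rel T) (pos : T -> R * R) : Prop :=
  injective pos /\
  forall x y z, e x y -> z != x -> z != y -> ~ seg (pos x) (pos y) (pos z).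

(** Adjacent edges are left aside: by [seg_common] they meet only in their common end in a straight
    drawing. *)
Definition segs_cross (T : finType) (e : rel T) (pos : T -> R * R) (x y u v : T) : Prop :=
  [/\ e x y, e u v, [&& x != u, x != v, y != u & y != v] &
      exists w, seg (pos x) (pos y) w /\ seg (pos u) (pos v) w].

Lemma segs_crossC (T : finType) (e : rel T) pos x y u v :
  segs_cross e pos x y u v -> segs_cross e pos u v x y.
Proof.
case=> exy euv /and4P[xu xv yu yv] [w [w1 w2]]; split => //; last by exists w.
by rewrite ![u == _]eq_sym ![v == _]eq_sym xu yu xv yv.
Qed.

Section Expansion.
Variables (T T' : finType) (e : rel T) (e' : rel T') (pi : T -> T') (xi : T').
Variables (h : T) (s : seq T) (oh o0 o1 : T').
Hypotheses (sym : symmetric e) (irr : irreflexive e) (sym' : symmetric e') (irr' : irreflexive e').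
Hypothesis us : uniq (h :: s).
Hypothesis s2 : (1 < size s)%N.
(** [pi] contracts the hub h and the path s to [xi]. Edges within s join consecutive vertices, and
    edges leaving the fan start at the hub or an end of s, with one target for each of the three. *)
Hypothesis piP : forall t, (pi t == xi) = (t \in h :: s).
Hypothesis pi_inj : forall t t', t \notin h :: s -> pi t = pi t' -> t = t'.
Hypothesis e_pi : forall x y, e x y -> pi x != pi y -> e' (pi x) (pi y).
Hypothesis e_rim : forall x y, x \in s -> y \in s -> e x y ->
  index y s = (index x s).+1 \/ index x s = (index y s).+1.
Hypothesis e_out : forall x y, x \in h :: s -> y \notin h :: s -> e x y ->
  [\/ x = h /\ pi y = oh, index x s = 0%N /\ x \in s /\ pi y = o0 |
      index x s = (size s).-1 /\ x \in s /\ pi y = o1].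
Hypotheses (exh : e' xi oh) (ex0 : e' xi o0) (ex1 : e' xi o1).
Hypotheses (o01 : o0 != o1) (o0h : o0 != oh) (o1h : o1 != oh).
Variable pos' : T' -> R * R.
Hypothesis str' : straight e' pos'.

Let X := h :: s.
Let v := pos' xi.
Let p := vsub (pos' o0) v.
Let q := vsub (pos' o1) v.
Let r := vsub (pos' oh) v.
Let m := (size s).-1.

Let m0 : (0 < m)%N. Proof. by rewrite /m; case: (size s) s2 => // -[|n]. Qed.

Let xi_o o : e' xi o -> o != xi.
Proof. by move=> exo; apply: contraTneq exo => ->; rewrite irr'. Qed.

Let vaddsub a : vadd v (vsub a v) = a.
Proof. by case: a => x y; rewrite /vadd /vsub /=; congr pair; ring. Qed.

Let dir0 o : e' xi o -> vsub (pos' o) v <> (0, 0).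
Proof.
move=> /xi_o /eqP oxi E; apply: oxi; apply: (proj1 str').
by rewrite -[LHS]vaddsub E /vadd /v; case: (pos' xi) => x y /=; congr pair; ring.
Qed.

(** Codirected legs would put the nearer neighbour on the old edge to the other one. *)
Let not_codir o o' : e' xi o -> e' xi o' -> o != o' ->
  ~ codirected (vsub (pos' o) v) (vsub (pos' o') v).
Proof.
move=> ex ex' ne [l [l0 E]].
have Eo : pos' o = vadd v (vscale l (vsub (pos' o') v)) by rewrite -E vaddsub.
have [le|lt] := Rle_lt_dec l 1.
  case: (proj2 str' xi o' o ex' (xi_o ex) ne); exists l; split; first lra.
  by rewrite Eo.
have ne' : o' != o by rewrite eq_sym.
case: (proj2 str' xi o o' ex (xi_o ex') ne'); exists (/ l); split.
  split; first by apply: Rlt_le; apply: Rinv_0_lt_compat; lra.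
  by rewrite -Rinv_1; apply: Rinv_le_contravar; lra.
rewrite Eo /vadd /vscale /vsub -/v [LHS]surjective_pairing /=.
by congr pair; field; lra.
Qed.

Definition code (t : T) : option nat := if t == h then None else Some (index t s).

Let code_h : code h = None. Proof. by rewrite /code eqxx. Qed.

Let code_s t : t \in s -> code t = Some (index t s).
Proof. by rewrite /code; case: eqP => // -> hs; move: us; rewrite /= hs. Qed.

Let code_inj t t' : t \in X -> t' \in X -> code t = code t' -> t = t'.
Proof.
rewrite !inE => /predU1P[->|ts] /predU1P[->|ts'] //; rewrite ?code_h ?code_s //.
by case=> /(congr1 (nth h s)); rewrite !nth_index.
Qed.

Let index_m t : t \in s -> (index t s <= m)%N.
Proof. by rewrite -index_mem /m; case: (size s). Qed.

Section Placed.
Variables (sg kap eta eps dl : R).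
Hypothesis fr : frame_spec p q r sg kap eta.
Hypotheses (eps0 : 0 < eps) (eps1 : eps < 1).
(** No old edge avoiding [xi] and, taking a = b, no other old vertex enters the box around v that
    will hold the fan. *)
Hypothesis far : forall a b, a != xi -> b != xi -> (a == b) || e' a b ->
  forall w, seg (pos' a) (pos' b) w -> ~ inbox v dl w.
Hypothesis eps_r : eps * (Rabs (fst r) + Rabs (snd r)) <= dl.
Hypothesis eps_pq :
  eps * (Rabs (fst p) + Rabs (snd p) + (Rabs (fst q) + Rabs (snd q))) <= dl.

Let H := hub_pt v r kap eps.
Let S := rim_pt v p q eta eps m.
Let pts := fan_pts H S m p q r.
Let fpos := fan_pos H S.

Definition fan_place (t : T) : R * R :=
  if t \in h :: s then fpos (code t) else pos' (pi t).

Let disj k k' w : fan_valid m k -> fan_valid m k' -> ~~ (is_leg k && is_leg k') ->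
  ~~ has (mem (fan_ends m k)) (fan_ends m k') -> pts k w -> pts k' w -> False.
Proof.
apply: (@fan_disjoint sg) => //.
- exact: placement_star.
- exact: placement_leg0.
- exact: placement_leg1.
- exact: placement_legH.
Qed.

Let vert k c : fan_valid m k -> (if c is Some i then (i <= m)%N else true) ->
  c \notin fan_ends m k -> ~ pts k (fpos c).
Proof.
apply: (@fan_vertex sg) => //.
- exact: placement_star.
- exact: placement_leg0.
- exact: placement_leg1.
- exact: placement_legH.
Qed.

Let place_in t : t \in X -> inbox v dl (fan_place t).
Proof.
move=> tX; rewrite /fan_place tX /fpos; move: tX; rewrite inE => /predU1P[->|ts].
  by rewrite code_h; apply: (hub_inbox _ fr).
by rewrite code_s //; apply: (rim_inbox _ m0 fr) => //; apply: index_m.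
Qed.

Let place_out t : t \notin X -> fan_place t = pos' (pi t).
Proof. by rewrite /fan_place => /negPf ->. Qed.

Let out_far t : t \notin X -> ~ inbox v dl (fan_place t).
Proof.
move=> tX; rewrite place_out //.
by apply: (@far (pi t) (pi t)); rewrite ?piP ?eqxx //; apply: seg_l.
Qed.

Let hub_mu : 0 <= eps * kap < 1.
Proof. by case: fr => k1 _ _ _ _; nra. Qed.

Let rim_mu : 0 < eps * eta < 1.
Proof. by case: fr => _ e1 _ _ _; nra. Qed.

Let S0E : S 0%N = vadd v (vscale (eps * eta) p).
Proof. by rewrite /S /rim_pt tau0 /vadd /vscale /=; congr pair; ring. Qed.

Let SmE : S m = vadd v (vscale (eps * eta) q).
Proof. by rewrite /S /rim_pt taum // /vadd /vscale /=; congr pair; ring. Qed.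

Definition inner_edge (k : fan_edge) (x y : T) : Prop :=
  [/\ x \in X, y \in X & ~~ is_leg k].

(** Only the hub may remain at the centre v, namely when kap = 0; hence the exception for [LegH]. *)
Definition leg_edge (k : fan_edge) (x y : T) : Prop :=
  [/\ x \in X, y \notin X, is_leg k, e' xi (pi y) &
    (forall w, seg (fan_place x) (fan_place y) w ->
       seg v (pos' (pi y)) w) /\
    (k <> LegH -> forall w, seg (fan_place x) (fan_place y) w -> w <> v)].

Definition edge_spec (k : fan_edge) (x y : T) : Prop :=
  [/\ fan_valid m k,
      forall w, seg (fan_place x) (fan_place y) w -> pts k w,
      (forall c, c \in fan_ends m k -> exists t, [/\ t \in X, (t = x \/ t = y) & code t = c]) &
      inner_edge k x y \/ leg_edge k x y].

Let inner_exists x y : e x y -> x \in X -> y \in X ->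
  exists k, edge_spec k x y \/ edge_spec k y x.
Proof.
move=> exy xX yX.
have placeS t : t \in s -> fan_place t = S (index t s).
  by move=> ts; rewrite /fan_place inE ts orbT /fpos code_s.
have placeH : fan_place h = H by rewrite /fan_place inE eqxx /fpos code_h.
have spoke t : t \in s -> edge_spec (Spoke (index t s)) h t.
  move=> ts; split; first exact: index_m.
  - by rewrite placeH placeS.
  - move=> c; rewrite !inE => /orP[/eqP->|/eqP->].
      by exists h; rewrite inE eqxx; split; [|left|].
    by exists t; rewrite inE ts orbT code_s //; split; [|right|].
  - by left; split; rewrite ?inE ?eqxx ?ts ?orbT.
have rim t t' : t \in s -> t' \in s -> index t' s = (index t s).+1 ->
    edge_spec (Rim (index t s)) t t'.
  move=> ts ts' E; split.
  - by rewrite /= -E; apply: index_m.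
  - by rewrite !placeS // E.
  - move=> c; rewrite !inE => /orP[/eqP->|/eqP->].
      by exists t; rewrite inE ts orbT code_s //; split; [|left|].
    by exists t'; rewrite inE ts' orbT code_s // E; split; [|right|].
  - by left; split; rewrite ?inE ?ts ?ts' ?orbT.
have xy : x != y.
  by apply/negP => /eqP E; move: exy; rewrite E irr.
move: (xX) (yX); rewrite !inE => /predU1P[xh|xs] /predU1P[yh|ys].
- by rewrite xh yh eqxx in xy.
- by exists (Spoke (index y s)); left; rewrite xh; apply: spoke.
- by exists (Spoke (index x s)); right; rewrite yh; apply: spoke.
have [E|E] := e_rim xs ys exy.
  by exists (Rim (index x s)); left; apply: rim.
by exists (Rim (index y s)); right; apply: rim.
Qed.

Let leg_exists x y : e x y -> x \in X -> y \notin X -> exists k, edge_spec k x y.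
Proof.
move=> exy xX yX.
have py : fan_place y = pos' (pi y) by apply: place_out.
have main k mu o : fan_valid m k -> is_leg k -> 0 <= mu < 1 -> (k <> LegH -> 0 < mu) ->
    pi y = o -> e' xi o -> fan_place x = vadd v (vscale mu (vsub (pos' o) v)) ->
    fan_ends m k = [:: code x] ->
    (forall w, ray (fan_place x) (vsub (pos' o) v) w -> pts k w) -> edge_spec k x y.
  move=> vk lk hmu kmu yo exo px kx rk.
  have lg w : seg (fan_place x) (fan_place y) w ->
      [/\ seg v (pos' o) w, ray (fan_place x) (vsub (pos' o) v) w & 0 < mu -> w <> v].
    rewrite px py yo -{2}(vaddsub (pos' o)) => /(leg_seg hmu)[h1 h2 h3].
    by split => //; [rewrite -(vaddsub (pos' o)) | move=> /h3; apply; apply: dir0].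
  split => //.
  - by move=> w /lg[_ rw _]; apply: rk.
  - by move=> c; rewrite kx inE => /eqP ->; exists x; split => //; left.
  right; split => //; first by rewrite yo.
  split; first by move=> w /lg[sw _ _]; rewrite yo.
  by move=> /kmu mu0 w /lg[_ _]; apply.
have rim_mu' : 0 <= eps * eta < 1 by lra.
have [[xh yo]|[ix [xs yo]]|[ix [xs yo]]] := e_out xX yX exy.
- exists LegH; apply: (main LegH (eps * kap) oh) => //.
  + by rewrite /fan_place -/X xX xh code_h.
  + by rewrite xh code_h.
  + by rewrite /fan_place -/X xX xh code_h.
- exists Leg0; apply: (main Leg0 (eps * eta) o0) => //.
  + by move=> _; lra.
  + by rewrite /fan_place -/X xX code_s // ix -S0E.
  + by rewrite code_s // ix.
  + by rewrite /fan_place -/X xX code_s // ix.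
exists Leg1; apply: (main Leg1 (eps * eta) o1) => //.
- by move=> _; lra.
- by rewrite /fan_place -/X xX code_s // ix -SmE.
- by rewrite code_s // ix.
- by rewrite /fan_place -/X xX code_s // ix.
Qed.

Let edge_exists x y : e x y -> (x \in X) || (y \in X) ->
  exists k, edge_spec k x y \/ edge_spec k y x.
Proof.
move=> exy; have [xX|xX] /= := boolP (x \in X).
  move=> _; have [yX|yX] := boolP (y \in X); first exact: inner_exists.
  by have [k ek] := leg_exists exy xX yX; exists k; left.
move=> yX; rewrite sym in exy.
by have [k ek] := leg_exists exy yX xX; exists k; right.
Qed.

Let place_inj : injective fan_place.
Proof.
move=> t t'; have [tX|tX] := boolP (t \in X); have [t'X|t'X] := boolP (t' \in X).
- move=> E; apply: code_inj => //; apply/eqP; apply: contraT => ne.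
  move: E; rewrite /fan_place -/X tX t'X => E0.
  have vc c : c \in X -> if code c is Some i then (i <= m)%N else true.
    by rewrite inE => /predU1P[->|cs]; rewrite ?code_h // code_s ?index_m.
  have hub_rim i : (i <= m)%N -> H <> S i.
    move=> im E; pose j := if i == 0%N then 1%N else 0%N.
    have jm : (j <= m)%N by rewrite /j; case: ifP.
    case: (@vert (Spoke j) (Some i)) => //; last by rewrite /fpos /= -E; apply: seg_l.
    by rewrite !inE; apply/negP => /eqP[ij]; move: ij; rewrite /j; case: eqP => [->|].
  have := vc t tX; have := vc t' t'X; move: ne E0.
  case: (code t) => [i|]; case: (code t') => [j|] // ne E jm im.
  + by case: (@vert (Spoke j) (Some i)) => //; rewrite ?E ?inE //; apply: seg_r.
  + by case: (hub_rim i).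
  + by case: (hub_rim j).
- by move=> E; case: (out_far t'X); rewrite -E; apply: place_in.
- by move=> E; case: (out_far tX); rewrite E; apply: place_in.
by rewrite !place_out // => /(proj1 str'); apply: pi_inj.
Qed.

Let no_vertex x y z : e x y -> z != x -> z != y ->
  ~ seg (fan_place x) (fan_place y) (fan_place z).
Proof.
move=> exy zx zy sz.
have [xyX|xyX] := boolP ((x \in X) || (y \in X)); last first.
  move: xyX; rewrite negb_or => /andP[xX yX].
  have xy : pi x != pi y.
    by apply/negP => /eqP /(pi_inj xX) E; rewrite E irr in exy.
  move: sz; rewrite (place_out xX) (place_out yX) => sz.
  have [zX|zX] := boolP (z \in X).
    by apply: (@far (pi x) (pi y)) sz _; rewrite ?piP ?e_pi ?orbT //; apply: place_in.
  apply: (proj2 str' _ _ (pi z) (e_pi exy xy)); rewrite ?(place_out zX) in sz *;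
    by [|apply: contraNneq zx => /(pi_inj zX) ->|apply: contraNneq zy => /(pi_inj zX) ->].
have {xyX} [k ek] := edge_exists exy xyX.
wlog {ek} ek : x y exy zx zy sz / edge_spec k x y.
  move=> W; case: ek => ek; first exact: (W x y).
  by apply: (W y x) => //; [rewrite sym | apply: segC].
case: ek => vk pk ck kk.
have [zX|zX] := boolP (z \in X).
  have zp : fan_place z = fpos (code z) by rewrite /fan_place -/X zX.
  apply: (@vert k (code z)) => //.
  - by move: zX; rewrite inE => /predU1P[->|cs]; rewrite ?code_h // code_s ?index_m.
  - apply/negP => /ck[t [tX txy ct]]; have E := code_inj tX zX ct.
    by case: txy => E'; move: zx zy; rewrite -E E' eqxx.
  - by rewrite -zp; apply: pk.
case: kk => [[xX yX _]|[xX yX _ exo [sv _]]].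
  by apply: (out_far zX); apply: inbox_seg sz; apply: place_in.
have := sv _ sz; rewrite (place_out zX); apply: (proj2 str') => //.
  by rewrite piP.
by apply: contraNneq zy => /(pi_inj zX) ->.
Qed.

Let ends_disjoint k k' x y u w : edge_spec k x y -> edge_spec k' u w ->
  [&& x != u, x != w, y != u & y != w] -> ~~ has (mem (fan_ends m k)) (fan_ends m k').
Proof.
move=> [_ _ ck _] [_ _ ck' _] /and4P[xu xw yu yw]; apply/hasPn => c cin'.
apply/negP => cin; have [t [tX txy ct]] := ck c cin; have [t' [t'X tuw ct']] := ck' c cin'.
have E : t = t' by apply: code_inj; rewrite // ct ct'.
by move: xu xw yu yw; case: txy => <-; case: tuw => <-; rewrite E eqxx.
Qed.

Let far_edge u w z : e u w -> u \notin X -> w \notin X ->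
  seg (fan_place u) (fan_place w) z ->
  [/\ e' (pi u) (pi w), seg (pos' (pi u)) (pos' (pi w)) z & ~ inbox v dl z].
Proof.
move=> euw uX wX sz.
have uw : pi u != pi w.
  by apply/negP => /eqP /(pi_inj uX) E; rewrite E irr in euw.
move: sz; rewrite !place_out // => sz; split => //; first exact: e_pi.
by apply: (far _ _ _ sz); rewrite ?piP ?e_pi ?orbT.
Qed.

(** Two legs lie on old edges at v, so a common point other than v would put a neighbour on the
    other's edge. The centre v can lie on [LegH] only, and two disjoint edges cannot both be that
    leg. *)
Let fan_fan k k' x y u w z : edge_spec k x y -> edge_spec k' u w ->
  [&& x != u, x != w, y != u & y != w] ->
  seg (fan_place x) (fan_place y) z -> seg (fan_place u) (fan_place w) z -> False.
Proof.
move=> ek ek' ne sz sz'; have nh := ends_disjoint ek ek' ne.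
case: ek => vk pk _ kk; case: ek' => vk' pk' _ kk'.
have [/andP[lk lk']|nl] := boolP (is_leg k && is_leg k'); last first.
  by apply: (disj vk vk' nl nh (pk _ sz) (pk' _ sz')).
case: kk => [[_ _]|[xX yX _ exo [sv nv]]]; first by rewrite lk.
case: kk' => [[_ _]|[uX wX _ exo' [sv' nv']]]; first by rewrite lk'.
have yw : pi y != pi w.
  by apply/negP => /eqP /(pi_inj yX) E; move: ne; rewrite E eqxx !andbF.
have [zv|zv] := classic (z = v).
  have kH : k = LegH by apply: NNPP => /nv; apply; eassumption.
  have kH' : k' = LegH by apply: NNPP => /nv'; apply; eassumption.
  by move: nh; rewrite kH kH'.
case: (seg_common (sv _ sz) (sv' _ sz') zv); apply: (proj2 str') => //.
- exact: xi_o.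
- by rewrite eq_sym.
- exact: xi_o.
Qed.

(** Edges away from the fan avoid the box, so only a leg can meet them, and then the old edge
    containing this leg crosses already. *)
Let fan_far k x y u w z : edge_spec k x y -> e u w -> u \notin X -> w \notin X ->
  [&& x != u, x != w, y != u & y != w] ->
  seg (fan_place x) (fan_place y) z -> seg (fan_place u) (fan_place w) z ->
  segs_cross e' pos' (pi x) (pi y) (pi u) (pi w).
Proof.
move=> [_ _ _ kk] euw uX wX /and4P[xu xw yu yw] sz sz'.
have [euw' sz2 nb] := far_edge euw uX wX sz'.
case: kk => [[xX yX _]|[xX yX _ exo [sv _]]].
  by case: nb; apply: inbox_seg sz; apply: place_in.
have xxi : pi x = xi by apply/eqP; rewrite piP.
rewrite xxi; split => //; last by exists z; split; [apply: sv|].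
rewrite ![xi == _]eq_sym !piP uX wX /=; apply/andP; split.
  by apply: contraNneq yu => /(pi_inj yX) ->.
by apply: contraNneq yw => /(pi_inj yX) ->.
Qed.

Let cross_pi x y u w : segs_cross e fan_place x y u w ->
  segs_cross e' pos' (pi x) (pi y) (pi u) (pi w).
Proof.
have swapl (a b c d : T) : [&& a != c, a != d, b != c & b != d] -> [&& b != c, b != d, a != c & a != d].
  by move=> /and4P[-> -> -> ->].
have swapr (a b c d : T) : [&& a != c, a != d, b != c & b != d] ->
    [&& a != d, a != c, b != d & b != c].
  by move=> /and4P[-> -> -> ->].
have half x1 y1 u1 w1 z : e x1 y1 -> e u1 w1 -> (x1 \in X) || (y1 \in X) ->
    u1 \notin X -> w1 \notin X -> [&& x1 != u1, x1 != w1, y1 != u1 & y1 != w1] ->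
    seg (fan_place x1) (fan_place y1) z -> seg (fan_place u1) (fan_place w1) z ->
    segs_cross e' pos' (pi x1) (pi y1) (pi u1) (pi w1).
  move=> e1 e2 A uX wX ne s1 s2'.
  have [k [ek|ek]] := edge_exists e1 A; first exact: (fan_far ek e2 uX wX ne s1 s2').
  have [h1 h2 h3 [t [h4 h5]]] := fan_far ek e2 uX wX (swapl _ _ _ _ ne) (segC s1) s2'.
  split => //; first by rewrite sym'.
    by move: h3 => /and4P[-> -> -> ->].
  by exists t; split => //; apply: segC.
case=> exy euw ne [z [sz sz']].
have [A|A] := boolP ((x \in X) || (y \in X)); have [B|B] := boolP ((u \in X) || (w \in X)).
- have [k [ek|ek]] := edge_exists exy A; have [k' [ek'|ek']] := edge_exists euw B.
  + by case: (fan_fan ek ek' ne sz sz').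
  + by case: (fan_fan ek ek' (swapr _ _ _ _ ne) sz (segC sz')).
  + by case: (fan_fan ek ek' (swapl _ _ _ _ ne) (segC sz) sz').
  + by case: (fan_fan ek ek' (swapr _ _ _ _ (swapl _ _ _ _ ne)) (segC sz) (segC sz')).
- by move: B; rewrite negb_or => /andP[uX wX]; apply: half sz sz'.
- move: A; rewrite negb_or => /andP[xX yX]; apply: segs_crossC.
  apply: half sz' sz => //; move: ne => /and4P[h1 h2 h3 h4].
  by rewrite ![u == _]eq_sym ![w == _]eq_sym h1 h2 h3 h4.
move: A; rewrite negb_or => /andP[xX yX]; move: B; rewrite negb_or => /andP[uX wX].
have [e1 s1 _] := far_edge exy xX yX sz; have [e2 s2' _] := far_edge euw uX wX sz'.
split => //; last by exists z.
move: ne => /and4P[h1 h2 h3 h4].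
apply/and4P; split; [apply: contraNneq h1|apply: contraNneq h2|apply: contraNneq h3|
  apply: contraNneq h4] => /pi_inj ->; by rewrite // eqxx.
Qed.

Lemma fan_place_straight : straight e fan_place /\ forall x y u w, segs_cross e fan_place x y u w ->
  segs_cross e' pos' (pi x) (pi y) (pi u) (pi w).
Proof.
split; last exact: cross_pi.
by split; [exact: place_inj | exact: no_vertex].
Qed.

End Placed.

Theorem fan_expansion : exists pos, straight e pos /\
  forall x y u w, segs_cross e pos x y u w ->
    segs_cross e' pos' (pi x) (pi y) (pi u) (pi w).
Proof.
have [||||||sg [kap [eta fr]]] := @frame_exists p q r; try exact: dir0; try exact: not_codir.
have [dl [dl0 far]] : exists dl, 0 < dl /\ forall i : T' * T', i.1 != xi -> i.2 != xi ->
    (i.1 == i.2) || e' i.1 i.2 -> forall w, seg (pos' i.1) (pos' i.2) w -> ~ inbox v dl w.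
  apply: uniform_delta => [[a b] d d' d0 dd' hd a1 b1 ab w sw [w1 w2]|[a b] /=].
    by apply: (hd a1 b1 ab w sw); split; lra.
  have [axi|axi] := eqVneq a xi; first by exists 1; split; [lra|].
  have [bxi|bxi] := eqVneq b xi; first by exists 1; split; [lra|].
  have [ab|ab] := boolP ((a == b) || e' a b); last by exists 1; split; [lra|].
  have [|d [d0 hd]] := @seg_away v (pos' a) (pos' b); last by exists d; split.
  case/orP: ab => [/eqP E|eab]; last by apply: (proj2 str') => //; rewrite eq_sym.
  rewrite -E => -[t [_ E2]]; case/eqP: axi; apply: (proj1 str').
  by rewrite -/v E2 [LHS]surjective_pairing; congr pair; ring.
(* M dominates the sizes required for the hub and for the path; eps at most dl / (M + 1) brings the
   whole fan into the box. *)
set M := Rabs (fst r) + Rabs (snd r) + (Rabs (fst p) + Rabs (snd p) + (Rabs (fst q) + Rabs (snd q))).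
have r1 := Rabs_pos (fst r); have r2 := Rabs_pos (snd r).
have p1 := Rabs_pos (fst p); have p2 := Rabs_pos (snd p).
have q1 := Rabs_pos (fst q); have q2 := Rabs_pos (snd q).
have M0 : 0 <= M by rewrite /M; lra.
have [eps [eps0 eps1 epsM]] : exists eps, [/\ 0 < eps, eps < 1 & eps * M <= dl].
  have M1 : 0 < M + 1 by lra.
  have d1 : 0 < dl / (M + 1) by apply: Rdiv_lt_0_compat.
  exists (Rmin (1 / 2) (dl / (M + 1))); split.
  - by apply: Rmin_pos; lra.
  - by have := Rmin_l (1 / 2) (dl / (M + 1)); lra.
  have := Rmin_r (1 / 2) (dl / (M + 1)).
  have : dl / (M + 1) * (M + 1) = dl by field; lra.
  by move: d1; generalize (dl / (M + 1)) => b; generalize (Rmin (1 / 2) b) => a; nra.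
exists (fan_place kap eta eps).
apply: (fan_place_straight (dl := dl) fr eps0 eps1).
- by move=> a b a1 b1 ab; apply: (far (a, b)).
- by apply: Rle_trans epsM; rewrite /M; nra.
- by apply: Rle_trans epsM; rewrite /M; nra.
Qed.

End Expansion.

Local Close Scope R_scope.

(** * Drawings of the base graphs *)

Definition same_pair (T : finType) (x y u w x' y' u' w' : T) : Prop :=
  ([set x; y] = [set x'; y'] /\ [set u; w] = [set u'; w']) \/
  ([set x; y] = [set u'; w'] /\ [set u; w] = [set x'; y']).

Definition plane_straight (T : finType) (e : rel T) : Prop :=
  exists pos, straight e pos /\ forall x y u w, ~ segs_cross e pos x y u w.

(** Only the pair of edges has to be unique; uniqueness of the crossing point is recovered by
    [two_points]. *)
Definition near_plane_straight (T : finType) (e : rel T) : Prop :=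
  exists pos, straight e pos /\
    forall x y u w x' y' u' w', segs_cross e pos x y u w ->
      segs_cross e pos x' y' u' w' -> same_pair x y u w x' y' u' w'.

Lemma plane_near_plane (T : finType) (e : rel T) : plane_straight e -> near_plane_straight e.
Proof.
by case=> pos [str nc]; exists pos; split => // x y u w x' y' u' w' /nc.
Qed.

(** * Integer drawings checked by computation *)

Section Template.
Local Open Scope Z_scope.

Definition zorient (a b c : Z * Z) : Z :=
  (b.1 - a.1) * (c.2 - a.2) - (b.2 - a.2) * (c.1 - a.1).

Definition zsame_side (a b c d : Z * Z) : bool := 0 <? zorient a b c * zorient a b d.

(* [al] is the only pair of edges allowed to cross. *)
Definition check_drawing (cs : seq (Z * Z)) (tm : seq (nat * nat))
    (al : option ((nat * nat) * (nat * nat))) : bool :=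
  let c i := nth (0, 0) cs i in
  let n := size cs in
  [&& all (fun i => all (fun j => (i == j) || ~~ ((c i).1 =? (c j).1) || ~~ ((c i).2 =? (c j).2))
        (iota 0 n)) (iota 0 n),
      all (fun p => all (fun k => (k == p.1) || (k == p.2) ||
        ~~ (zorient (c p.1) (c p.2) (c k) =? 0)) (iota 0 n)) tm &
      all (fun p => all (fun q => [|| p.1 == q.1, p.1 == q.2, p.2 == q.1, p.2 == q.2,
        zsame_side (c p.1) (c p.2) (c q.1) (c q.2), zsame_side (c q.1) (c q.2) (c p.1) (c p.2),
        Some (p, q) == al | Some (q, p) == al]) tm) tm].

End Template.

Section TemplateDrawing.
Variables (T : finType) (e : rel T) (vs : seq T) (tm : seq (nat * nat)).
Variables (cs : seq (Z * Z)) (al : option ((nat * nat) * (nat * nat))).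
Hypotheses (sym : symmetric e) (irr : irreflexive e).
Hypothesis emb : embeds e vs tm.
Hypothesis scs : size cs = size vs.
Hypothesis chk : check_drawing cs tm al.

Local Open Scope R_scope.

Definition zpt (a : Z * Z) : R * R := (IZR a.1, IZR a.2).

Lemma orient_zpt a b c : orient (zpt a) (zpt b) (zpt c) = IZR (zorient a b c).
Proof.
by rewrite /orient /det /vsub /zpt /zorient /= !minus_IZR !mult_IZR !minus_IZR.
Qed.

Lemma seg_orient a b w : seg a b w -> orient a b w = 0.
Proof. by case=> t [_ ->]; rewrite orient_seg orient_self orientaa; ring. Qed.

(** Along the second segment the orientation interpolates between two values of the same sign, so it
    never vanishes, as it would on the line of the first. *)
Lemma same_side_disjoint a b c d w : zsame_side a b c d ->
  seg (zpt a) (zpt b) w -> seg (zpt c) (zpt d) w -> False.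
Proof.
move=> /Z.ltb_lt /IZR_lt; rewrite mult_IZR -!orient_zpt => lt /seg_orient o0 [t [ht E]].
move: o0 lt; rewrite E orient_seg; set p := orient _ _ _; set q := orient _ _ _ => o0 lt.
have p2 : 0 < p * p by have := Rle_0_sqr p; rewrite /Rsqr; nra.
have : (1 - t) * (p * p) + t * (p * q) = 0 by rewrite -[RHS](Rmult_0_r p) -o0; ring.
by have [le|ge] := Rle_lt_dec t (1 / 2); nra.
Qed.

Let cpt i : Z * Z := nth (0%Z, 0%Z) cs i.
Let pos (x : T) : R * R := zpt (cpt (index x vs)).

Let idx_lt x : (index x vs < size cs)%N.
Proof. by case: emb => _ all _; rewrite scs index_mem. Qed.

Let idx_inj : injective (fun x => index x vs).
Proof.
case: emb => _ all _ x y /= xy.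
by rewrite -(nth_index x (all x)) xy nth_index.
Qed.

Let idx_in x : index x vs \in iota 0 (size cs).
Proof. by rewrite mem_iota /= idx_lt. Qed.

Let edge_tm x y : e x y ->
  (index x vs, index y vs) \in tm \/ (index y vs, index x vs) \in tm.
Proof.
case: emb => _ all tmP exy; have [lt|gt|eq] := ltngtP (index x vs) (index y vs).
- by left; apply: tmP.
- by right; apply: tmP; rewrite // sym.
- by move: exy; rewrite (idx_inj eq) irr.
Qed.

Let pos_straight : straight e pos.
Proof.
have [/allP c1 /allP c2 _] := and3P chk.
split=> [x y [E1 E2]|x y z exy zx zy sz].
  have /allP/(_ _ (idx_in y)) := c1 _ (idx_in x).
  case/orP => [/orP[/eqP/idx_inj //|]|].
    by rewrite -/(cpt _) (eq_IZR _ _ E1) Z.eqb_refl.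
  by rewrite -/(cpt _) -/(cpt (index y vs)) (eq_IZR _ _ E2) Z.eqb_refl.
have main x1 y1 : (index x1 vs, index y1 vs) \in tm -> z != x1 -> z != y1 ->
    seg (pos x1) (pos y1) (pos z) -> False.
  move=> /c2/allP/(_ _ (idx_in z)) /= h zx1 zy1 /seg_orient.
  move: h; rewrite !(inj_eq idx_inj) (negPf zx1) (negPf zy1) /= => /negP h.
  by rewrite /pos orient_zpt => /eq_IZR E; apply: h; rewrite -/(cpt _) E.
by case: (edge_tm exy) => [/main|/main]; apply => //; apply: segC.
Qed.

Let allowed x y u w : segs_cross e pos x y u w -> exists p q, al = Some (p, q) /\
  let E a b (r : nat * nat) := (index a vs, index b vs) = r \/ (index b vs, index a vs) = r in
  (E x y p /\ E u w q) \/ (E x y q /\ E u w p).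
Proof.
have [_ _ /allP c3] := and3P chk.
case=> exy euw ne [z [sz sz']].
have main x1 y1 u1 w1 : (index x1 vs, index y1 vs) \in tm -> (index u1 vs, index w1 vs) \in tm ->
    [&& x1 != u1, x1 != w1, y1 != u1 & y1 != w1] ->
    seg (pos x1) (pos y1) z -> seg (pos u1) (pos w1) z ->
    al = Some ((index x1 vs, index y1 vs), (index u1 vs, index w1 vs)) \/
    al = Some ((index u1 vs, index w1 vs), (index x1 vs, index y1 vs)).
  move=> m1 m2 /and4P[n1 n2 n3 n4] s1 s2; have /allP/(_ _ m2) /= := c3 _ m1.
  rewrite !(inj_eq idx_inj) (negPf n1) (negPf n2) (negPf n3) (negPf n4) /=.
  case/or4P => [ss|ss|/eqP <-|/eqP <-]; [| | by left | by right].
  - by case: (same_side_disjoint ss s1 s2).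
  - by case: (same_side_disjoint ss s2 s1).
have swl (a b c d : T) : [&& a != c, a != d, b != c & b != d] ->
    [&& b != c, b != d, a != c & a != d] by move=> /and4P[-> -> -> ->].
have swr (a b c d : T) : [&& a != c, a != d, b != c & b != d] ->
    [&& a != d, a != c, b != d & b != c] by move=> /and4P[-> -> -> ->].
case: (edge_tm exy) => m1; case: (edge_tm euw) => m2.
- by case: (main _ _ _ _ m1 m2 ne sz sz') => ->; do 2 eexists; split; eauto => /=; tauto.
- case: (main _ _ _ _ m1 m2 (swr _ _ _ _ ne) sz (segC sz')) => ->;
  by do 2 eexists; split; eauto => /=; tauto.
- case: (main _ _ _ _ m1 m2 (swl _ _ _ _ ne) (segC sz) sz') => ->;
  by do 2 eexists; split; eauto => /=; tauto.
case: (main _ _ _ _ m1 m2 (swr _ _ _ _ (swl _ _ _ _ ne)) (segC sz) (segC sz')) => ->;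
by do 2 eexists; split; eauto => /=; tauto.
Qed.

Lemma template_near_plane : near_plane_straight e.
Proof.
exists pos; split => // x y u w x' y' u' w' /allowed[p [q [alE c1]]] /allowed[p' [q' [alE' c2]]].
have [pp qq] : p' = p /\ q' = q by move: alE'; rewrite alE => -[<- <-].
subst p' q'.
have setE a b a' b' r :
    (index a vs, index b vs) = r \/ (index b vs, index a vs) = r ->
    (index a' vs, index b' vs) = r \/ (index b' vs, index a' vs) = r -> [set a; b] = [set a'; b'].
  case=> <- [[/idx_inj -> /idx_inj ->]|[/idx_inj -> /idx_inj ->]] //; by rewrite setUC.
rewrite /same_pair.
by case: c1 c2 => -[h1 h2] [[h3 h4]|[h3 h4]];
  [left|right|right|left]; split; apply: setE; eassumption.
Qed.

Lemma template_plane : al = None -> plane_straight e.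
Proof.
by move=> al0; exists pos; split => // x y u w /allowed[p [q [alE _]]]; rewrite alE in al0.
Qed.

End TemplateDrawing.

Section BaseDrawings.
Local Open Scope Z_scope.

(** [check_drawing] rejects any vertex on the line through an edge, even beyond its ends, so the hub
    sits off centre. *)
Definition wheel_coords (n : nat) : seq (Z * Z) := match n with
  | 5%N => [:: (1, 2); (10, 0); (0, 11); (-10, 0); (0, -12)]
  | 6%N => [:: (1, 2); (10, 0); (0, 11); (-10, 1); (-6, -9); (5, -10)]
  | 7%N => [:: (1, 2); (10, 0); (5, 9); (-5, 9); (-10, 0); (-5, -9); (5, -9)]
  | _ => [::] end.

Lemma check_wheels : all (fun n => check_drawing (wheel_coords n) (wheel_template n) None)
  [:: 5%N; 6%N; 7%N].
Proof. by vm_compute. Qed.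

Definition k4_template : seq (nat * nat) :=
  [:: (0, 1); (0, 2); (0, 3); (1, 2); (1, 3); (2, 3)]%N.

Lemma check_k4 : check_drawing [:: (0, 0); (4, 0); (0, 4); (1, 1)] k4_template None.
Proof. by vm_compute. Qed.

(** Contracting (3, 4) turns the third template into a K_{3,3} with 0, 5, 6 on one side, so a
    crossing cannot be avoided; it is placed on (0, 2) and (1, 6). *)
Definition theta_coords : seq (seq (Z * Z) * option ((nat * nat) * (nat * nat))) :=
  [:: ([:: (1, -1); (0, 5); (-10, -8); (10, -9); (0, -12); (-10, 10); (10, 10)], None);
      ([:: (1, -1); (-4, 5); (-9, -8); (4, 6); (10, -9); (-10, 10); (10, 11)], None);
      ([:: (1, -2); (0, 5); (1, 10); (-6, -9); (7, -10); (-10, 0); (10, 1)],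
        Some ((0, 2), (1, 6))%N)].

Definition check_theta (tm : seq (nat * nat)) (p : seq (Z * Z) * option _) : bool :=
  (size p.1 == 7%N) && check_drawing p.1 tm p.2.

Lemma check_thetas : all (fun tm => has (check_theta tm) theta_coords) theta_templates.
Proof. by vm_compute. Qed.

End BaseDrawings.

Lemma embeds_size (T : finType) (e : rel T) vs tm : embeds e vs tm -> size vs = #|T|.
Proof. by case=> us all _; rewrite -(card_uniqP us); apply: eq_card => x; rewrite all. Qed.

Lemma k4_plane_straight (T : finType) (e : rel T) : symmetric e -> irreflexive e ->
  #|T| = 4 -> plane_straight e.
Proof.
move=> sym irr T4; have sT : size (enum T) = 4 by rewrite -cardT.
apply: (@template_plane _ e (enum T) k4_template _ None sym irr _ _ check_k4); rewrite ?sT //.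
split; [by rewrite enum_uniq | by move=> x; rewrite mem_enum | move=> x y _].
have : (index y (enum T) < 4)%N by rewrite -sT index_mem mem_enum.
by move: (index x _) (index y _) => [|[|[|[|i]]]] [|[|[|[|j]]]].
Qed.

Lemma one_big_straight (T : finType) (e : rel T) : uniform3 e -> #|big e| = 1 ->
  (4 < #|T| <= 7)%N -> near_plane_straight e /\ ((#|T| <= 6)%N -> plane_straight e).
Proof.
move=> ue /eqP/cards1P[h bh] /andP[T4 T7]; have [sym irr _ _] := ue.
have [b bneh] : exists b, b != h.
  have /card_gt0P[b] : (0 < #|[set~ h]|)%N by rewrite cardsC1; case: #|T| T4 => [|[|n]].
  by rewrite !inE; exists b.
have wheel : (#|T| = 7 -> 4 < deg e h)%N -> plane_straight e.
  move=> d7; have [s emb] := wheel_embedding ue bh bneh T7 d7.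
  have TI : (#|T| : nat) \in [:: 5; 6; 7]%N.
    by move: T4 T7; clear; case: #|T| => [|[|[|[|[|[|[|[|n]]]]]]]].
  apply: (template_plane sym irr emb _ (allP check_wheels _ TI)) => //.
  by rewrite (embeds_size emb); move: TI; rewrite !inE => /or3P[]/eqP ->.
have [T6|T6] := leqP #|T| 6.
  have pl : plane_straight e by apply: wheel => T7'; rewrite T7' in T6.
  by split => //; apply: plane_near_plane.
have T7E : #|T| = 7 by apply/eqP; rewrite eqn_leq T7.
split => //; have [d4|d4] := ltnP 4 (deg e h); first exact/plane_near_plane/wheel.
have d4E : deg e h = 4.
  by apply/eqP; rewrite eqn_leq d4; have := set11 h; rewrite -bh inE.
have [vs [tm [tmt emb]]] := theta_embedding ue bh T7E d4E.
have [[cs al] /andP[/eqP sc ck]] : exists p, check_theta tm p.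
  have /allP/(_ _ tmt) := check_thetas; elim: theta_coords => //= p ps IH.
  by case/orP => [|/IH //]; exists p.
by apply: (template_near_plane sym irr emb _ ck); rewrite (embeds_size emb) T7E.
Qed.

(** * Drawing by induction on leaves *)

Lemma wheel_template_rim n i j : (i.+2, j.+2) \in wheel_template n -> j = i.+1.
Proof.
rewrite /wheel_template !mem_cat => /or3P[/mapP[k _ []]|/mapP[k _ [E1 E2]]|] //.
by lia.
Qed.

Lemma wheel_template_out n j : (1, j.+2) \in wheel_template n -> j = 0 \/ j.+2 = n.-1.
Proof.
rewrite /wheel_template !mem_cat => /or3P[/mapP[k _ []]|/mapP[k _ [E1 E2]]|] //.
  by left; lia.
by rewrite inE => /eqP[]; right.
Qed.

Lemma deg_le_seq (T : finType) (e : rel T) x (l : seq T) :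
  (forall y, e x y -> y \in l) -> deg e x <= size l.
Proof.
move=> xl; apply: leq_trans (card_size l); apply: subset_leq_card.
by apply/subsetP => y; rewrite inE => /xl.
Qed.

Lemma lift_seq (T : finType) (X : {set T}) (s : seq (quot X)) : None \notin s ->
  exists t, s = map (@qproj T X) t /\ all (fun x => x \notin X) t.
Proof.
elim: s => [|a s IH]; first by exists [::].
rewrite inE negb_or eq_sym => /andP[aN /IH[t [-> tX]]].
by have [x xX <-] := qproj_some aN; exists (x :: t); rewrite /= xX.
Qed.

Section Leaf.
Variables (T : finType) (e : rel T) (Y : {set T}).
Hypotheses (ue : uniform3 e) (b1 : 1 < #|big e|).
Hypotheses (bY : boundary e Y <= 3) (Y1 : #|Y :&: big e| = 1) (Y5 : #|Y| <= 5).

Let sym : symmetric e. Proof. by case: ue. Qed.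
Let irr : irreflexive e. Proof. by case: ue. Qed.
Let YT : Y != setT. Proof. exact: leaf_proper Y1 b1. Qed.
Let Y4 : 4 <= #|Y|. Proof. exact: (leaf_card ue YT bY Y1). Qed.
Let Yg : 1 < #|Y|. Proof. exact: leq_trans Y4. Qed.
Let Yc : 1 < #|~: Y|. Proof. exact: (leaf_complement_gt1 ue bY Y1 b1). Qed.
Let Ycc : 1 < #|~: ~: Y|. Proof. by rewrite setCK. Qed.
Let bYc : boundary e (~: Y) <= 3. Proof. by rewrite boundaryC. Qed.

Let e2 := @qrel T e (~: Y).
Let pr2 := @qproj T (~: Y).
Let u2 : uniform3 e2 := uniform3_qrel ue Yc Ycc bYc.

(** Contracting the complement of Y leaves at most 6 vertices with one big vertex among them, hence
    a wheel with [None] on its rim; without [None], the hub and a path remain. *)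
Lemma leaf_fan : exists h s,
  [/\ uniq (h :: s), forall x, (x \in h :: s) = (x \in Y),
      forall x y, x \in s -> y \in s -> e x y ->
        index y s = (index x s).+1 \/ index x s = (index y s).+1 &
      (exists z, z \notin Y /\ e h z) /\
      (forall x y, x \in s -> y \notin Y -> e x y -> index x s = 0 \/ index x s = (size s).-1) /\
      (forall i, i = 0 \/ i = (size s).-1 -> exists z, z \notin Y /\ e (nth h s i) z)] /\
  size s = #|Y|.-1.
Proof.
have [sym2 irr2 _ _] := u2.
have cT2 : #|quot (~: Y)| = #|Y|.+1 by rewrite card_quot setCK.
have NB : None \notin big e2 by rewrite inE -leqNgt; apply: deg_qrel_None.
have b2 : #|big e2| = 1.
  have := card_big_qrel ue Yc Ycc bYc; have := cardsID Y (big e).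
  by rewrite setIC Y1 setDE setIC; rewrite -/e2; clear; lia.
have /eqP/cards1P[h2 bh2] := b2.
have Nh : None != h2 by apply: contraNneq NB => ->; rewrite bh2 set11.
have [||s2 emb] := wheel_embedding u2 bh2 Nh.
- by rewrite cT2; move: Y5; clear; lia.
- by rewrite cT2; move: Y5; clear; lia.
have [us2 all2 tm2] := emb.
have [t [tE tX]] : exists t, h2 :: s2 = map pr2 t /\ all (fun x => x \notin ~: Y) t.
  apply: lift_seq; move: us2; rewrite /= !inE !negb_or => /andP[/andP[_ _] /andP[Ns2 _]].
  by rewrite Nh Ns2.
case: t tE tX => [|h s] //= [h2E s2E] /andP[hY sY]; subst h2 s2.
rewrite inE negbK in hY.
have {}sY x : x \in s -> x \in Y by move/(allP sY); rewrite inE negbK.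
have prN x : x \in Y -> pr2 x != None by rewrite /pr2 qproj_in inE negbK.
have prO x : x \notin Y -> pr2 x = None by move=> xY; apply/eqP; rewrite qproj_in inE.
have pr_inj x y : x \in Y -> pr2 x = pr2 y -> x = y.
  by move=> xY; apply: qproj_out; rewrite inE negbK.
have pr_in x (l : seq T) : x \in Y -> (pr2 x \in map pr2 l) = (x \in l).
  move=> xY; apply/mapP/idP => [[y yl /(pr_inj x y xY) -> //]|xl]; by exists x.
have us : uniq (h :: s).
  move: us2; rewrite /= !inE !negb_or => /and3P[/andP[_ h1] _ /map_uniq ->].
  by move: h1; rewrite pr_in // => ->.
have inhs x : (x \in h :: s) = (x \in Y).
  apply/idP/idP; first by rewrite inE => /predU1P[->|/sY].
  move=> xY; have := all2 (pr2 x); rewrite !inE (negPf (prN x xY)) /= pr_in //.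
  by case/predU1P => [/(pr_inj x h xY) ->|->]; rewrite ?eqxx ?orbT.
have ss : size s = #|Y|.-1.
  have <- : size (h :: s) = #|Y|.
    by rewrite -(card_uniqP us); apply: eq_card => x; rewrite inhs.
  by [].
set ws := [:: pr2 h, None & map pr2 s] in emb us2 all2 tm2.
have hs : h \notin s by case/andP: us.
(* The hub and [None] occupy the first two positions of [ws]. *)
have idx x : x \in s -> index (pr2 x) ws = (index x s).+2.
  move=> xs; rewrite /ws /=.
  have -> : (pr2 h == pr2 x) = false.
    by apply/negP => /eqP /(pr_inj h x hY) E; rewrite E xs in hs.
  have -> : (None == pr2 x) = false by rewrite eq_sym; apply/negbTE/prN/sY.
  congr _.+2; elim: (s) (sY) => //= y l IH lY.
  have -> : (pr2 y == pr2 x) = (y == x).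
    by apply/eqP/eqP => [/(pr_inj y x (lY y (mem_head _ _)))|->].
  by case: eqP => // _; congr _.+1; apply: IH => z zl; apply: lY; rewrite inE zl orbT.
have idxN : index None ws = 1.
  by rewrite /ws /=; have /negPf -> : pr2 h != None by apply: prN.
have e2e x y : x \in Y -> e x y -> x != y -> e2 (pr2 x) (pr2 y).
  by move=> xY exy xy; apply: qrel_proj => //; apply: contraNneq xy => /(pr_inj x y xY) ->.
have out x : x \in s -> e2 None (pr2 x) -> index x s = 0 \/ index x s = (size s).-1.
  move=> xs ex; have := tm2 _ _ ex; rewrite idxN idx // => /(_ isT) /wheel_template_out.
  by rewrite cT2 ss; case=> [->|E]; [left | right; move: E; clear; lia].
have s1 : 1 < size s by rewrite ss; move: Y4; clear; lia.
have d3 : deg e2 None = 3.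
  apply/eqP; rewrite eqn_leq (deg_ge3 u2) ?andbT; last by rewrite cT2; move: Yg; clear; lia.
  by apply: deg_qrel_None.
have nb a : e2 None a -> a \in [:: pr2 h; pr2 (nth h s 0); pr2 (nth h s (size s).-1)].
  move=> ea; have := all2 a; rewrite /ws !inE => /or3P[->//|/eqP E|/mapP[x xs E]].
    by rewrite E irr2 in ea.
  subst a; have [E|E] := out x xs ea; rewrite -E nth_index // eqxx ?orbT //.
(* The embedding bounds edges only from above. As [None] has degree 3 and just three possible
   neighbours, the hub and the two ends of the path, all three occur. *)
have nb3 i : i < 3 ->
    e2 None (nth None [:: pr2 h; pr2 (nth h s 0); pr2 (nth h s (size s).-1)] i).
  move=> i3; apply: contraT => ne.
  set l := [:: _; _; _] in nb ne.
  have : deg e2 None <= size (rem (nth None l i) l).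
    apply: deg_le_seq => a ea; have al := nb a ea.
    have ai : a != nth None l i by apply: contraNneq ne => <-.
    have : a \in nth None l i :: rem (nth None l i) l.
      by rewrite -(perm_mem (perm_to_rem (mem_nth None (i3 : i < size l)))).
    by rewrite inE (negPf ai).
  by rewrite d3 size_rem ?mem_nth.
have outz x : x \in Y -> e2 None (pr2 x) -> exists z, z \notin Y /\ e x z.
  move=> xY /andP[_ /existsP[z /existsP[y /and3P[/eqP zN /eqP yx ezy]]]].
  have xy : y = x by apply/esym/pr_inj.
  exists z; rewrite sym -xy; split => //.
  by apply/negP => zY; move: (prN z zY); rewrite /pr2 zN.
exists h, s; split => //; split => //.
  move=> x y xs ys exy; have xy : x != y by apply: contraTneq exy => ->; rewrite irr.
  have ex := e2e x y (sY x xs) exy xy.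
  have [lt|gt|E] := ltngtP (index x s) (index y s).
  - by left; have := tm2 _ _ ex; rewrite !idx // !ltnS => /(_ lt) /wheel_template_rim.
  - right; rewrite sym2 in ex.
    by have := tm2 _ _ ex; rewrite !idx // !ltnS => /(_ gt) /wheel_template_rim.
  - by move: xy; rewrite -(nth_index h xs) E nth_index // eqxx.
split; first by apply: outz; rewrite // (nb3 0).
split.
  move=> x y xs yY exy; apply: out => //; rewrite sym2 -(prO y yY); apply: e2e => //; first exact: sY.
  by apply: contraTneq exy => ->; rewrite irr.
move=> i [->|->]; apply: outz.
- by apply: sY; apply: mem_nth; apply: ltnW.
- exact: (nb3 1).
- by apply: sY; apply: mem_nth; case: (size s) s1.
- exact: (nb3 2).
Qed.

Let e1 := @qrel T e Y.
Let pr1 := @qproj T Y.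

(** The edges across Y form a matching, so no two edges are identified; this lifts uniqueness of the
    crossing pair from the quotient. *)
Let pr1_edge x y x' y' : e x y -> e x' y' -> pr1 x = pr1 x' -> pr1 y = pr1 y' ->
  pr1 x != pr1 y -> x = x' /\ y = y'.
Proof.
move=> exy exy' xx yy ne.
have inY z : (pr1 z == None) = (z \in Y) by apply: qproj_in.
have [xY|xY] := boolP (x \in Y).
  have yY : y \notin Y by move: ne; rewrite -!inY; move: xY; rewrite -inY => /eqP ->; rewrite eq_sym.
  move/(qproj_out yY): yy => yy; subst y'; split => //.
  by apply: (matching_in ue Yg Yc bY yY) => //; rewrite -?inY -?xx ?inY // sym.
move/(qproj_out xY): xx => xx; subst x'; split => //.
have [yY|yY] := boolP (y \in Y); last by apply: (qproj_out yY).
by apply: (matching_in ue Yg Yc bY xY) => //; rewrite -inY -yy inY.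
Qed.

Let pr1_pair x y x' y' : e x y -> e x' y' -> pr1 x != pr1 y ->
  [set pr1 x; pr1 y] = [set pr1 x'; pr1 y'] -> [set x; y] = [set x'; y'].
Proof.
move=> exy exy' ne E.
have : pr1 x \in [set pr1 x'; pr1 y'] by rewrite -E !inE eqxx.
have : pr1 y \in [set pr1 x'; pr1 y'] by rewrite -E !inE eqxx orbT.
rewrite !inE => /orP[]/eqP yE /orP[]/eqP xE.
- by rewrite xE yE eqxx in ne.
- by rewrite sym in exy'; have [-> ->] := pr1_edge exy exy' xE yE ne; rewrite setUC.
- by have [-> ->] := pr1_edge exy exy' xE yE ne.
- by rewrite xE yE eqxx in ne.
Qed.

Lemma leaf_expansion pos' : straight e1 pos' -> exists pos, straight e pos /\
  forall x y u w, segs_cross e pos x y u w ->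
    segs_cross e1 pos' (pr1 x) (pr1 y) (pr1 u) (pr1 w).
Proof.
move=> str'; have [h [s [[us inhs e_rim [[zh [zhY ehz]] [e_out zs]]] ss]]] := leaf_fan.
have [z0 [z0Y ez0]] := zs 0 (or_introl erefl).
have [z1 [z1Y ez1]] := zs (size s).-1 (or_intror erefl).
have s1 : 1 < size s by rewrite ss; move: Y4; clear; lia.
have hY : h \in Y by rewrite -inhs mem_head.
have sY i : i < size s -> nth h s i \in Y by move=> it; rewrite -inhs inE mem_nth ?orbT.
have s0 : 0 < size s by apply: ltnW.
have sl : (size s).-1 < size s by case: (size s) s0.
have inY z : (pr1 z == None) = (z \in Y) by apply: qproj_in.
have exo z x : x \in Y -> z \notin Y -> e x z -> e1 None (pr1 z).
  move=> xY zY exz; have /eqP <- : pr1 x == None by rewrite inY.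
  apply: qrel_proj => //; apply: contraNneq zY => E; by rewrite -inY /pr1 -E -/(pr1 x) inY.
have uniqz x z z' : x \in Y -> z \notin Y -> z' \notin Y -> e x z -> e x z' -> z = z'.
  by move=> xY; apply: (matching_uniq ue Yg YT bY xY).
(* Different fan vertices have different outer neighbours, again by the matching property; this
   makes the three legs distinct. *)
have neq x x' z z' : x \in Y -> x' \in Y -> z \notin Y -> e x z -> e x' z' -> x != x' ->
    pr1 z != pr1 z'.
  move=> xY x'Y zY exz exz'; apply: contraNneq => /(qproj_out zY) E; subst z'.
  by apply/eqP/(matching_in ue Yg Yc bY zY); rewrite // sym.
have hs : h \notin s by case/andP: us.
have us' : uniq s by case/andP: us.
apply: (@fan_expansion T _ e e1 pr1 None h s (pr1 zh) (pr1 z0) (pr1 z1) sym irr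
  (qrel_sym ue) (@qrel_irr T e Y) us s1).
- by move=> t; rewrite inhs inY.
- by move=> t t'; rewrite inhs; apply: qproj_out.
- by move=> x y exy ne; apply: qrel_proj.
- exact: e_rim.
- move=> x y; rewrite !inhs -inhs inE => /predU1P[->|xs] yY exy.
    by constructor 1; split => //; rewrite (uniqz h y zh).
  have xY : x \in Y by rewrite -inhs inE xs orbT.
  have [E|E] := e_out x y xs yY exy; [constructor 2|constructor 3]; split => //; split => //.
    by rewrite (uniqz x y z0) // -(nth_index h xs) E.
  by rewrite (uniqz x y z1) // -(nth_index h xs) E.
- exact: exo ehz.
- by apply: exo ez0; rewrite // sY.
- by apply: exo ez1; rewrite // sY.
- by apply: neq ez0 ez1 _; rewrite ?sY // nth_uniq //; case: (size s) s1 => // -[].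
- by apply: neq ez0 ehz _; rewrite ?sY //; apply: contraNneq hs => <-; apply: mem_nth.
- by apply: neq ez1 ehz _; rewrite ?sY //; apply: contraNneq hs => <-; apply: mem_nth.
exact: str'.
Qed.

Lemma leaf_plane : plane_straight e1 -> plane_straight e.
Proof.
case=> pos' [/leaf_expansion[pos [str cr]] nc]; exists pos; split => // x y u w /cr.
exact: nc.
Qed.

Lemma leaf_near_plane : near_plane_straight e1 -> near_plane_straight e.
Proof.
case=> pos' [/leaf_expansion[pos [str cr]] one]; exists pos; split => //.
move=> x y u w x' y' u' w' c c'; have h := one _ _ _ _ _ _ _ _ (cr _ _ _ _ c) (cr _ _ _ _ c').
have ne a b : e1 (pr1 a) (pr1 b) -> pr1 a != pr1 b by case/andP.
have [/ne xy /ne uw _ _] := cr _ _ _ _ c.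
case: c c' => exy euw _ _ [exy' euw' _ _].
by case: h => -[h1 h2]; [left|right]; split; apply: pr1_pair.
Qed.

End Leaf.

(** Without big vertices the bounds force n = 4; with one, n lies between 5 and 7. Otherwise a leaf
    is contracted, and n - 3b does not grow. *)
Theorem straight_drawing (T : finType) (e : rel T) : uniform3 e -> 1 < #|T| ->
  #|T| <= 3 * #|big e| + 4 ->
  near_plane_straight e /\ (#|T| = 4 \/ #|T| <= 3 * #|big e| + 3 -> plane_straight e).
Proof.
move: {2}#|T|.+1 (ltnSn #|T|) => n; elim: n T e => // n IH T e Tn ue T1 Tb.
have [sym irr _ _] := ue; have T4 := card_ge4 ue T1.
have lb := card_big_le ue T1.
have [b0|b0] := posnP #|big e|.
  have T4E : #|T| = 4 by move: Tb T4; rewrite b0; clear; lia.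
  have pl := k4_plane_straight sym irr T4E.
  by split => //; apply: plane_near_plane.
have [b1|b1] := leqP #|big e| 1.
  have b1E : #|big e| = 1 by move: b0 b1; clear; lia.
  have [|h1 h2] := one_big_straight ue b1E; first by move: lb Tb; rewrite b1E; clear; lia.
  by split => // h; apply: h2; move: h; rewrite b1E; clear; lia.
have [Y [bY Y1 Y5]] := small_leaf ue b1 Tb.
have YT := leaf_proper Y1 b1.
have Y4 := leaf_card ue YT bY Y1.
have Yg : 1 < #|Y| by apply: leq_trans Y4.
have Yc := leaf_complement_gt1 ue bY Y1 b1.
have cb := card_big_qrel ue Yg Yc bY; rewrite Y1 in cb.
have cY := cardsC Y; have cq := card_quot Y.
have [|||h1 h2] := IH _ _ _ (uniform3_qrel ue Yg Yc bY).
- by move: cY cq Tn Y4; clear; lia.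
- by move: cq Yc; clear; lia.
- by move: cY cq Tb cb Y4; clear; lia.
split; first exact: (leaf_near_plane ue b1 bY Y1 Y5).
(* With two big vertices n is at least 8, so the hypothesis says n <= 3b + 3, and the quotient
   inherits it because the leaf has at least 4 vertices. *)
move=> h; apply: (leaf_plane ue b1 bY Y1 Y5); apply: h2; right.
by move: h cY cq lb cb Y4 b1; clear; lia.
Qed.

(** * From straight-line drawings to curves *)

Section StraightArcs.
Local Open Scope R_scope.
Variables (T : finType) (e : rel T) (pos : T -> R * R).
Hypotheses (sym : symmetric e) (irr : irreflexive e) (str : straight e pos).

Definition line (a b : R * R) (t : R) : R * R :=
  (fst a + t * (fst b - fst a), snd a + t * (snd b - snd a)).

Definition straight_arc (x y : T) : R -> R * R := line (pos x) (pos y).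

Let pos_inj : injective pos. Proof. exact: proj1 str. Qed.

Let edge_neq x y : e x y -> x <> y.
Proof. by move=> exy E; rewrite E irr in exy. Qed.

Lemma line_inj a b s t : a <> b -> line a b s = line a b t -> s = t.
Proof.
case: a b => a1 a2 [b1 b2] ab [/= E1 E2].
have h1 : (s - t) * (b1 - a1) = 0 by lra.
have h2 : (s - t) * (b2 - a2) = 0 by lra.
have [st|st] := Req_dec (s - t) 0; first lra.
case: ab; case: (Rmult_integral _ _ h1) => //; case: (Rmult_integral _ _ h2) => // e2 e1.
by congr pair; lra.
Qed.

Lemma line0 a b : line a b 0 = a.
Proof. by case: a => x y; rewrite /line /=; congr pair; ring. Qed.

Lemma line1 a b : line a b 1 = b.
Proof. by case: b => x y; rewrite /line /=; congr pair; ring. Qed.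

Lemma straight_is_drawing : is_drawing e pos straight_arc.
Proof.
split; first exact: pos_inj.
move=> x y exy; have pxy : pos x <> pos y by move=> /pos_inj; apply: edge_neq.
split; [|split; [|split; [|split; [|split]]]].
- move=> t; split; rewrite /straight_arc /line /=; reg.
- exact: line0.
- exact: line1.
- by move=> s t _ _; apply: line_inj.
- move=> t z ht E; have [zx|zx] := eqVneq z x.
    have t0 : t = 0 by apply: (line_inj pxy); rewrite line0; apply: etrans E _; rewrite zx.
    by lra.
  have [zy|zy] := eqVneq z y.
    have t0 : t = 1 by apply: (line_inj pxy); rewrite line1; apply: etrans E _; rewrite zy.
    by lra.
  by apply: (proj2 str x y z exy zx zy); exists t; split; [lra | rewrite -E].
by move=> t; rewrite /straight_arc /line; congr pair; ring.
Qed.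

Let common_end a b c w : e a b -> e a c -> b <> c -> seg (pos a) (pos b) w ->
  seg (pos a) (pos c) w -> w <> pos a -> False.
Proof.
move=> eab eac bc s1 s2 wa.
have ba : b != a by apply/eqP => E; case: (edge_neq eab).
have ca : c != a by apply/eqP => E; case: (edge_neq eac).
case: (seg_common s1 s2 wa); apply: (proj2 str) => //; by apply/eqP => // /esym.
Qed.

Let open_end a b s w : e a b -> 0 < s < 1 -> straight_arc a b s = w ->
  [/\ seg (pos a) (pos b) w, w <> pos a & w <> pos b].
Proof.
move=> eab hs <-; have pab : pos a <> pos b by move=> /pos_inj; apply: edge_neq.
split; first by exists s; split; [lra|].
  by move=> E; have : s = 0 by [apply: (line_inj pab); rewrite line0]; lra.
by move=> E; have : s = 1 by [apply: (line_inj pab); rewrite line1]; lra.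
Qed.

Lemma crossing_segs p x y u w : crossing e straight_arc p x y u w ->
  [/\ segs_cross e pos x y u w, seg (pos x) (pos y) p & seg (pos u) (pos w) p].
Proof.
case=> exy euw ne [s [hs /(open_end exy hs)[s1 px py]]] [t [ht /(open_end euw ht)[s2 pu pw]]].
split => //; split => //; last by exists p.
have eyx : e y x by rewrite sym.
have ewu : e w u by rewrite sym.
apply/and4P; split; apply/eqP => E; subst.
- apply: (common_end exy euw _ s1 s2 px) => E; apply: ne; by rewrite E.
- apply: (common_end exy ewu _ s1 (segC s2) px) => E; apply: ne; by rewrite E setUC.
- apply: (common_end eyx euw _ (segC s1) s2 py) => E; apply: ne; by rewrite E setUC.
- apply: (common_end eyx ewu _ (segC s1) (segC s2) py) => E; apply: ne; by rewrite E.
Qed.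

(** Two shared points make all four ends collinear. The parameters [al] and [be] of u and w on the
    line xy lie outside [0, 1], yet a shared point lies between them, so they lie on opposite sides
    and x is on the edge uw. *)
Let two_points x y u w a b : segs_cross e pos x y u w ->
  seg (pos x) (pos y) a -> seg (pos u) (pos w) a ->
  seg (pos x) (pos y) b -> seg (pos u) (pos w) b -> a = b.
Proof.
case=> exy euw /and4P[xu xw yu yw] _ sa [t1 [ht1 aE]] sb [t2 [ht2 bE]].
have [E|ne] := Req_dec t1 t2; first by rewrite aE bE E.
exfalso.
have pxy : pos x <> pos y by move=> /pos_inj; apply: edge_neq.
have d0 : vsub (pos y) (pos x) <> (0, 0).
  case=> E1 E2; apply: pxy; rewrite [pos x]surjective_pairing [pos y]surjective_pairing.
  by congr pair; lra.
have ou1 := seg_orient sa; rewrite aE orient_seg in ou1.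
have ou2 := seg_orient sb; rewrite bE orient_seg in ou2.
have ou : orient (pos x) (pos y) (pos u) = 0 by nra.
have ow : orient (pos x) (pos y) (pos w) = 0 by nra.
have param z : z != x -> orient (pos x) (pos y) (pos z) = 0 ->
    exists al, pos z = line (pos x) (pos y) al.
  move=> zx oz; have z0 : vsub (pos z) (pos x) <> (0, 0).
    case=> E1 E2; case/eqP: zx; apply: pos_inj.
    by rewrite [pos z]surjective_pairing [pos x]surjective_pairing; congr pair; lra.
  have oz' : det (vsub (pos z) (pos x)) (vsub (pos y) (pos x)) = 0.
    by move: oz; rewrite /orient /det; lra.
  have back l : vsub (pos z) (pos x) = vscale l (vsub (pos y) (pos x)) ->
      pos z = line (pos x) (pos y) l.
    rewrite /vsub /vscale /line /= => -[E1 E2]; rewrite [LHS]surjective_pairing.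
    by congr pair; lra.
  by case: (parallel_cases z0 d0 oz') => -[l [_ /back E]]; [exists (- l) | exists l].
have ux : u != x by rewrite eq_sym.
have wx : w != x by rewrite eq_sym.
have uy : u != y by rewrite eq_sym.
have wy : w != y by rewrite eq_sym.
have [al uE] := param u ux ou; have [be wE] := param w wx ow.
have na : ~ 0 <= al <= 1.
  by move=> h; apply: (proj2 str x y u exy ux uy); exists al; split.
have nb : ~ 0 <= be <= 1.
  by move=> h; apply: (proj2 str x y w exy wx wy); exists be; split.
case: sa => s [hs aE'].
have sE : s = al + t1 * (be - al).
  apply: (line_inj pxy); rewrite -[LHS]aE' aE uE wE /line /=.
  by congr pair; ring.
have nx : ~ exists t, 0 <= t <= 1 /\ al + t * (be - al) = 0.
  case=> t [ht E]; apply: (proj2 str u w x euw xu xw); exists t; split => //.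
  rewrite uE wE /line /= [LHS]surjective_pairing.
  have E3 : forall c d, c + al * (d - c) + t * (c + be * (d - c) - (c + al * (d - c))) =
      c + (al + t * (be - al)) * (d - c) by move=> c d; ring.
  by rewrite !E3 E; congr pair; ring.
apply: nx; have ab : be - al <> 0.
  by move=> ab; apply: na; rewrite ab in sE; lra.
exists (- al / (be - al)); split; last by field.
have hyp : (al < 0 /\ 1 < be) \/ (1 < al /\ be < 0).
  have [a0|a0] := Rlt_le_dec al 0; have [b0|b0] := Rlt_le_dec be 0.
  - exfalso; nra.
  - left; split => //; apply: Rnot_le_lt => h; apply: nb; lra.
  - right; split => //; apply: Rnot_le_lt => h; apply: na; lra.
  - have a1 : 1 < al by apply: Rnot_le_lt => h; apply: na; lra.
    have b1 : 1 < be by apply: Rnot_le_lt => h; apply: nb; lra.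
    exfalso; nra.
set q := - al / (be - al); have qE : q * (be - al) = - al by rewrite /q; field.
by case: hyp => h; split; nra.
Qed.

Lemma plane_no_crossing : (forall x y u w, ~ segs_cross e pos x y u w) ->
  no_crossing e straight_arc.
Proof. by move=> nc p x y u w /crossing_segs[/nc]. Qed.

Let seg_set x y x' y' p : [set x; y] = [set x'; y'] -> seg (pos x') (pos y') p ->
  x' <> y' -> seg (pos x) (pos y) p.
Proof.
move=> E s ne.
have h1 : x' \in [set x; y] by rewrite E !inE eqxx.
have h2 : y' \in [set x; y] by rewrite E !inE eqxx orbT.
move: h1 h2; rewrite !inE => /orP[]/eqP E1 /orP[]/eqP E2; subst => //.
exact: segC.
Qed.

Lemma near_plane_one_crossing :
  (forall x y u w x' y' u' w', segs_cross e pos x y u w ->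
      segs_cross e pos x' y' u' w' -> same_pair x y u w x' y' u' w') ->
  at_most_one_crossing e straight_arc.
Proof.
move=> one p x y u w p' x' y' u' w' /crossing_segs[c s1 s2] /crossing_segs[c' s1' s2'].
have h := one _ _ _ _ _ _ _ _ c c'; split; last exact: h.
have n1 : x' <> y' by case: c' => /edge_neq.
have n2 : u' <> w' by case: c' => _ /edge_neq.
by case: h => -[E1 E2]; apply: (two_points c s1 s2); apply: seg_set; eassumption.
Qed.

End StraightArcs.

Lemma near_plane_cr_le1 (T : finType) (e : rel T) : symmetric e -> irreflexive e ->
  near_plane_straight e -> cr_le1 e.
Proof.
move=> sym irr [pos [str one]]; exists pos, (straight_arc pos); split.
  exact: straight_is_drawing.
exact: near_plane_one_crossing.
Qed.

Lemma plane_planar (T : finType) (e : rel T) : symmetric e -> irreflexive e ->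
  plane_straight e -> planar e.
Proof.
move=> sym irr [pos [str nc]]; exists pos, (straight_arc pos); split.
  exact: straight_is_drawing.
exact: plane_no_crossing.
Qed.

(** The minimum degree is 3 and is attained, so the vertices of minimum degree are those outside
    [big e]. *)
Lemma nu_uniform3 (T : finType) (e : rel T) : uniform3 e -> 1 < #|T| ->
  nu e + #|big e| = #|T|.
Proof.
move=> ue T1; rewrite -(cardsC (big e)) addnC; congr (_ + _); apply: eq_card => v.
rewrite !inE -leqNgt; have [x x3] := exists_cubic ue T1.
apply/forallP/idP => [/(_ x)|v3 w]; first by rewrite x3.
exact: leq_trans v3 (deg_ge3 ue w T1).
Qed.

Theorem theorem18 (T : finType) (e : rel T) (k : nat) (l : Z) :
  simple_graph e ->
  uniformly_connected e 3 ->
  (nu e = (2 * #|T| + 4) %/ 3)%nat ->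
  (4 <= #|T|)%N ->
  (l = (-1)%Z \/ l = 0%Z \/ l = 1%Z) ->
  Z.of_nat #|T| = (3 * Z.of_nat k + l)%Z ->
  cr_le1 e /\ (((#|T| = 4)%nat \/ l = (-1)%Z \/ l = 0%Z) -> planar e).
Proof.
move=> [sym irr] uc nuE T4 lE TE.
have ue : uniform3 e.
  by split => //; [apply: uniformly_connected_three | apply: uniformly_connected_separable].
have T1 : (1 < #|T|)%N by apply: leq_trans T4.
have nb := nu_uniform3 ue T1.
have [|near pl] := straight_drawing ue T1.
  (* The extremal value is (2n + 2)/3 rounded up; since it equals n - b, b is (n - 2)/3 rounded
     down, and n <= 3b + 4. *)
  by move: nuE nb; clear; lia.
split; first exact: near_plane_cr_le1.
move=> h; apply: plane_planar => //; apply: pl; case: h => [h|h]; [left|right] => //.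
(* For l = -1 and l = 0 the remainder n - 3b - 2 is 0 and 1. *)
by move: nuE nb lE TE h; clear; lia.
Qed.
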